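(* Let $N\ge 7$ and $\frac{N(N-2)}{4}<\lambda<\left(\frac{N-1}{2}\right)^2$. Then the equation $$-\Delta_{\mathbb{B}^N}u-\lambda u=|u|^{2^*-2}u,\qquad u\in H^1(\mathbb{B}^N),$$ has infinitely many distinct nontrivial radial sign-changing (weak) solutions.
   Context: $\mathbb{B}^N=\{x\in\mathbb{R}^N:|x|<1\}$ with the hyperbolic metric $g_{ij}=\left(\frac{2}{1-|x|^2}\right)^2\delta_{ij}$; $dV_{\mathbb{B}^N}=\left(\frac{2}{1-|x|^2}\right)^N dx$; $|\nabla_{\mathbb{B}^N}u|_g^2=\left(\frac{1-|x|^2}{2}\right)^2|\nabla u|^2$; $\Delta_{\mathbb{B}^N}u=\left(\frac{1-|x|^2}{2}\right)^2\Delta u+(N-2)\frac{1-|x|^2}{2}\,x\cdot\nabla u$. $H^1(\mathbb{B}^N)$ is the completion of $C_c^\infty(\mathbb{B}^N)$ under $\left(\int(|\nabla_{\mathbb{B}^N}u|_g^2+u^2)\,dV_{\mathbb{B}^N}\right)^{1/2}$; $2^*=\frac{2N}{N-2}$. Radial means $u(x)$ depends only on $|x|$; sign-changing means $u$ takes both strictly positive and strictly negative values. *)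

(* Defs.v *)
From HB Require Import structures.
From mathcomp Require Import all_boot all_order all_algebra.
From mathcomp Require Import all_classical all_reals all_analysis.
Set Implicit Arguments. Unset Strict Implicit. Unset Printing Implicit Defensive.
Import Order.TTheory GRing.Theory Num.Theory.
Import numFieldNormedType.Exports.
Local Open Scope classical_set_scope.
Local Open Scope ring_scope.

Section HypBall.
Variables (R : realType) (N : nat).
Local Notation V := 'rV[R]_N.

Definition sqn (x : V) : R := \sum_(i < N) (x ord0 i) ^+ 2.
Definition edot (x y : V) : R := \sum_(i < N) x ord0 i * y ord0 i.
Definition inball (x : V) : Prop := sqn x < 1.
Definition confac (x : V) : R := 2 / (1 - sqn x).

(* iterated Lebesgue integral over R^k of a [0,+oo]-valued function of the
   coordinates; coordinate k-1 is integrated outermost (Tonelli). *)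
Fixpoint iter_int (k : nat) (g : (nat -> R) -> \bar R) : \bar R :=
  match k with
  | 0 => g (fun _ => 0)
  | k'.+1 => (\int[@lebesgue_measure R]_(t in [set: R])
               iter_int k' (fun y => g (fun i => if i == k' then t else y i)))%E
  end.

Definition int_nn (f : V -> \bar R) : \bar R :=
  iter_int N (fun y => f (\row_(i < N) y (nat_of_ord i))).

(* hyperbolic volume integral over B^N (dV = (2/(1-|x|^2))^N dx) of |f| *)
Definition hint_abs (f : V -> R) : \bar R :=
  int_nn (fun x => if asbool (inball x) then (`|f x| * confac x ^+ N)%:E else 0%E).

Definition hintegrable (f : V -> R) : Prop := (hint_abs f < +oo)%E.

Definition hint (f : V -> R) : R :=
  fine (int_nn (fun x => if asbool (inball x) then (Num.max (f x) 0 * confac x ^+ N)%:E else 0%E))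
  - fine (int_nn (fun x => if asbool (inball x) then (Num.max (- f x) 0 * confac x ^+ N)%:E else 0%E)).

Definition ball_meas (A : set V) : \bar R :=
  int_nn (fun x => if asbool (inball x /\ A x) then 1%E else 0%E).

Definition borel_fun (f : V -> R) : Prop :=
  forall B : set R, measurable B -> <<s [set A : set V | open A] >> (f @^-1` B).
Definition borel_vfun (G : V -> V) : Prop :=
  forall i : 'I_N, borel_fun (fun x => G x ord0 i).

Fixpoint iterD (vs : seq V) (f : V -> R) : V -> R :=
  match vs with
  | [::] => f
  | v :: vs' => 'D_v (iterD vs' f)
  end.

Definition Cc_inf (phi : V -> R) : Prop :=
  (forall (vs : seq V) (x : V), differentiable (iterD vs phi) x) /\
  exists r : R, r < 1 /\ forall x : V, r <= sqn x -> phi x = 0.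

Definition egrad (f : V -> R) (x : V) : V :=
  \row_(i < N) 'D_(delta_mx ord0 i) f x.

(* (u, G) is an element of H^1(B^N), the completion of C_c^oo(B^N) under
   (int (|grad_g u|_g^2 + u^2) dV)^(1/2); u is the function and G its
   (Euclidean) weak gradient, so |grad_g u|_g^2 = ((1-|x|^2)/2)^2 |G|^2. *)
Definition inH1 (u : V -> R) (G : V -> V) : Prop :=
  borel_fun u /\ borel_vfun G /\
  exists phi : nat -> (V -> R),
    (forall k, Cc_inf (phi k)) /\
    ((fun k => hint_abs (fun x => (u x - phi k x) ^+ 2
                 + confac x ^- 2 * sqn (G x - egrad (phi k) x))) @ \oo --> 0%E).

(* weak formulation of  -Delta_B u - lambda u = |u|^(2^*-2) u  :
   for every test function psi in C_c^oo(B^N),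
   int (<grad_g u, grad_g psi>_g - lambda u psi - |u|^(2^*-2) u psi) dV = 0 *)
Definition weak_sol (lambda : R) (u : V -> R) (G : V -> V) : Prop :=
  let p := 2 * N%:R / (N%:R - 2) in
  forall psi : V -> R, Cc_inf psi ->
    let F := fun x => confac x ^- 2 * edot (G x) (egrad psi x)
                      - lambda * u x * psi x
                      - (`|u x| `^ (p - 2)) * u x * psi x in
    hintegrable F /\ hint F = 0.

Definition radial (u : V -> R) : Prop :=
  forall x y : V, sqn x = sqn y -> u x = u y.

Definition sign_changing (u : V -> R) : Prop :=
  (0 < ball_meas [set x | (0 < u x)%R])%E /\ (0 < ball_meas [set x | (u x < 0)%R])%E.

(* u and v are distinct as elements of H^1 (not a.e. equal on B^N) *)
Definition distinct_fun (u v : V -> R) : Prop :=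
  (0 < ball_meas [set x | u x <> v x])%E.

End HypBall.

(* Main.v *)
Require Import Defs.
From HB Require Import structures.
From mathcomp Require Import all_boot all_order all_algebra.
From mathcomp Require Import all_classical all_reals all_analysis.
From mathcomp Require Import ring lra.
Set Implicit Arguments. Unset Strict Implicit. Unset Printing Implicit Defensive.
Import Order.TTheory GRing.Theory Num.Theory.
Import numFieldNormedType.Exports.
Local Open Scope classical_set_scope.
Local Open Scope ring_scope.

(** A radial solution is a function v of x = cosh r - 1, r the hyperbolic
    distance to the origin, with
      x (x + 2) v'' + N (x + 1) v' + lambda v + |v|^(2* - 2) v = 0
    and v(0) = a, and it lies in the energy space as soon as it decays like
    (x + 1)^(-b) for some b > (N - 1) / 2.  Slow solutions end up in an open set of
    "trapped" states in which v no longer vanishes, and the solutions that are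
    never trapped decay fast.  Because lambda > N (N - 2) / 4, a Pohozaev
    quantity is increasing and all zeros are simple; so, as long as all the
    solutions are trapped, having at least k zeros is an open and closed
    condition on a.  Because N >= 7, the number of zeros tends to infinity
    with a (a phase plane argument in Emden-Fowler variables), whereas each
    trapped solution has finitely many of them.  Hence fast decaying solutions
    exist for arbitrarily large a, and they change sign.

    The weak formulation is the divergence theorem applied to
    psi (2 / (1 - |x|^2))^(N - 2) G, one coordinate at a time. *)

(** At infinity the linear part is of Euler type, with decay exponents (N - 1) / 2 +- sqrt D, where
    D = ((N - 1) / 2)^2 - lambda. The lower bound on lambda serves twice: it gives the sign in the
    Pohozaev quantity, and it says D < 1/4, so that b = (N - 1) / 2 + D lies strictly between (N -
    1) / 2 and the larger exponent. Comparison with the single power b is therefore enough, and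
    exact asymptotics are never computed. The condition N >= 7 is c > 2 for c = (N - 2) / 2. Between
    two bumps an Emden-Fowler orbit passes the saddle at 0 with an energy at least of order exp(2
    t0), where t0 < 0 is the time of the first bump. Approaching and leaving the saddle at a rate
    close to c takes about 2 |t0| / c; this is less than |t0| exactly when c > 2, and then the
    number of bumps before a fixed time grows without bound as t0 tends to minus infinity. No nodal
    count is attached to the solutions obtained: the continuity argument only produces an untrapped
    initial value beyond any given bound, and the solutions are told apart by their values at the
    origin. *)

Definition has_deriv (R : realType) (f : R -> R) (x d : R) : Prop :=
  is_derive x 1 f d.

(** * One-variable calculus *)

Section Calculus.
Variable R : realType.
Implicit Types (f g F G df : R -> R) (a b x y t : R).

Lemma derD f g x a b : has_deriv f x a -> has_deriv g x b ->
  has_deriv (fun t => f t + g t) x (a + b).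
Proof. exact: is_deriveD. Qed.

Lemma derB f g x a b : has_deriv f x a -> has_deriv g x b ->
  has_deriv (fun t => f t - g t) x (a - b).
Proof. by move=> hf hg; apply: is_deriveB. Qed.

Lemma derN f x a : has_deriv f x a -> has_deriv (fun t => - f t) x (- a).
Proof. exact: is_deriveN. Qed.

Lemma derM f g x a b : has_deriv f x a -> has_deriv g x b ->
  has_deriv (fun t => f t * g t) x (a * g x + f x * b).
Proof.
move=> hf hg; apply: (@is_derive_eq _ _ _ (f * g) x 1 _ _ (is_deriveM hf hg)).
by rewrite /GRing.scale /= addrC [g x * a]mulrC.
Qed.

Lemma derV f x a : f x != 0 -> has_deriv f x a ->
  has_deriv (fun t => (f t)^-1) x (- a / f x ^+ 2).
Proof.
move=> fx hf; apply: (is_derive_eq (is_deriveV fx hf)).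
by rewrite /GRing.scale /= !mulNr mulrC.
Qed.

Lemma derC x c : has_deriv (fun=> c : R) x (0 : R).
Proof. exact: is_derive_cst. Qed.

Lemma derI x : has_deriv (fun t => t : R) x (1 : R).
Proof. exact: is_derive_id. Qed.

Lemma derX f n x a : has_deriv f x a ->
  has_deriv (fun t => f t ^+ n) x (n%:R * f x ^+ n.-1 * a).
Proof.
move=> hf; elim: n => [|n ih].
  rewrite !mul0r; exact: derC.
have -> : (fun t => f t ^+ n.+1) = (fun t => f t * f t ^+ n).
  by apply/funext => t; rewrite exprS.
apply: (is_derive_eq (derM hf ih)).
rewrite mulrA; case: n {ih} => [|n] /=; first by rewrite !expr0; ring.
by rewrite [in RHS]exprS -[n.+2%:R]natr1 exprS; ring.
Qed.

Lemma der_comp f g x a b : has_deriv f (g x) a -> has_deriv g x b ->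
  has_deriv (fun t => f (g t)) x (a * b).
Proof. exact: is_derive1_comp. Qed.

Lemma der_eq f x a b : has_deriv f x a -> a = b -> has_deriv f x b.
Proof. by move=> h <-. Qed.

Lemma der_ext f g x a : (\forall y \near x, f y = g y) ->
  has_deriv f x a -> has_deriv g x a.
Proof. by move=> h; apply: near_eq_is_derive => //; rewrite oner_eq0. Qed.

Lemma der_cont f x a : has_deriv f x a -> {for x, continuous f}.
Proof.
by move=> [h _]; apply: differentiable_continuous; apply/derivable1_diffP.
Qed.

Lemma der_uniq f x a b : has_deriv f x a -> has_deriv f x b -> a = b.
Proof. by move=> [_ <-] [_ <-]. Qed.

Lemma der_sqrt f x a : 0 < f x -> has_deriv f x a ->
  has_deriv (fun t => Num.sqrt (f t)) x (a / (2 * Num.sqrt (f x))).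
Proof.
move=> fx hf; have h := is_derive1_sqrt fx.
by apply: (der_eq (der_comp h hf)); rewrite mulrC.
Qed.

Lemma continuous_itv f a b : (forall x, a <= x <= b -> {for x, continuous f}) ->
  {within `[a, b], continuous f}.
Proof.
move=> h; apply: continuous_in_subspaceT => x; rewrite inE /= in_itv /=; exact: h.
Qed.

Lemma MVT_itv f df a b : a < b ->
  (forall x, a <= x <= b -> {for x, continuous f}) ->
  (forall x, a < x < b -> has_deriv f x (df x)) ->
  exists2 c, a < c < b & f b - f a = df c * (b - a).
Proof.
move=> ab cf dff.
have dff' x : x \in `]a, b[ -> has_deriv f x (df x).
  by rewrite in_itv; exact: dff.
have [c] := MVT ab dff' (continuous_itv cf).
by rewrite in_itv /= => cab e; exists c.
Qed.

Lemma der_ge0_le f df a b : a <= b ->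
  (forall x, a <= x <= b -> {for x, continuous f}) ->
  (forall x, a < x < b -> has_deriv f x (df x)) ->
  (forall x, a < x < b -> 0 <= df x) -> f a <= f b.
Proof.
rewrite le_eqVlt => /predU1P[<-//|ab cf dff h].
have [c cab e] := MVT_itv ab cf dff.
by rewrite -subr_ge0 e mulr_ge0 ?h// subr_ge0 ltW.
Qed.

Lemma der_le f g df dg a b : a <= b ->
  (forall x, a <= x <= b -> {for x, continuous f}) ->
  (forall x, a <= x <= b -> {for x, continuous g}) ->
  (forall x, a < x < b -> has_deriv f x (df x)) ->
  (forall x, a < x < b -> has_deriv g x (dg x)) ->
  (forall x, a < x < b -> df x <= dg x) -> f b - f a <= g b - g a.
Proof.
move=> ab cf cg dff dgg h.
have cB x : a <= x <= b -> {for x, continuous (fun x => g x - f x)}.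
  by move=> xab; apply: continuousB; [exact: cg|exact: cf].
have dB x : a < x < b -> has_deriv (fun x => g x - f x) x (dg x - df x).
  by move=> xab; apply: derB; [exact: dgg|exact: dff].
have B0 x : a < x < b -> 0 <= dg x - df x by move=> /h; rewrite subr_ge0.
by have := der_ge0_le ab cB dB B0; lra.
Qed.

Lemma der_norm_le f g df dg a b : a <= b ->
  (forall x, a <= x <= b -> {for x, continuous f}) ->
  (forall x, a <= x <= b -> {for x, continuous g}) ->
  (forall x, a < x < b -> has_deriv f x (df x)) ->
  (forall x, a < x < b -> has_deriv g x (dg x)) ->
  (forall x, a < x < b -> `|df x| <= dg x) -> `|f b - f a| <= g b - g a.
Proof.
move=> ab cf cg dff dgg h.
have h1 x : a < x < b -> df x <= dg x.
  by move=> /h; rewrite ler_norml => /andP[].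
have h2 x : a < x < b -> - df x <= dg x.
  by move=> /h; rewrite ler_norml => /andP[? _]; rewrite lerNl.
have cN x : a <= x <= b -> {for x, continuous (fun x => - f x)}.
  by move=> xab; apply: continuousN; exact: cf.
have dN x : a < x < b -> has_deriv (fun x => - f x) x (- df x).
  by move=> xab; apply: derN; exact: dff.
have := der_le ab cN cg dN dgg h2; have := der_le ab cf cg dff dgg h1.
by rewrite ler_norml; lra.
Qed.

Lemma der0_eq f a b : a <= b -> (forall x, a <= x <= b -> has_deriv f x 0) ->
  f a = f b.
Proof.
move=> ab h; apply/eqP; rewrite eq_le.
have c x : a <= x <= b -> {for x, continuous f} by move=> /h; exact: der_cont.
have h' x : a < x < b -> has_deriv f x 0 by move=> ?; apply: h; lra.
have cN x : a <= x <= b -> {for x, continuous (fun x => - f x)}.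
  by move=> xab; apply: continuousN; exact: c.
have dN x : a < x < b -> has_deriv (fun x => - f x) x (- 0).
  by move=> xab; apply: derN; exact: h'.
have N0 x : a < x < b -> (0 : R) <= - 0 by rewrite oppr0.
have := der_ge0_le ab cN dN N0; rewrite lerN2 => ->.
by rewrite (der_ge0_le ab c h').
Qed.

Lemma near_dist x (Q : R -> Prop) : (\forall y \near x, Q y) <->
  exists2 e : R, 0 < e & forall y, `|y - x| < e -> Q y.
Proof.
split=> [/nbhs_ballP[e /= e0 he]|[e e0 he]].
  by exists e => // y yx; apply: he; rewrite /ball /= distrC.
by apply/nbhs_ballP; exists e => //= y; rewrite /ball /= distrC; exact: he.
Qed.

Lemma cont_gt f x m : {for x, continuous f} -> m < f x ->
  exists2 e : R, 0 < e & forall y, `|y - x| < e -> m < f y.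
Proof. by move=> cf h; apply/near_dist; exact: (cvgr_gt _ cf). Qed.

Lemma cont_lt f x m : {for x, continuous f} -> f x < m ->
  exists2 e : R, 0 < e & forall y, `|y - x| < e -> f y < m.
Proof. by move=> cf h; apply/near_dist; exact: (cvgr_lt _ cf). Qed.

(** The supremum of the times up to which [f] stays above [m]; continuity excludes both [m < f t]
    and [f t < m] there. *)
Lemma first_hit f a b m : a <= b ->
  (forall x, a <= x <= b -> {for x, continuous f}) -> m < f a -> f b <= m ->
  exists t, [/\ a < t, t <= b, f t = m & forall s, a <= s < t -> m < f s].
Proof.
move=> ab cf fa fb.
pose S := [set t | a <= t <= b /\ forall s, a <= s <= t -> m < f s].
have Sa : S a by split; [rewrite lexx|move=> s ?; have -> : s = a by lra].
have uS : ubound S b by move=> t [/andP[]].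
have hS : has_sup S by split; [exists a|exists b].
set t := sup S.
have ta : a <= t by apply: ub_le_sup => //; exists b.
have tb : t <= b by apply: ge_sup => //; exists a.
have lt_t s : a <= s < t -> m < f s.
  move=> /andP[sa st]; have ts : 0 < t - s by lra.
  have [u [_ uu] su] := sup_adherent ts hS.
  by apply: uu; rewrite sa /=; move: su; rewrite -/t; lra.
have ct : {for t, continuous f} by apply: cf; rewrite ta.
have ft : f t <= m.
  rewrite leNgt; apply/negP => mft.
  have tltb : t < b.
    rewrite lt_neqAle tb andbT; apply/eqP => tbE; move: mft; rewrite tbE; lra.
  have [e e0 he] := cont_gt ct mft.
  pose d := Num.min (e / 2) (b - t).
  have d0 : 0 < d by rewrite lt_min; apply/andP; split; lra.
  have de : d <= e / 2 by rewrite ge_min lexx.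
  have db : d <= b - t by rewrite ge_min lexx orbT.
  have : t + d <= t.
    apply: ub_le_sup; first by exists b.
    split; first lra.
    move=> s /andP[sa sd]; case: (ltP s t) => st; first by apply: lt_t; lra.
    by apply: he; rewrite ltr_norml; lra.
  lra.
have altt : a < t.
  rewrite lt_neqAle ta andbT; apply/eqP => E; move: ft; rewrite -E; lra.
exists t; split => //; apply/eqP; rewrite eq_le ft /= leNgt; apply/negP => ftm.
have [e e0 he] := cont_lt ct ftm.
pose d := Num.min (e / 2) (t - a).
have d0 : 0 < d by rewrite lt_min; apply/andP; split; lra.
have de : d <= e / 2 by rewrite ge_min lexx.
have da : d <= t - a by rewrite ge_min lexx orbT.
have : f (t - d) < m by apply: he; rewrite ltr_norml; lra.
have : m < f (t - d) by apply: lt_t; lra.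
lra.
Qed.

End Calculus.

Section Primitive.
Variable R : realType.
Implicit Types (f F G : R -> R).

Lemma primitive_gt f (a : R) : continuous f ->
  exists F : R -> R, forall x, a < x -> has_deriv F x (f x).
Proof.
move=> cf; exists (fun x => \int[lebesgue_measure]_(t in `[a, x]) f t) => x ax.
have xx1 : x < x + 1 by lra.
have ci : lebesgue_measure.-integrable `[a, (x + 1)] (EFin \o f).
  apply: continuous_compact_integrable; first exact: segment_compact.
  exact: continuous_subspaceT.
have [df ef] := continuous_FTC1_closed xx1 ci ax (cf x).
rewrite derive1E in ef; exact: DeriveDef df ef.
Qed.

(** The fundamental theorem of calculus gives a primitive to the right of a finite base point only.
    Those based at -1, -2, ... agree on common domains once normalised to vanish at 0, and are
    glued. *)
Lemma primitive f : continuous f ->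
  exists2 F : R -> R, F 0 = 0 & forall x, has_deriv F x (f x).
Proof.
move=> cf.
have /choice[G hG] : forall n : nat, exists F : R -> R, F 0 = 0 /\
    forall x : R, - n.+1%:R < x -> has_deriv F x (f x).
  move=> n; have [F hF] := primitive_gt (- n.+1%:R) cf.
  exists (fun x => F x - F 0); split; first by rewrite subrr.
  move=> x /hF h; apply: (der_eq (derB h (derC _ _))); exact: subr0.
have cons m n (x : R) : - m.+1%:R < x -> - n.+1%:R < x -> G m x = G n x.
  move=> mx nx; have [Gm hm] := hG m; have [Gn hn] := hG n.
  have mp : (0 : R) < m.+1%:R by rewrite ltr0n.
  have np : (0 : R) < n.+1%:R by rewrite ltr0n.
  pose D y := G m y - G n y.
  have d (y : R) : - m.+1%:R < y -> - n.+1%:R < y ->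
      has_deriv D y 0.
    by move=> my ny; apply: (der_eq (derB (hm _ my) (hn _ ny))); rewrite subrr.
  suff : D x = D 0 by rewrite /D Gm Gn; lra.
  have [x0|x0] := leP 0 x.
    by symmetry; apply: (der0_eq x0) => y yx; apply: d; lra.
  by apply: (der0_eq (ltW x0)) => y yx; apply: d; lra.
have kP (x : R) : exists k, `|x| < k.+1%:R.
  exists (Num.truncn `|x|); exact: truncnS_gt.
pose k x := projT1 (cid (kP x)).
have kE x : `|x| < (k x).+1%:R by rewrite /k; case: cid.
exists (fun x => G (k x) x); first by have [] := hG (k 0).
(* One index more than [x] itself requires: the whole unit neighbourhood of [x] then lies in the
   half-line of this primitive. *)
move=> x; have [_ hm] := hG (k x).+1.
have kx := kE x; have kn : (k x).+2%:R = (k x).+1%:R + 1 :> R by rewrite natr1.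
move: kx; rewrite ltr_norml => kx.
apply: (@der_ext _ (G (k x).+1)); last by apply: hm; lra.
apply/near_dist; exists 1 => // y; rewrite ltr_norml => yx.
apply: cons; first lra.
by have := kE y; rewrite ltr_norml; lra.
Qed.

End Primitive.

Section Continuity.
Variables (R : realType) (T : topologicalType).
Implicit Types (f g : T -> R) (x : T).

Lemma cont_comp (f : R -> R) g x : {for x, continuous g} -> {for (g x), continuous f} ->
  {for x, continuous (fun y => f (g y))}.
Proof. by move=> hg hf; apply: (@continuous_comp _ _ _ g f). Qed.

Lemma contC (c : R) x : {for x, continuous (fun=> c)}.
Proof. exact: cst_continuous. Qed.

Lemma contD f g x : {for x, continuous f} -> {for x, continuous g} ->
  {for x, continuous (fun y => f y + g y)}.
Proof. by move=> hf hg; apply: continuousD. Qed.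

Lemma contB f g x : {for x, continuous f} -> {for x, continuous g} ->
  {for x, continuous (fun y => f y - g y)}.
Proof. by move=> hf hg; apply: continuousB. Qed.

Lemma contN f x : {for x, continuous f} -> {for x, continuous (fun y => - f y)}.
Proof. by move=> hf; apply: continuousN. Qed.

Lemma contM f g x : {for x, continuous f} -> {for x, continuous g} ->
  {for x, continuous (fun y => f y * g y)}.
Proof. by move=> hf hg; apply: continuousM. Qed.

Lemma contV f x : f x != 0 -> {for x, continuous f} ->
  {for x, continuous (fun y => (f y)^-1)}.
Proof. by move=> hf hg; apply: continuousV. Qed.

Lemma contX f k x : {for x, continuous f} -> {for x, continuous (fun y => f y ^+ k)}.
Proof. by move=> hf; apply: (@cont_comp (fun z => z ^+ k) f) => //; exact: exprn_continuous. Qed.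

Lemma cont_norm f x : {for x, continuous f} -> {for x, continuous (fun y => `|f y|)}.
Proof. by move=> hf; apply: (@cont_comp (fun z => `|z|) f) => //; exact: norm_continuous. Qed.

Lemma cont_ext f g x : (\forall y \near x, f y = g y) ->
  {for x, continuous f} -> {for x, continuous g}.
Proof.
move=> h hf; have hf' : f y @[y --> x] --> f x := hf.
suff : g y @[y --> x] --> g x by [].
by rewrite -(nbhs_singleton h); apply: cvg_trans hf'; exact: near_eq_cvg.
Qed.

End Continuity.

Lemma contI (R : realType) (x : R) : {for x, continuous (fun y : R => y)}.
Proof. exact: cvg_id. Qed.

Lemma cont_epsP (R : realType) (f : R -> R) x : {for x, continuous f} <->
  forall e : R, 0 < e -> exists2 d : R, 0 < d & forall y, `|y - x| < d -> `|f y - f x| < e.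
Proof.
split=> [/cvgrPdist_lt h e /h /near_dist[d d0 hd]|h].
  by exists d => // y /hd; rewrite distrC.
apply/cvgrPdist_lt => e /h[d d0 hd]; apply/near_dist; exists d => // y /hd.
by rewrite distrC.
Qed.

(** * The radial equation *)

Section Linear.
Variables (R : realType) (N : nat).
Hypothesis N7 : (7 <= N)%N.
Local Notation n := (N%:R : R).
Implicit Types (d h v g : R -> R) (x y K C : R).

(* In the variable [x = cosh r - 1], [sinh2 x] is [sinh(r)^2] and [sinhN x] is
   [sinh(r)^N]. *)
Definition sinh2 (x : R) : R := x * (x + 2).
Definition sinhN (x : R) : R := Num.sqrt (sinh2 x) ^+ N.
Definition sinhN2 (x : R) : R := Num.sqrt (sinh2 x) ^+ (N - 2).

Lemma n7 : 7 <= n. Proof. by rewrite ler_nat. Qed.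

Lemma sinh2_gt0 x : 0 < x -> 0 < sinh2 x.
Proof. by move=> x0; rewrite mulr_gt0//; lra. Qed.

Lemma sinh2_ge0 x : 0 <= x -> 0 <= sinh2 x.
Proof. by move=> x0; rewrite mulr_ge0//; lra. Qed.

Lemma sinh2_der x : has_deriv sinh2 x (2 * (x + 1)).
Proof.
apply: (der_eq (derM (derI x) (derD (derI x) (derC x 2)))); ring.
Qed.

Lemma sinh2_cont : continuous sinh2.
Proof. by move=> x; exact: der_cont (sinh2_der x). Qed.

Lemma sqrtPP_cont : continuous (fun x => Num.sqrt (sinh2 x)).
Proof. by move=> x; apply: (@cont_comp R _ Num.sqrt sinh2); [exact: sinh2_cont|exact: sqrt_continuous]. Qed.

Lemma exp_cont (f : R -> R) k : continuous f -> continuous (fun x => f x ^+ k).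
Proof. by move=> cf x; exact: contX (cf x). Qed.

Lemma sinhN_cont : continuous sinhN. Proof. exact: exp_cont sqrtPP_cont. Qed.
Lemma sinhN2_cont : continuous sinhN2. Proof. exact: exp_cont sqrtPP_cont. Qed.

Lemma sinhN_gt0 x : 0 < x -> 0 < sinhN x.
Proof. by move=> x0; rewrite exprn_gt0// sqrtr_gt0 sinh2_gt0. Qed.
Lemma sinhN2_gt0 x : 0 < x -> 0 < sinhN2 x.
Proof. by move=> x0; rewrite exprn_gt0// sqrtr_gt0 sinh2_gt0. Qed.
Lemma sinhN_ge0 x : 0 <= sinhN x. Proof. by rewrite exprn_ge0// sqrtr_ge0. Qed.
Lemma sinhN2_ge0 x : 0 <= sinhN2 x. Proof. by rewrite exprn_ge0// sqrtr_ge0. Qed.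
Lemma mm0 : sinhN 0 = 0.
Proof. by rewrite /sinhN /sinh2 mul0r sqrtr0 expr0n; case: N N7. Qed.

Lemma mmE x : 0 <= x -> sinhN x = sinh2 x * sinhN2 x.
Proof.
move=> x0; rewrite /sinhN /sinhN2; have {1}-> : N = (2 + (N - 2))%N by rewrite subnKC// (leq_trans _ N7).
by rewrite exprD sqr_sqrtr// sinh2_ge0.
Qed.

Lemma sinhN_der x : 0 < x -> has_deriv sinhN x (n * (x + 1) * sinhN2 x).
Proof.
move=> x0; have P0 := sinh2_gt0 x0; have s0 : 0 < Num.sqrt (sinh2 x) by rewrite sqrtr_gt0.
apply: (der_eq (derX N (der_sqrt P0 (sinh2_der x)))).
have -> : N.-1 = (N - 2).+1 by case: N N7 => [//|[//|k _]]; rewrite subSS subSS subn0.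
rewrite exprS /sinhN2; field.
by rewrite gt_eqF.
Qed.

(* Integrated form of [sinh2 x * d' + n * (x + 1) * d = h] with [d] regular at 0. *)
Definition lin d h := [/\ continuous d, d 0 = h 0 / n
  & forall x, 0 < x -> has_deriv (fun y => sinhN y * d y) x (sinhN2 x * h x)].

Lemma linB d h d' h' : lin d h -> lin d' h' ->
  lin (fun x => d x - d' x) (fun x => h x - h' x).
Proof.
move=> [cd d0 dd] [cd' d0' dd']; split.
- by move=> x; apply: contB; [exact: cd|exact: cd'].
- by rewrite d0 d0' mulrBl.
- move=> x x0; have -> : (fun y => sinhN y * (d y - d' y)) =
     (fun y => sinhN y * d y - sinhN y * d' y) by apply/funext => y; rewrite mulrBr.
  by rewrite mulrBr; apply: derB; [exact: dd|exact: dd'].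
Qed.

(** Comparison of [sinhN * d] with [C / n * sinhN * expR (K x)]. The part [n * sinhN2] of the
    derivative of [sinhN] already dominates the source; the other terms of the derivative of the
    majorant are nonnegative. *)
Lemma lin_bound d h K C : 0 <= K -> lin d h ->
  (forall x, 0 <= x -> `|h x| <= C * expR (K * x)) ->
  forall x, 0 <= x -> `|d x| <= C / n * expR (K * x).
Proof.
move=> K0 [cd d0 dd] hh x; have n7 := n7.
have n0 : n != 0 by apply: lt0r_neq0; lra.
have C0 : 0 <= C.
  by have := hh 0 (lexx _); rewrite mulr0 expR0 mulr1; apply: le_trans.
rewrite le_eqVlt => /predU1P[<-|x0].
  have h0 := hh 0 (lexx _); have np : 0 < n by lra.
  by rewrite d0 normrM normfV (gtr0_norm np) mulrAC ler_pM2r ?invr_gt0.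
pose G y := C / n * (sinhN y * expR (K * y)).
have dG y : 0 < y -> has_deriv G y (C / n *
   (n * (y + 1) * sinhN2 y * expR (K * y) + sinhN y * (expR (K * y) * K))).
  move=> y0; apply: (der_eq (derM (derC y (C / n)) (derM (sinhN_der y0)
     (der_comp (is_derive_expR _) (derM (derC y K) (derI y)))))); ring.
have cG y : 0 <= y <= x -> {for y, continuous G}.
  move=> _; apply: contM; first exact: contC.
  apply: contM; first exact: sinhN_cont.
  apply: continuous_comp; last exact: continuous_expR.
  by apply: contM; [exact: contC|exact: cvg_id].
have cmd y : 0 <= y <= x -> {for y, continuous (fun y => sinhN y * d y)}.
  by move=> _; apply: contM; [exact: sinhN_cont|exact: cd].
have dmd y : 0 < y < x -> has_deriv (fun y => sinhN y * d y) y (sinhN2 y * h y).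
  by move=> /andP[y0 _]; exact: dd.
have dG' y : 0 < y < x -> has_deriv G y (C / n *
   (n * (y + 1) * sinhN2 y * expR (K * y) + sinhN y * (expR (K * y) * K))).
  by move=> /andP[y0 _]; exact: dG.
have le_d y : 0 < y < x -> `|sinhN2 y * h y| <= C / n *
   (n * (y + 1) * sinhN2 y * expR (K * y) + sinhN y * (expR (K * y) * K)).
  move=> /andP[y0 _]; rewrite normrM ger0_norm ?sinhN2_ge0//.
  have e0 := expR_gt0 (K * y).
  apply: (@le_trans _ _ (sinhN2 y * (C * expR (K * y)))).
    by rewrite ler_wpM2l ?sinhN2_ge0// hh// ltW.
  have -> : C / n * (n * (y + 1) * sinhN2 y * expR (K * y) + sinhN y * (expR (K * y) * K))
    = sinhN2 y * (C * expR (K * y)) + (C * expR (K * y)) * (y * sinhN2 y)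
      + (C / n * sinhN y * (expR (K * y) * K)) by field.
  rewrite -addrA lerDl addr_ge0// !mulr_ge0// ?ltW ?sinhN2_gt0 ?sinhN_gt0// invr_gt0; lra.
have := der_norm_le (ltW x0) cmd cG dmd dG' le_d.
rewrite /G mm0 !mul0r mulr0 !subr0 normrM ger0_norm ?sinhN_ge0//.
by rewrite mulrCA ler_pM2l ?sinhN_gt0.
Qed.

(** Integrating the exponential weight produces the factor [1 / K], which is what makes the Picard
    map contract for large [K]. *)
Lemma lin_step d h V K C : 0 < K -> lin d h -> (forall x, has_deriv V x (d x)) ->
  (forall x, 0 <= x -> `|h x| <= C * expR (K * x)) ->
  forall x, 0 <= x -> `|V x - V 0| <= C / n / K * expR (K * x).
Proof.
move=> K0 ld dV hh x x0; have n7 := n7.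
have hd := lin_bound (ltW K0) ld hh.
have C0 : 0 <= C.
  by have := hh 0 (lexx _); rewrite mulr0 expR0 mulr1; apply: le_trans.
pose G y := C / n / K * expR (K * y).
have dG y : has_deriv G y (C / n * expR (K * y)).
  apply: (der_eq (derM (derC y (C / n / K)) (der_comp (is_derive_expR _)
    (derM (derC y K) (derI y))))); field; rewrite !gt_eqF//=; lra.
have cV y : 0 <= y <= x -> {for y, continuous V} by move=> _; exact: der_cont (dV y).
have cG y : 0 <= y <= x -> {for y, continuous G} by move=> _; exact: der_cont (dG y).
have dV' y : 0 < y < x -> has_deriv V y (d y) by move=> _; exact: dV.
have dG' y : 0 < y < x -> has_deriv G y (C / n * expR (K * y)) by move=> _; exact: dG.
have le_d y : 0 < y < x -> `|d y| <= C / n * expR (K * y) by move=> /andP[/ltW /hd].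
apply: le_trans (der_norm_le x0 cV cG dV' dG' le_d) _.
rewrite lerBlDr lerDl /G mulr_ge0 ?expR_ge0// !divr_ge0//; lra.
Qed.

(** On x > 0 the solution is the primitive of [sinhN2 * h] divided by [sinhN]; it is continued by
    its limit [h 0 / n] to the left. Continuity at 0 comes from comparing the primitive with
    [h 0 / n * sinhN]: the difference has derivative [sinhN2 y * (h y - h 0 * (y + 1))], whose
    second factor is small near 0. *)
Lemma lin_exists h : continuous h -> exists d, lin d h.
Proof.
move=> ch; have n7 := n7; have n0 : n != 0 by apply: lt0r_neq0; lra.
have cwh : continuous (fun x => sinhN2 x * h x).
  by move=> x; apply: contM; [exact: sinhN2_cont|exact: ch].
have [W W0 dW] := primitive cwh.
pose d x := if 0 < x then W x / sinhN x else h 0 / n.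
have dE x : 0 < x -> sinhN x * d x = W x.
  by move=> x0; rewrite /d x0 mulrC divfK// gt_eqF// sinhN_gt0.
have dmd x : 0 < x -> has_deriv (fun y => sinhN y * d y) x (sinhN2 x * h x).
  move=> x0; apply: (der_ext _ (dW x)).
  by near=> y; rewrite dE//; near: y; exact: lt_nbhsr.
exists d; split; last exact: dmd; last by rewrite /d ltxx.
move=> x; have [x0|x0|<-] := ltgtP 0 x.
- have c : {for x, continuous (fun y => W y / sinhN y)}.
    apply: contM; first exact: der_cont (dW x).
    by apply: contV; [rewrite gt_eqF ?sinhN_gt0|exact: sinhN_cont].
  apply: cont_ext c.
  by near=> y; rewrite /d ifT//; near: y; exact: lt_nbhsr.
- apply: (@cont_ext R _ (fun=> h 0 / n) d); last exact: contC.
  near=> y; rewrite /d ltNge; suff -> : y <= 0 by [].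
  by apply: ltW; near: y; exact: lt_nbhsl.
- apply/cont_epsP => e e0.
  have ck : {for 0, continuous (fun y => `|h y - h 0 * (y + 1)|)}.
    apply: cont_norm; apply: contB; first exact: ch.
    apply: contM; first exact: contC.
    by apply: contD; [exact: contI|exact: contC].
  have e2 : 0 < e / 2 by lra.
  have [|r r0 hr] := cont_lt (m := e / 2) ck; first by rewrite add0r mulr1 subrr normr0.
  exists r => // {}x; rewrite subr0 => xr.
  rewrite {2}/d ltxx; have [x0|x0] := ltP 0 x; last first.
    by rewrite /d [0 < x]ltNge x0 subrr normr0.
  suff : `|d x - h 0 / n| <= e / 2 by lra.
  pose F y := W y - h 0 / n * sinhN y.
  have dF y : 0 < y < x -> has_deriv F y (sinhN2 y * (h y - h 0 * (y + 1))).
    move=> /andP[y0 _]; apply: (der_eq (derB (dW y) (derM (derC y (h 0 / n)) (sinhN_der y0)))).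
    by field.
  have dG y : 0 < y < x -> has_deriv (fun y => e / 2 * sinhN y) y (e / 2 * (n * (y + 1) * sinhN2 y)).
    move=> /andP[y0 _]; apply: (der_eq (derM (derC y (e / 2)) (sinhN_der y0))); ring.
  have cF y : 0 <= y <= x -> {for y, continuous F}.
    move=> _; apply: contB; first exact: der_cont (dW y).
    by apply: contM; [exact: contC|exact: sinhN_cont].
  have cG y : 0 <= y <= x -> {for y, continuous (fun y => e / 2 * sinhN y)}.
    by move=> _; apply: contM; [exact: contC|exact: sinhN_cont].
  have le_d y : 0 < y < x -> `|sinhN2 y * (h y - h 0 * (y + 1))| <= e / 2 * (n * (y + 1) * sinhN2 y).
    move=> /andP[y0 yx]; rewrite normrM ger0_norm ?sinhN2_ge0// mulrC [leRHS]mulrA.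
    rewrite ler_wpM2r ?sinhN2_ge0//.
    have : `|h y - h 0 * (y + 1)| < e / 2.
      by apply: hr; rewrite subr0; move: xr; rewrite !gtr0_norm//; lra.
    by move/ltW/le_trans; apply; rewrite ler_peMr ?(ltW e2)//; nra.
  have := der_norm_le (ltW x0) cF cG dF dG le_d.
  rewrite /F mm0 W0 !mulr0 !subr0 -dE// mulrC -mulrBl normrM [X in _ * X]ger0_norm ?sinhN_ge0//.
  by rewrite ler_pM2r ?sinhN_gt0.
Unshelve. all: by end_near.
Qed.

Lemma lin_der d h x : lin d h -> 0 < x ->
  has_deriv d x ((h x - n * (x + 1) * d x) / sinh2 x).
Proof.
move=> [_ _ dd] x0; have m0 := sinhN_gt0 x0; have w0 := sinhN2_gt0 x0; have P0 := sinh2_gt0 x0.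
have mn : sinhN x != 0 by rewrite gt_eqF.
apply: (@der_ext _ (fun y => (sinhN y * d y) * (sinhN y)^-1)).
  near=> y; rewrite mulrAC divff ?mul1r// gt_eqF// sinhN_gt0//.
  by near: y; exact: lt_nbhsr.
apply: (der_eq (derM (dd x x0) (derV mn (sinhN_der x0)))).
rewrite mmE ?(ltW x0)//; field.
by rewrite !gt_eqF.
Unshelve. all: by end_near.
Qed.

End Linear.

(** * Existence by Picard iteration *)

Lemma expR_ge_1 (R : realType) (x : R) : 0 <= x -> 1 <= expR x.
Proof. by move=> x0; rewrite -[leLHS]expR0 ler_expR. Qed.

Section GeometricLimit.
Variable R : realType.

(** The intervals of radius [2 * B * 2 ^- k] around [u k] are nested; the limit is the supremum of
    their left ends. *)
Lemma geometric_limit (u : nat -> R) (B : R) :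
  (forall k, `|u k.+1 - u k| <= B * 2 ^- k) ->
  exists l, forall k, `|u k - l| <= 2 * B * 2 ^- k.
Proof.
move=> hu.
have half k : 2 ^- k.+1 = 2 ^- k / 2 :> R by rewrite exprS invfM mulrC.
pose a k := u k - 2 * B * 2 ^- k; pose b k := u k + 2 * B * 2 ^- k.
have B0 : 0 <= B by have := hu 0%N; rewrite expr0 invr1 mulr1; apply: le_trans.
have p0 k : 0 <= B * 2 ^- k by rewrite mulr_ge0// invr_ge0 exprn_ge0.
have amono k j : a k <= a (k + j)%N.
  elim: j => [|j ih]; first by rewrite addn0.
  apply: le_trans ih _; rewrite addnS /a half; have := hu (k + j)%N.
  rewrite ler_norml; have := p0 (k + j)%N; set t := 2 ^- _; nra.
have bmono k j : b (k + j)%N <= b k.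
  elim: j => [|j ih]; first by rewrite addn0.
  apply: le_trans ih; rewrite addnS /b half; have := hu (k + j)%N.
  rewrite ler_norml; have := p0 (k + j)%N; set t := 2 ^- _; nra.
have ab k j : a k <= b j.
  have := amono k j; have := bmono j k; rewrite addnC.
  have : a (k + j)%N <= b (k + j)%N by rewrite /a /b; have := p0 (k + j)%N; lra.
  lra.
have sa : has_sup (range a) by split; [exists (a 0%N), 0%N|exists (b 0%N) => _ [k _ <-]].
exists (sup (range a)) => k.
have h1 : a k <= sup (range a) by apply: ub_le_sup; [case: sa|exists k].
have h2 : sup (range a) <= b k by apply: ge_sup; [case: sa|move=> _ [j _ <-]].
by move: h1 h2; rewrite /a /b ler_norml; lra.
Qed.

Lemma pow2_small (C e : R) : 0 < e -> exists k, C * 2 ^- k < e.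
Proof.
move=> e0; have [C0|C0] := leP C 0; first by exists 0%N; rewrite expr0 invr1; lra.
exists (Num.truncn (C / e)).+1; rewrite ltr_pdivrMr ?exprn_gt0//.
have h := truncnS_gt (C / e); rewrite mulrC -ltr_pdivrMr//.
apply: lt_trans h _; rewrite -natrX ltr_nat; exact: ltn_expl.
Qed.

End GeometricLimit.

Section Solutions.
Variables (R : realType) (N : nat).
Hypothesis N7 : (7 <= N)%N.
Local Notation n := (N%:R : R).
Implicit Types (d h v g : R -> R) (x y K C L M a : R).

Definition sol g a v d := [/\ v 0 = a, forall x, has_deriv v x (d x)
  & lin N d (fun x => - g (v x))].

(** In the sup norm weighted by [expR (- (2 L + 1) x)] the Picard map halves distances, because
    [L / (n (2 L + 1)) <= 1 / 2]. The weight gives existence on the whole half-line at once, without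
    continuation of local solutions. *)
Lemma sol_contraction g L a a' v d v' d' w w' B : 0 <= L ->
  (forall s t, `|g s - g t| <= L * `|s - t|) ->
  lin N d (fun x => - g (w x)) -> lin N d' (fun x => - g (w' x)) ->
  (forall x, has_deriv v x (d x)) -> (forall x, has_deriv v' x (d' x)) ->
  v 0 = a -> v' 0 = a' ->
  (forall x, 0 <= x -> `|w x - w' x| <= B * expR ((2 * L + 1) * x)) ->
  forall x, 0 <= x -> `|v x - v' x| <= (`|a - a'| + B / 2) * expR ((2 * L + 1) * x).
Proof.
move=> L0 gL ld ld' vd vd' va va' hw x x0; have n7 := n7 R N7.
have K0 : 0 < 2 * L + 1 by lra.
have hh y : 0 <= y -> `|- g (w y) - - g (w' y)| <= L * B * expR ((2 * L + 1) * y).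
  move=> y0; have -> : - g (w y) - - g (w' y) = - (g (w y) - g (w' y)) by ring.
  rewrite normrN; apply: le_trans (gL _ _) _.
  by rewrite -mulrA ler_wpM2l// hw.
have dV y : has_deriv (fun y => v y - v' y) y (d y - d' y) by exact: derB.
have := lin_step N7 K0 (linB ld ld') dV hh x0.
have B0 : 0 <= B.
  by have := hw 0 (lexx _); rewrite mulr0 expR0 mulr1; apply: le_trans.
have e1 : 1 <= expR ((2 * L + 1) * x) by rewrite expR_ge_1// mulr_ge0// ltW.
rewrite va va' => h.
have : `|v x - v' x| <= `|a - a'| + L * B / n / (2 * L + 1) * expR ((2 * L + 1) * x).
  have -> : v x - v' x = (a - a') + (v x - v' x - (a - a')) by ring.
  by apply: le_trans (ler_normD _ _) _; rewrite lerD2l.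
move/le_trans; apply; rewrite [leRHS]mulrDl lerD//; first by rewrite ler_peMr.
rewrite ler_wpM2r ?expR_ge0// ler_pdivrMr// ler_pdivrMr; last lra.
by have : 0 <= L * B by [rewrite mulr_ge0|]; nra.
Qed.

Lemma picard g L a : 0 <= L -> (forall s t, `|g s - g t| <= L * `|s - t|) ->
  exists v d, sol g a v d.
Proof.
move=> L0 gL; set K := 2 * L + 1.
have K0 : 0 <= K by rewrite /K; lra.
have cg : continuous g.
  move=> x; apply/cont_epsP => e e0; exists (e / (L + 1)); first by rewrite divr_gt0//; lra.
  move=> y hy; apply: le_lt_trans (gL _ _) _.
  move: hy; rewrite ltr_pdivlMr; last lra.
  by apply: le_lt_trans; rewrite mulrDr mulr1 mulrC lerDl.
have stepP v : exists p : (R -> R) * (R -> R), continuous v ->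
    [/\ p.1 0 = a, forall x, has_deriv p.1 x (p.2 x) & lin N p.2 (fun x => - g (v x))].
  have [cv|ncv] := pselect (continuous v); last by exists (v, v).
  have ch : continuous (fun x => - g (v x)).
    by move=> x; apply: contN; apply: cont_comp; [exact: cv|exact: cg].
  have [d ld] := lin_exists N7 ch; have [cd _ _] := ld.
  have [V V0 dV] := primitive cd.
  exists (fun x => V x + a, d) => _; split => //=; first by rewrite V0 add0r.
  by move=> x; apply: (der_eq (derD (dV x) (derC _ a))); rewrite addr0.
have [T hT] := choice stepP.
pose u k := iter k (fun v => (T v).1) (fun=> a).
have cu k : continuous (u k).
  elim: k => [|k ih] x; first exact: contC.
  by have [_ dv _] := hT _ ih; exact: der_cont (dv x).
have dist01 : exists2 B : R, 0 <= B & forall x, 0 <= x -> `|u 1%N x - u 0%N x| <= B * expR (K * x).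
  exists (`|g a| / n / 1).
    by rewrite !divr_ge0//.
  move=> x x0; have [v0 dv ld] := hT _ (cu 0%N).
  have hh y : 0 <= y -> `|- g (u 0%N y)| <= `|g a| * expR (1 * y).
    by move=> y0; rewrite normrN ler_peMr// expR_ge_1// mul1r.
  have := lin_step N7 ltr01 ld dv hh x0; rewrite v0 => /le_trans; apply.
  rewrite ler_wpM2l ?divr_ge0// ler_expR ler_wpM2r// /K; lra.
have [B B0 hB] := dist01.
have dist k x : 0 <= x -> `|u k.+1 x - u k x| <= B * 2 ^- k * expR (K * x).
  elim: k x => [|k ih] x x0; first by rewrite expr0 invr1 mulr1 hB.
  have [v0 dv ld] := hT _ (cu k.+1); have [v0' dv' ld'] := hT _ (cu k).
  have := sol_contraction L0 gL ld ld' dv dv' v0 v0' ih x0.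
  have -> : B * 2 ^- k.+1 = B * 2 ^- k / 2 by rewrite exprS invfM mulrA mulrAC.
  by rewrite subrr normr0 add0r.
have limP x : exists l, 0 <= x -> forall k, `|u k x - l| <= 2 * (B * expR (K * x)) * 2 ^- k.
  have [x0|x0] := leP 0 x; last by exists 0.
  have [|l hl] := @geometric_limit _ (fun k => u k x) (B * expR (K * x)); last by exists l.
  by move=> k; rewrite mulrAC dist.
have [l hl] := choice limP.
(* The iterates converge on x >= 0 only, so the limit is frozen at its value at 0 on the left. One
   more Picard step turns it into a function differentiable on the whole line that agrees with it on
   x >= 0. *)
pose v x := l (Num.max x 0).
have vl k x : 0 <= x -> `|u k x - v x| <= 2 * B * 2 ^- k * expR (K * x).
  move=> x0; rewrite /v max_l//; apply: le_trans (hl _ x0 k) _.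
  by rewrite mulrA mulrAC.
have cv : continuous v.
  move=> x; apply/cont_epsP => e e0.
  set E := expR (K * (Num.max x 0 + 1)).
  have e3 : 0 < e / 3 by lra.
  have [k hk] := pow2_small (2 * B * E) e3.
  have /cont_epsP/(_ (e / 3) e3)[r r0 hr] := cu k (Num.max x 0).
  exists (Num.min r 1); first by rewrite lt_min r0 ltr01.
  move=> y; rewrite lt_min => /andP[yr y1].
  have m0 z : 0 <= Num.max z 0 :> R by rewrite le_max lexx orbT.
  have near_max : `|Num.max y 0 - Num.max x 0| <= `|y - x|.
    by rewrite /Num.max; case: ltP => ?; case: ltP => ?; rewrite ?subrr ?normr0// ler_norml;
      apply/andP; split; have := ler_norm (y - x); have := ler_norm (x - y); rewrite distrC; lra.
  have bnd z : 0 <= z -> z <= Num.max x 0 + 1 -> `|u k z - v z| < e / 3.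
    move=> z0 zx; apply: le_lt_trans (vl k z z0) _; apply: le_lt_trans hk.
    rewrite mulrAC ler_wpM2r ?invr_ge0 ?exprn_ge0// ler_wpM2l ?mulr_ge0//.
    by rewrite ler_expR ler_wpM2l.
  have vm z : v z = v (Num.max z 0) by rewrite /v [Num.max (Num.max _ _) _]max_l.
  have h1 := bnd (Num.max x 0) (m0 x) _.
  have h2 := bnd (Num.max y 0) (m0 y) _.
  have h3 : `|u k (Num.max y 0) - u k (Num.max x 0)| < e / 3.
    by apply: hr; exact: le_lt_trans near_max yr.
  rewrite (vm y) (vm x).
  have {}h1 := h1 ltac:(lra).
  have {}h2 : `|u k (Num.max y 0) - v (Num.max y 0)| < e / 3.
    by apply: h2; have := ler_norm (Num.max y 0 - Num.max x 0); lra.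
  move: h1 h2 h3; rewrite !ltr_norml; lra.
have [s0 ds ls] := hT _ cv.
set s := (T v).1 in s0 ds; set d := (T v).2 in ds ls.
have sv x : 0 <= x -> s x = v x.
  move=> x0; apply/eqP; rewrite -subr_eq0 -normr_le0; apply/ler_addgt0Pl => e e0.
  rewrite addr0.
  have [k hk] := pow2_small (4 * B * expR (K * x)) e0.
  have [u0 du lu] := hT _ (cu k).
  have vl' y : 0 <= y -> `|v y - u k y| <= 2 * B * 2 ^- k * expR (K * y).
    by move=> y0; rewrite distrC vl.
  have := sol_contraction L0 gL ls lu ds du s0 u0 vl' x0.
  have := vl k.+1 x x0; rewrite /= -/(u k.+1) subrr normr0 add0r -/K.
  have -> : (2 ^- k.+1 : R) = 2 ^- k / 2 by rewrite exprS invfM mulrC.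
  have -> : s x - v x = (s x - (T (u k)).1 x) + ((T (u k)).1 x - v x) by ring.
  move=> h1 h2; apply: le_trans (ler_normD _ _) _.
  apply: le_trans (ltW hk); apply: le_trans (lerD h2 h1) _.
  set t := 2 ^- k; set E := expR _.
  have E0 : 0 <= B * t * E by rewrite !mulr_ge0 ?expR_ge0 ?invr_ge0 ?exprn_ge0.
  nra.
exists s, d; split => //; have [cd d0 dd] := ls; split => //.
  by rewrite d0 sv.
by move=> x x0; rewrite sv ?ltW//; exact: dd.
Qed.

End Solutions.

Lemma der_epsP (R : realType) (f : R -> R) (x d : R) : has_deriv f x d <->
  forall e : R, 0 < e -> exists2 r : R, 0 < r & forall h : R, h != 0 -> `|h| < r ->
    `|(f (x + h) - f x) / h - d| < e.
Proof.
have E (h : R) : h^-1 *: ((f \o shift x) (h *: (1 : R)) - f x) = (f (x + h) - f x) / h.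
  by rewrite /GRing.scale /= mulr1 mulrC [h + x]addrC.
split=> [[hd he] e e0|H].
  have : h^-1 *: ((f \o shift x) (h *: (1 : R)) - f x) @[h --> 0^'] --> d by rewrite -he; exact: hd.
  move/cvgrPdist_lt/(_ e e0); rewrite near_withinE => /near_dist[r r0 hr].
  by exists r => // h h0 hlt; rewrite -E distrC; apply: hr; rewrite ?subr0.
have c : h^-1 *: ((f \o shift x) (h *: (1 : R)) - f x) @[h --> 0^'] --> d.
  apply/cvgrPdist_lt => e /H[r r0 hr]; rewrite near_withinE; apply/near_dist.
  by exists r => // h; rewrite subr0 => hlt h0; rewrite E distrC hr.
split; last exact: cvg_lim c.
by apply/cvg_ex; exists d.
Qed.

(** * The critical nonlinearity and its truncation *)

Section Nonlinearity.
Variables (R : realType) (q : R).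
Hypothesis q0 : 0 < q.
Implicit Types (v M : R).

Definition phi v : R := `|v| `^ q * v.
Definition Phi v : R := `|v| `^ q * v ^+ 2 / (q + 2).

Lemma phi_odd v : phi (- v) = - phi v.
Proof. by rewrite /phi normrN mulrN. Qed.

Lemma absq_cont v : {for v, continuous (fun t => `|t| `^ q)}.
Proof.
have [->|v0] := eqVneq v 0.
  apply/cont_epsP => e e0; exists (e `^ q^-1); first exact: powR_gt0.
  move=> y; rewrite subr0 => hy; rewrite normr0 powR0 ?gt_eqF// subr0.
  rewrite ger0_norm ?powR_ge0//.
  have -> : e = (e `^ q^-1) `^ q by rewrite -powRrM mulVf ?gt_eqF// powRr1// ltW.
  by apply: gt0_ltr_powR => //; rewrite nnegrE ?powR_ge0// normr_ge0.
have a0 : 0 < `|v| by rewrite normr_gt0.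
apply: (@cont_comp R _ (fun t => t `^ q) (fun t => `|t|)); first exact: norm_continuous.
exact: der_cont (is_derive1_powR _ a0).
Qed.

Lemma phi_der v : has_deriv phi v ((q + 1) * `|v| `^ q).
Proof.
have pos t : 0 < t -> has_deriv phi t ((q + 1) * `|t| `^ q).
  move=> t0; rewrite gtr0_norm//.
  apply: (@der_ext _ (fun t => t `^ q * t)).
    near=> y; rewrite /phi gtr0_norm//; near: y; exact: lt_nbhsr.
  apply: (der_eq (derM (is_derive1_powR q t0) (derI t))).
  have -> : q * t `^ (q - 1) * t = q * t `^ q.
    by rewrite -mulrA [_ * t]mulrC mulr_powRB1// ltW.
  by rewrite mulr1 mulrDl mul1r.
have [v0|v0|<-] := ltgtP 0 v; first exact: pos.
  have n0 : 0 < - v by rewrite oppr_gt0.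
  have -> : phi = (fun t => - phi (- t)) by apply/funext => t; rewrite phi_odd opprK.
  apply: (der_eq (derN (der_comp (g := fun t => - t) (pos _ n0) (derN (derI v))))).
  by rewrite normrN; ring.
rewrite normr0 powR0 ?gt_eqF// mulr0; apply/der_epsP => e e0.
have /cont_epsP/(_ e e0)[r r0 hr] := @absq_cont 0.
exists r => // h h0 hlt; have := hr h; rewrite subr0 => /(_ hlt).
by rewrite normr0 powR0 ?gt_eqF// !subr0 add0r /phi mulr0 subr0 mulfK.
Unshelve. all: by end_near.
Qed.

Lemma Phi_der v : has_deriv Phi v (phi v).
Proof.
have -> : Phi = (fun t => phi t * t * (q + 2)^-1).
  by apply/funext => t; rewrite /Phi /phi; ring.
apply: (der_eq (derM (derM (phi_der v) (derI v)) (derC v (q + 2)^-1))).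
by rewrite /phi; field; rewrite gt_eqF//; have := q0; lra.
Qed.

Lemma phi_cont : continuous phi.
Proof. by move=> v; exact: der_cont (phi_der v). Qed.

Lemma Phi_ge0 v : 0 <= Phi v.
Proof. apply: divr_ge0; last by have := q0; lra.
by apply: mulr_ge0; [exact: powR_ge0|exact: sqr_ge0].
Qed.

Lemma le_powq (s t : R) : 0 <= s -> s <= t -> s `^ q <= t `^ q.
Proof.
by move=> s0 st; apply: ge0_ler_powR; rewrite ?nnegrE ?(ltW q0)//; exact: le_trans st.
Qed.

Lemma phi_lip M s t : `|s| <= M -> `|t| <= M ->
  `|phi s - phi t| <= (q + 1) * M `^ q * `|s - t|.
Proof.
have q1 : 0 <= q + 1 by have := q0; lra.
wlog : s t / t <= s.
  move=> H sM tM; have [h|/ltW h] := leP t s; first exact: H.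
  by rewrite distrC [`|s - t|]distrC; exact: H.
rewrite le_eqVlt => /predU1P[->|ts] sM tM.
  by rewrite !subrr normr0 mulr0.
have [c /andP[tc cs] ->] := MVT_itv ts (fun x _ => @phi_cont x) (fun x _ => phi_der x).
rewrite normrM ler_wpM2r// ger0_norm; last by rewrite mulr_ge0 ?powR_ge0.
rewrite ler_wpM2l// le_powq//; move: sM tM; rewrite !ler_norml; lra.
Qed.

Definition clamp M v : R := Num.max (- M) (Num.min M v).

Lemma clamp_id M v : `|v| <= M -> clamp M v = v.
Proof. by rewrite ler_norml /clamp => /andP[h1 h2]; rewrite (min_r h2) max_r. Qed.

Lemma clamp_norm M v : 0 <= M -> `|clamp M v| <= M.
Proof.
move=> M0; rewrite ler_norml /clamp le_max lexx /= ge_max ge_min lexx andbT; lra.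
Qed.

Lemma max_lip (a s t : R) : `|Num.max a s - Num.max a t| <= `|s - t|.
Proof.
have := ler_norm (s - t); have := ler_norm (t - s); rewrite [`|t - s|]distrC.
have := normr_ge0 (s - t); rewrite ler_norml.
by case: (leP a s) => ?; case: (leP a t) => ? *; lra.
Qed.

Lemma min_lip (a s t : R) : `|Num.min a s - Num.min a t| <= `|s - t|.
Proof.
have := ler_norm (s - t); have := ler_norm (t - s); rewrite [`|t - s|]distrC.
have := normr_ge0 (s - t); rewrite ler_norml.
by case: (leP a s) => ?; case: (leP a t) => ? *; lra.
Qed.

Lemma clamp_lip M s t : `|clamp M s - clamp M t| <= `|s - t|.
Proof. exact: le_trans (max_lip _ _ _) (min_lip _ _ _). Qed.

End Nonlinearity.

(** * Energy, global existence and dependence on the initial value *)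

Section Sol.
Variables (R : realType) (N : nat).
Hypothesis N7 : (7 <= N)%N.
Local Notation n := (N%:R : R).
Implicit Types (d v g G : R -> R) (x y K L M a : R).

Lemma sol_ext g g' a v d : (forall x, 0 <= x -> g (v x) = g' (v x)) ->
  sol N g a v d -> sol N g' a v d.
Proof.
move=> E [v0 dv [cd d0 dd]]; split => //; split => //.
  by rewrite d0 E.
by move=> x x0; rewrite -E ?ltW//; exact: dd.
Qed.

Lemma sol_cont g a v d : sol N g a v d -> continuous v.
Proof. by move=> [_ dv _] x; exact: der_cont (dv x). Qed.

Lemma sol_dcont g a v d : sol N g a v d -> continuous d.
Proof. by move=> [_ _ []]. Qed.

Lemma sol_der2 g a v d x : sol N g a v d -> 0 < x ->
  has_deriv d x ((- g (v x) - n * (x + 1) * d x) / sinh2 x).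
Proof. move=> [_ _ ld] x0; exact: (lin_der N7 ld x0). Qed.

(** The first order term acts as friction: the energy has derivative
    [- (n - 1) * (t + 1) * d t ^+ 2]. Any [g] with primitive [G] is allowed because the truncated
    nonlinearity is needed as well. *)
Lemma sol_energy g G a v d : sol N g a v d -> (forall t, has_deriv G t (g t)) ->
  forall x y, 0 <= x -> x <= y ->
  sinh2 y * d y ^+ 2 / 2 + G (v y) <= sinh2 x * d x ^+ 2 / 2 + G (v x).
Proof.
move=> s dG x y x0 xy; have n7 := n7 R N7; have [_ dv [cd _ _]] := s.
pose H t := - (sinh2 t * d t ^+ 2 / 2 + G (v t)).
suff : H x <= H y by rewrite lerN2.
have cH t : x <= t <= y -> {for t, continuous H}.
  move=> _; apply: contN; apply: contD.
    apply: contM; last exact: contC.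
    by apply: contM; [exact: sinh2_cont|apply: contX; exact: cd].
  by apply: cont_comp; [exact: der_cont (dv t)|exact: der_cont (dG _)].
have dH t : x < t < y -> has_deriv H t ((n - 1) * (t + 1) * d t ^+ 2).
  move=> /andP[xt _]; have t0 : 0 < t by lra.
  have P0 := sinh2_gt0 t0.
  apply: (der_eq (derN (derD (derM (derM (sinh2_der t) (derX 2 (sol_der2 s t0))) (derC t 2^-1))
    (der_comp (dG (v t)) (dv t))))).
  by rewrite expr1; field; rewrite gt_eqF.
have H0 t : x < t < y -> 0 <= (n - 1) * (t + 1) * d t ^+ 2.
  by move=> xty; apply: mulr_ge0; [apply: mulr_ge0; lra|exact: sqr_ge0].
exact: (der_ge0_le xy cH dH H0).
Qed.

(** The contraction estimate is applied to the two solutions themselves: a bound [B] improves to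
    [|a - a'| + B / 2], so that, starting from [2 M], the bounds decrease to the fixed point
    [2 |a - a'|]. *)
Lemma sol_dep g L M a a' v d v' d' : 0 <= L ->
  (forall s t, `|g s - g t| <= L * `|s - t|) ->
  sol N g a v d -> sol N g a' v' d' ->
  (forall x, 0 <= x -> `|v x| <= M) -> (forall x, 0 <= x -> `|v' x| <= M) ->
  forall x, 0 <= x ->
  `|v x - v' x| <= 2 * `|a - a'| * expR ((2 * L + 1) * x) /\
  `|d x - d' x| <= 2 * L * `|a - a'| * expR ((2 * L + 1) * x).
Proof.
move=> L0 gL [v0 dv ld] [v0' dv' ld'] vM vM'; have n7 := n7 R N7.
have M0 : 0 <= M by apply: le_trans (vM 0 (lexx _)).
pose B k : R := 2 * `|a - a'| + 2 * M * 2 ^- k.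
have hB k x : 0 <= x -> `|v x - v' x| <= B k * expR ((2 * L + 1) * x).
  elim: k x => [|k ih] x x0.
    have e1 : 1 <= expR ((2 * L + 1) * x) by rewrite expR_ge_1// mulr_ge0//; lra.
    apply: le_trans (ler_normB _ _) _; rewrite /B expr0 invr1 mulr1.
    have := vM x x0; have := vM' x x0; have := normr_ge0 (a - a'); nra.
  apply: le_trans (sol_contraction N7 L0 gL ld ld' dv dv' v0 v0' ih x0) _.
  rewrite ler_wpM2r ?expR_ge0// /B.
  have -> : (2 ^- k.+1 : R) = 2 ^- k / 2 by rewrite exprS invfM mulrC.
  have := normr_ge0 (a - a'); lra.
have main x : 0 <= x -> `|v x - v' x| <= 2 * `|a - a'| * expR ((2 * L + 1) * x).
  move=> x0; apply/ler_addgt0Pl => e e0.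
  have [k hk] := pow2_small (2 * M * expR ((2 * L + 1) * x)) e0.
  apply: le_trans (hB k x x0) _; rewrite /B mulrDl addrC lerD2r.
  by rewrite mulrAC ltW.
move=> x x0; split; first exact: main.
have hh y : 0 <= y -> `|- g (v y) - - g (v' y)| <= L * (2 * `|a - a'|) * expR ((2 * L + 1) * y).
  move=> y0; have -> : - g (v y) - - g (v' y) = - (g (v y) - g (v' y)) by ring.
  rewrite normrN; apply: le_trans (gL _ _) _.
  by rewrite -mulrA ler_wpM2l// main.
have K0 : 0 <= 2 * L + 1 by lra.
apply: le_trans (lin_bound N7 K0 (linB ld ld') hh x0) _.
rewrite ler_wpM2r ?expR_ge0// ler_pdivrMr; last lra.
have : 0 <= L * `|a - a'| by rewrite mulr_ge0.
nra.
Qed.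

Variables (lam q : R).
Hypotheses (lam0 : 0 < lam) (q0 : 0 < q).

Definition nonlin (v : R) : R := lam * v + phi q v.
Definition nonlin_prim (v : R) : R := lam * v ^+ 2 / 2 + Phi q v.

Lemma nonlin_der t : has_deriv nonlin t (lam + (q + 1) * `|t| `^ q).
Proof.
by apply: (der_eq (derD (derM (derC t lam) (derI t)) (phi_der q0 t))); ring.
Qed.

Lemma nonlin_cont : continuous nonlin.
Proof. by move=> t; exact: der_cont (nonlin_der t). Qed.

Lemma nonlin_prim_der t : has_deriv nonlin_prim t (nonlin t).
Proof.
apply: (der_eq (derD (derM (derM (derC t lam) (derX 2 (derI t))) (derC t 2^-1)) (Phi_der q0 t))).
by rewrite /nonlin expr1; field.
Qed.

Lemma nonlin_prim_ge (v : R) : lam * v ^+ 2 / 2 <= nonlin_prim v.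
Proof. by rewrite /nonlin_prim lerDl Phi_ge0. Qed.

(** The energy bounds [v ^+ 2] by the last two terms. Adding 1 makes the sum M satisfy
    [M <= M ^+ 2], hence [|v| <= M], and spares a square root. *)
Definition Mbound a : R := 1 + a ^+ 2 + 2 / lam * (`|a| `^ q * a ^+ 2).

Lemma Mbound_ge1 a : 1 <= Mbound a.
Proof.
rewrite /Mbound -addrA lerDl addr_ge0 ?sqr_ge0// mulr_ge0//; first by rewrite divr_ge0// ltW.
by rewrite mulr_ge0 ?sqr_ge0 ?powR_ge0.
Qed.

Lemma Mbound_le a (b : R) : `|a| <= b -> Mbound a <= Mbound b.
Proof.
move=> ab; have b0 : 0 <= b by apply: le_trans ab.
have sq : a ^+ 2 <= b ^+ 2.
  by rewrite -[a ^+ 2]real_normK ?num_real// ler_pXn2r ?nnegrE.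
rewrite /Mbound lerD//; first by rewrite lerD2l.
have l0 : 0 <= 2 / lam by rewrite divr_ge0// ltW.
apply: ler_wpM2l => //; apply: ler_pM; [exact: powR_ge0|exact: sqr_ge0| |exact: sq].
by rewrite [`|b|]ger0_norm// le_powq.
Qed.

Lemma le_Mbound a : `|a| <= Mbound a.
Proof.
apply: (@le_trans _ _ (1 + a ^+ 2)).
  by rewrite -[a ^+ 2]real_normK ?num_real//; nra.
by rewrite lerDl mulr_ge0 ?divr_ge0 ?(ltW lam0)// mulr_ge0 ?sqr_ge0 ?powR_ge0.
Qed.

Lemma le_Mbound_sqr (v : R) a : lam * v ^+ 2 / 2 <= lam * a ^+ 2 / 2 + `|a| `^ q * a ^+ 2 ->
  `|v| <= Mbound a.
Proof.
move=> h; have M1 := Mbound_ge1 a.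
rewrite -(@ler_pXn2r _ 2)// ?nnegrE//; last lra.
rewrite real_normK ?num_real//; apply: (@le_trans _ _ (Mbound a)); last by nra.
have : v ^+ 2 <= a ^+ 2 + 2 / lam * (`|a| `^ q * a ^+ 2); last by rewrite /Mbound; lra.
move: h; set T := `|a| `^ q * a ^+ 2 => h; rewrite -(ler_pM2l lam0) mulrDr.
by have -> : lam * (2 / lam * T) = 2 * T; [field; rewrite gt_eqF|lra].
Qed.

Lemma sol_bound a v d : sol N nonlin a v d -> forall x, 0 <= x -> `|v x| <= Mbound a.
Proof.
move=> s x x0; apply: le_Mbound_sqr; have [v0 _ _] := s.
have := sol_energy s nonlin_prim_der (lexx _) x0; rewrite {2}/sinh2 mul0r !mul0r add0r v0.
have := nonlin_prim_ge (v x).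
have : 0 <= sinh2 x * d x ^+ 2 / 2 by rewrite divr_ge0// mulr_ge0 ?sinh2_ge0 ?sqr_ge0.
have : Phi q a <= `|a| `^ q * a ^+ 2.
  rewrite /Phi ler_pdivrMr; last by have := q0; lra.
  rewrite ler_peMr//; first exact: mulr_ge0 (powR_ge0 _ _) (sqr_ge0 _).
  by have := q0; lra.
by rewrite [nonlin_prim a]/nonlin_prim; lra.
Qed.

(** Truncation makes the nonlinearity globally Lipschitz, as the Picard scheme requires; it is
    harmless as soon as the solution is known to stay below [M]. *)
Definition fM M (v : R) : R := lam * v + phi q (clamp M v).

Lemma fM_lip M : 0 <= M -> forall s t,
  `|fM M s - fM M t| <= (lam + (q + 1) * M `^ q) * `|s - t|.
Proof.
move=> M0 s t; have -> : fM M s - fM M t =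
  lam * (s - t) + (phi q (clamp M s) - phi q (clamp M t)) by rewrite /fM; ring.
apply: le_trans (ler_normD _ _) _; rewrite mulrDl lerD//.
  by rewrite normrM ger0_norm// ltW.
apply: le_trans (phi_lip q0 (clamp_norm _ M0) (clamp_norm _ M0)) _.
by rewrite ler_wpM2l ?clamp_lip// mulr_ge0 ?powR_ge0//; have := q0; lra.
Qed.

Lemma fM_ff M (v : R) : `|v| <= M -> fM M v = nonlin v.
Proof. by move=> vM; rewrite /fM clamp_id. Qed.

Lemma LM_ge0 M : 0 <= lam + (q + 1) * M `^ q.
Proof. by rewrite addr_ge0 ?(ltW lam0)// mulr_ge0 ?powR_ge0//; have := q0; lra. Qed.

Lemma phi_sign M t s : 0 <= M -> `|s| <= `|t| -> 0 <= s * t ->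
  0 <= phi q (clamp M s) * t.
Proof.
move=> M0 st sgn; rewrite /phi -mulrA mulr_ge0 ?powR_ge0//.
have [/eqP|s0] := eqVneq (`|s|) 0.
  by rewrite normr_eq0 => /eqP ->; rewrite clamp_id ?normr0// mul0r.
have : 0 < s \/ s < 0.
  by move: s0; rewrite normr_eq0 neq_lt => /orP[]; [right|left].
case=> {}s0.
  have t0 : 0 <= t by rewrite -(pmulr_rge0 t s0).
  by rewrite mulr_ge0// /clamp le_max le_min M0 (ltW s0) orbT.
have t0 : t <= 0 by rewrite -(nmulr_rge0 t s0).
by rewrite mulr_le0// /clamp ge_max ge_min (ltW s0) orbT andbT; lra.
Qed.

(** The truncated equation with M = [Mbound a] has a solution. Its potential [Psi] is nonnegative,
    and [Psi a] is at most [|a| ^ q * a ^+ 2], so the decreasing energy keeps [|v|] below M, where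
    truncated and original nonlinearity agree. *)
Lemma sol_exists a : exists v d, sol N nonlin a v d.
Proof.
set M := Mbound a; have M1 : 1 <= M := Mbound_ge1 a; have M0 : 0 <= M by lra.
have [v [d s]] := picard N7 a (LM_ge0 M) (fM_lip M0).
exists v, d; apply: (sol_ext _ s) => x x0; apply: fM_ff.
have [v0 _ _] := s.
have cphi : continuous (fun t => phi q (clamp M t)).
  have h : continuous (clamp M).
    move=> t; apply/cont_epsP => e e0; exists e => // y.
    exact: le_lt_trans (clamp_lip _ _ _).
  by move=> t; apply: (@cont_comp R _ (phi q) (clamp M)); [exact: h|exact: phi_cont].
have [Psi Psi0 dPsi] := primitive cphi.
have Psi_mvt t : exists2 c, `|c| <= `|t| /\ 0 <= c * t & Psi t = phi q (clamp M c) * t.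
  have cP y : {for y, continuous Psi} by exact: der_cont (dPsi y).
  have [t0|t0|<-] := ltgtP 0 t; last by exists 0; rewrite ?mulr0// !normr0.
    have [c /andP[c0 ct]] := MVT_itv t0 (fun y _ => cP y) (fun y _ => dPsi y).
    rewrite Psi0 !subr0 => ->; exists c => //; rewrite !gtr0_norm// mulr_ge0 ?ltW//.
  have [c /andP[c0 ct]] := MVT_itv t0 (fun y _ => cP y) (fun y _ => dPsi y).
  rewrite Psi0 !sub0r mulrN => /oppr_inj ->; exists c => //.
  by rewrite !ltr0_norm// lerN2 ltW// mulr_le0// ltW.
pose G t := lam * t ^+ 2 / 2 + Psi t.
have dG t : has_deriv G t (fM M t).
  apply: (der_eq (derD (derM (derM (derC t lam) (derX 2 (derI t))) (derC t 2^-1)) (dPsi t))).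
  by rewrite /fM expr1; field.
have := sol_energy s dG (lexx _) x0; rewrite {2}/sinh2 mul0r !mul0r add0r v0 /G.
have : 0 <= sinh2 x * d x ^+ 2 / 2 by rewrite divr_ge0// mulr_ge0 ?sinh2_ge0 ?sqr_ge0.
have : 0 <= Psi (v x).
  by have [c [cv sg] ->] := Psi_mvt (v x); exact: phi_sign.
have : Psi a <= `|a| `^ q * a ^+ 2.
  have [c [ca _] ->] := Psi_mvt a.
  rewrite clamp_id; last exact: le_trans ca (le_Mbound a).
  apply: le_trans (ler_norm _) _; rewrite /phi !normrM [`| _ `^ _|]ger0_norm ?powR_ge0//.
  rewrite -mulrA ler_pM ?powR_ge0 ?mulr_ge0 ?le_powq//.
  by rewrite -[a ^+ 2]real_normK ?num_real// expr2 ler_wpM2r.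
by move=> h1 h2 h3 h4; apply: le_Mbound_sqr; lra.
Qed.

(** All solutions with [|a| <= A] stay below the common height [Mbound A], and so obey one truncated
    equation with one Lipschitz constant. *)
Lemma sol_cont_dep A : 0 <= A -> exists C K, [/\ 0 < C, 0 <= K &
  forall a a' v d v' d', `|a| <= A -> `|a'| <= A -> sol N nonlin a v d -> sol N nonlin a' v' d' ->
  forall x, 0 <= x -> `|v x - v' x| <= C * expR (K * x) * `|a - a'| /\
  `|d x - d' x| <= C * expR (K * x) * `|a - a'|].
Proof.
move=> A0; set M := Mbound A; have M1 : 1 <= M := Mbound_ge1 A; have M0 : 0 <= M by lra.
pose L := lam + (q + 1) * M `^ q; have L0 : 0 <= L := LM_ge0 M.
exists (2 + 2 * L), (2 * L + 1); split; [lra|lra|].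
move=> a a' v d v' d' aA aA' s s' x x0.
have vM y : 0 <= y -> `|v y| <= M.
  by move=> y0; apply: le_trans (sol_bound s y0) _; exact: Mbound_le.
have vM' y : 0 <= y -> `|v' y| <= M.
  by move=> y0; apply: le_trans (sol_bound s' y0) _; exact: Mbound_le.
have sM : sol N (fM M) a v d by apply: (sol_ext _ s) => y y0; rewrite fM_ff ?vM.
have sM' : sol N (fM M) a' v' d' by apply: (sol_ext _ s') => y y0; rewrite fM_ff ?vM'.
have [h1 h2] := sol_dep L0 (fM_lip M0) sM sM' vM vM' x0.
have E0 := expR_ge0 ((2 * L + 1) * x); have D0 := normr_ge0 (a - a').
have p : 0 <= expR ((2 * L + 1) * x) * `|a - a'| by rewrite mulr_ge0.
have pL : 0 <= L * (expR ((2 * L + 1) * x) * `|a - a'|) by rewrite mulr_ge0.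
split; [apply: le_trans h1 _|apply: le_trans h2 _]; nra.
Qed.

End Sol.

(** * Energies and decay *)

Section Decay.
Variables (R : realType) (N : nat) (lam : R).
Hypothesis N7 : (7 <= N)%N.
Local Notation n := (N%:R : R).
Hypothesis lam_lo : n * (n - 2) / 4 < lam.
Hypothesis lam_hi : lam < ((n - 1) / 2) ^+ 2.
Local Notation c := ((n - 2) / 2).
Local Notation q := (4 / (n - 2)).
Local Notation mu := (lam - n * (n - 2) / 4).
Local Notation f := (nonlin lam q).
Local Notation F := (nonlin_prim lam q).

Lemma q_gt0 : 0 < q. Proof. by have := n7 R N7 => h; rewrite divr_gt0//; lra. Qed.

Lemma lam_gt0 : 0 < lam.
Proof. by have := n7 R N7 => h; apply: le_lt_trans lam_lo; rewrite divr_ge0// mulr_ge0; lra. Qed.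

Lemma phiM_Phi t : phi q t * t = (q + 2) * Phi q t.
Proof. move: q_gt0; rewrite /Phi /phi; move: (4 / (n - 2)) => Q h; field; rewrite gt_eqF//; lra. Qed.

Lemma sinhN2_der x : 0 < x -> has_deriv (@sinhN2 R N) x ((n - 2) * (x + 1) * sinhN2 N x / sinh2 x).
Proof.
move=> x0; have P0 := sinh2_gt0 x0; have s0 : 0 < Num.sqrt (sinh2 x) by rewrite sqrtr_gt0.
apply: (der_eq (derX (N - 2) (der_sqrt P0 (sinh2_der x)))).
rewrite /sinhN2 natrB; last by apply: leq_trans N7.
have -> : (N - 2 = (N - 2).-1.+1)%N by rewrite prednK// subn_gt0 (leq_trans _ N7).
rewrite [in RHS]exprS /=; have P1 : sinh2 x = Num.sqrt (sinh2 x) ^+ 2 by rewrite sqr_sqrtr// ltW.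
set s := Num.sqrt (sinh2 x) in s0 P1 *; rewrite P1; field.
by rewrite gt_eqF.
Qed.

Variables (a : R) (v d : R -> R).
Hypothesis s : sol N f a v d.
Let dv x : has_deriv v x (d x). Proof. by case: s. Qed.
Let cv : continuous v. Proof. exact: sol_cont s. Qed.
Let cd : continuous d. Proof. exact: sol_dcont s. Qed.
Let v0 : v 0 = a. Proof. by case: s. Qed.

(* A Pohozaev quantity: its derivative is a multiple of [lam - n (n - 2) / 4], so it
   is positive on [x > 0], which forbids double zeros of [v]. *)
Definition pohozaev x : R := sinhN2 N x * (((c * (x + 1) * v x + sinh2 x * d x) ^+ 2
  - c ^+ 2 * v x ^+ 2 + mu * sinh2 x * v x ^+ 2) / 2 + sinh2 x * Phi q (v x)).

Lemma pohozaev_cont : continuous pohozaev.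
Proof.
move=> x; have hP := @sinh2_cont R x; have hv := @cv x; have hd := @cd x.
have hX : {for x, continuous (fun y : R => y + 1)} by apply: contD; [exact: contI|exact: contC].
have hF : {for x, continuous (fun y => Phi q (v y))}.
  by apply: cont_comp => //; exact: der_cont (Phi_der q_gt0 _).
apply: contM; first exact: sinhN2_cont.
apply: contD; last exact: contM.
apply: contM; last exact: contC.
apply: contD; [apply: contB|apply: contM].
- apply: contX; apply: contD; last exact: contM.
  by apply: contM => //; apply: contM => //; exact: contC.
- by apply: contM; [exact: contC|exact: contX].
- by apply: contM => //; exact: contC.
- exact: contX.
Qed.

Lemma pohozaev_der x : 0 < x -> has_deriv pohozaev x (mu * (x + 1) * sinhN2 N x * v x ^+ 2).
Proof.
move=> x0; have P0 := sinh2_gt0 x0; have h := n7 R N7.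
have dP := sinh2_der x; have dd := sol_der2 N7 s x0; have dvx := dv x.
have dX := derD (derI x) (derC x 1).
apply: (der_eq (derM (sinhN2_der x0) (derD (derM (derD (derB (derX 2 (derD
  (derM (derM (derC x c) dX) dvx) (derM dP dd)))
  (derM (derC x (c ^+ 2)) (derX 2 dvx))) (derM (derM (derC x mu) dP) (derX 2 dvx)))
  (derC x 2^-1)) (derM dP (der_comp (Phi_der q_gt0 (v x)) dvx))))).
(* The critical exponent enters here: [q + 2 = 2 n / (n - 2)], and with this ratio all nonlinear
   terms of the derivative cancel. *)
have -> : Phi q (v x) = phi q (v x) * v x * ((n - 2) / (2 * n)).
  by rewrite phiM_Phi; field; rewrite !gt_eqF//; lra.
rewrite /nonlin /=; set p := phi q (v x); set W := sinhN2 N x; rewrite /sinh2 in P0 *.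
field; rewrite !gt_eqF//; lra.
Qed.

Lemma mu_gt0 : 0 < mu. Proof. by rewrite subr_gt0. Qed.

Lemma pohozaev_gt0 x : a != 0 -> 0 < x -> 0 < pohozaev x.
Proof.
move=> a0 x0; have E0 : pohozaev 0 = 0.
  rewrite /pohozaev /sinhN2 /sinh2 mul0r sqrtr0 expr0n.
  have -> : (N - 2 == 0)%N = false by apply/negbTE; rewrite -lt0n subn_gt0 (leq_trans _ N7).
  by rewrite /= mul0r.
have cn : {for 0, continuous (fun x => `|v x|)} by apply: cont_norm; exact: cv.
have [|r r0 hr] := cont_gt (m := 0) cn; first by rewrite v0 normr_gt0.
pose y := Num.min (r / 2) x.
have y0 : 0 < y by rewrite lt_min x0 andbT; lra.
have yr : y <= r / 2 by rewrite ge_min lexx.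
have yx : y <= x by rewrite ge_min lexx orbT.
have pos t : 0 < t -> 0 <= mu * (t + 1) * sinhN2 N t * v t ^+ 2.
  move=> t0; apply: mulr_ge0; last exact: sqr_ge0.
  by apply: mulr_ge0; [apply: mulr_ge0; [exact: ltW mu_gt0|lra]|exact: sinhN2_ge0].
have cE z w t : z <= t <= w -> {for t, continuous pohozaev} by move=> _; exact: pohozaev_cont.
have dE z w t : 0 <= z -> z < t < w -> has_deriv pohozaev t (mu * (t + 1) * sinhN2 N t * v t ^+ 2).
  by move=> z0 /andP[zt _]; apply: pohozaev_der; lra.
have h1 : pohozaev y <= pohozaev x.
  apply: (der_ge0_le yx (cE y x)) (fun t => dE y x t (ltW y0)) _ => t /andP[yt _].
  by apply: pos; lra.
apply: lt_le_trans h1.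
have [t /andP[t0 ty]] := MVT_itv y0 (cE 0 y) (fun t => dE 0 y t (lexx _)).
rewrite E0 !subr0 => ->; rewrite mulr_gt0// mulr_gt0//.
  by rewrite mulr_gt0 ?sinhN2_gt0// mulr_gt0 ?mu_gt0//; lra.
have : 0 < `|v t| by apply: hr; rewrite subr0 gtr0_norm//; lra.
by rewrite normr_gt0 => vt; rewrite exprn_even_gt0.
Qed.

Lemma simple_zero x : a != 0 -> 0 <= x -> v x = 0 -> d x != 0.
Proof.
rewrite le_eqVlt => a0 /predU1P[<-|x0] vx; first by move: a0; rewrite -v0 vx eqxx.
apply/eqP => dx; have := pohozaev_gt0 a0 x0; rewrite /pohozaev vx dx.
have -> : Phi q 0 = 0 by rewrite /Phi expr0n /= mulr0 mul0r.
by rewrite (_ : sinhN2 N x * _ = 0) ?ltxx//; ring.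
Qed.

Definition energy x : R := sinh2 x * d x ^+ 2 / 2 + F (v x).

Lemma energy_mono x y : 0 <= x -> x <= y -> energy y <= energy x.
Proof. exact: (sol_energy N7 s (nonlin_prim_der lam q_gt0)). Qed.

Lemma energy_v x : 0 <= x -> lam * v x ^+ 2 / 2 <= energy x.
Proof.
move=> x0; apply: le_trans (nonlin_prim_ge lam q_gt0 (v x)) _; rewrite lerDr.
by apply: divr_ge0 => //; apply: mulr_ge0; [exact: sinh2_ge0|exact: sqr_ge0].
Qed.

Lemma energy_d x : 0 <= x -> sinh2 x * d x ^+ 2 / 2 <= energy x.
Proof.
move=> x0; rewrite lerDl; apply: le_trans (nonlin_prim_ge lam q_gt0 (v x)).
by apply: divr_ge0 => //; apply: mulr_ge0; [exact: ltW lam_gt0|exact: sqr_ge0].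
Qed.

(** Weight of the cross term in [LL]. With S = (x + 1) d, the cross term costs at most
    [(1 + T ^+ 2 / (2 lam)) * S ^+ 2] with [T = 1 + 4 n / 3]; this choice lets half of the friction
    [(n - 1) * S ^+ 2] absorb it. *)
Let e := Num.min 1 ((n - 1) / 2 / (1 + (1 + 4 * n / 3) ^+ 2 / (2 * lam))).

Let e_gt0 : 0 < e.
Proof.
have h := n7 R N7; have l := lam_gt0; rewrite lt_min ltr01 /= divr_gt0//; first lra.
by rewrite ltr_wpDr// divr_ge0 ?sqr_ge0//; lra.
Qed.

(** A Lyapunov function: friction alone gives no decay where [d = 0], and the cross term adds
    dissipation of [v], so that in the variable ln (x + 1) the loss is at least a multiple of the
    whole energy. *)
Let LL x : R := energy x + e * ((x + 1) * v x * d x).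

Let dLL x : R := - (n - 1) * (x + 1) * d x ^+ 2 + e * (v x * d x + (x + 1) * d x ^+ 2
  + (x + 1) * v x * ((- f (v x) - n * (x + 1) * d x) / sinh2 x)).

Let LL_der x : 0 < x -> has_deriv LL x (dLL x).
Proof.
move=> x0; have P0 := sinh2_gt0 x0.
have dP := sinh2_der x; have dd := sol_der2 N7 s x0; have dvx := dv x.
have dX := derD (derI x) (derC x 1).
apply: (der_eq (derD (derD (derM (derM dP (derX 2 dd)) (derC x 2^-1))
   (der_comp (nonlin_prim_der lam q_gt0 (v x)) dvx)) (derM (derC x e) (derM (derM dX dvx) dd)))).
by rewrite /dLL /=; field; rewrite gt_eqF.
Qed.

(** For x >= 1 the ratio [r = (x + 1) ^+ 2 / sinh2 x] lies in [1, 4/3], so [|1 - r n| <= T]; the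
    mixed term [(1 - r n) v S] is then split by the inequality of Young between [lam * v ^+ 2 / 2]
    and a multiple of [S ^+ 2]. *)
Let dLL_le x : 1 <= x -> (x + 1) * dLL x <= - e * energy x.
Proof.
move=> x1; have x0 : 0 < x by lra.
have P0 := sinh2_gt0 x0; have h := n7 R N7; have l := lam_gt0; have e0 := e_gt0.
pose X := x + 1; pose S := X * d x; pose r := X ^+ 2 / sinh2 x.
have XE : X ^+ 2 = sinh2 x + 1 by rewrite /X /sinh2; ring.
have P3 : 3 <= sinh2 x by rewrite /sinh2; nra.
have r1 : 1 <= r by rewrite /r ler_pdivlMr// mul1r XE; lra.
have r4 : r <= 4 / 3 by rewrite /r ler_pdivrMr// XE; lra.
have -> : (x + 1) * dLL x = - (n - 1) * S ^+ 2 + e * (v x * S + S ^+ 2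
    - r * (lam * v x ^+ 2 + (q + 2) * Phi q (v x) + n * v x * S)).
  rewrite -phiM_Phi /dLL /S /r /X /nonlin; field; rewrite !gt_eqF//; lra.
have HS : energy x <= S ^+ 2 / 2 + (lam * v x ^+ 2 / 2 + Phi q (v x)).
  rewrite /energy /nonlin_prim lerD2r// ler_pM2r ?invr_gt0// /S exprMn XE ler_wpM2r ?sqr_ge0//; lra.
have Ph : 0 <= Phi q (v x) := Phi_ge0 q_gt0 _.
have q0 := q_gt0.
set T := 1 + 4 * n / 3.
have Tpos : 0 <= T by rewrite /T; lra.
have eT : e * (1 + T ^+ 2 / (2 * lam)) <= (n - 1) / 2.
  rewrite -ler_pdivlMr; first by rewrite /e ge_min lexx orbT.
  by rewrite ltr_wpDr// divr_ge0 ?sqr_ge0//; lra.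
have e1 : e <= 1 by rewrite /e ge_min lexx.
have young : v x * S - r * (n * v x * S) <= lam * v x ^+ 2 / 2 + T ^+ 2 / (2 * lam) * S ^+ 2.
  have : `|(1 - r * n) * (v x * S)| <= T * (`|v x| * `|S|).
    rewrite normrM [`|v x * S|]normrM ler_wpM2r ?mulr_ge0// ler_norml /T; apply/andP.
    by split; nra.
  have : (1 - r * n) * (v x * S) <= `|(1 - r * n) * (v x * S)| by exact: ler_norm.
  have : T * (`|v x| * `|S|) <= lam * v x ^+ 2 / 2 + T ^+ 2 / (2 * lam) * S ^+ 2.
    rewrite -[v x ^+ 2]real_normK ?num_real// -[S ^+ 2]real_normK ?num_real//.
    rewrite -subr_ge0; set A := `|v x|; set B := `|S|.
    have -> : lam * A ^+ 2 / 2 + T ^+ 2 / (2 * lam) * B ^+ 2 - T * (A * B) =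
      (lam * A - T * B) ^+ 2 / (2 * lam) by field; rewrite gt_eqF.
    by rewrite divr_ge0 ?sqr_ge0//; lra.
  lra.
have A0 : 0 <= v x ^+ 2 := sqr_ge0 _.
have B0 : 0 <= S ^+ 2 := sqr_ge0 _.
have lA : 0 <= lam * v x ^+ 2 by rewrite mulr_ge0// ltW.
have step1 : v x * S + S ^+ 2 - r * (lam * v x ^+ 2 + (q + 2) * Phi q (v x) + n * v x * S)
   <= (1 + T ^+ 2 / (2 * lam)) * S ^+ 2 - (lam * v x ^+ 2 / 2 + Phi q (v x)).
  have qP := mulr_ge0 (ltW q0) Ph.
  move: young Ph qP; move: (4 / (n - 2)) => Q young Ph qP.
  have : lam * v x ^+ 2 + (Q + 2) * Phi Q (v x) <= r * (lam * v x ^+ 2 + (Q + 2) * Phi Q (v x)).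
    by rewrite ler_peMl//; lra.
  lra.
have := ler_wpM2l (ltW e0) step1; have := ler_wpM2l (ltW e0) HS.
have := ler_wpM2r B0 eT.
nra.
Qed.

(** If the energy stayed above [eps], [LL] would drop at least like [- e * eps * ln (x + 1)],
    although the energy at 1 bounds it from below. *)
Lemma energy_small eps : 0 < eps -> exists2 x, 1 <= x & energy x < eps.
Proof.
move=> eps0; apply: contrapT => H.
have Hge x : 1 <= x -> eps <= energy x by move=> x1; rewrite leNgt; apply/negP => ?; apply: H; exists x.
have h := n7 R N7; have l := lam_gt0; have e0 := e_gt0.
have H1 := Hge 1 (lexx _).
(* In units of the energy, [2 / lam] bounds [v ^+ 2] and [8 / 3] bounds [((x + 1) d) ^+ 2], the
   latter because [(x + 1) ^+ 2 = sinh2 x + 1] and [sinh2 x >= 3]. *)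
pose K := energy 1 * (1 + 2 / lam + 8 / 3).
have LLge x : 1 <= x -> - K <= LL x.
  move=> x1; have x0 : 0 <= x by lra.
  have hm := energy_mono ler01 x1; have hv := energy_v x0; have hd := energy_d x0.
  have Hx := Hge x x1.
  have A : v x ^+ 2 <= 2 / lam * energy 1.
    rewrite mulrAC ler_pdivlMr//; lra.
  have B : ((x + 1) * d x) ^+ 2 <= 8 / 3 * energy 1.
    have -> : ((x + 1) * d x) ^+ 2 = sinh2 x * d x ^+ 2 + d x ^+ 2 by rewrite /sinh2; ring.
    have : 3 * d x ^+ 2 <= sinh2 x * d x ^+ 2 by rewrite ler_wpM2r ?sqr_ge0// /sinh2; nra.
    lra.
  have e1 : e <= 1 by rewrite /e ge_min lexx.
  have AB : `|(x + 1) * v x * d x| <= v x ^+ 2 + ((x + 1) * d x) ^+ 2.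
    have -> : (x + 1) * v x * d x = v x * ((x + 1) * d x) by ring.
    set S := (x + 1) * d x; rewrite ler_norml; apply/andP; split; nra.
  have : `|e * ((x + 1) * v x * d x)| <= v x ^+ 2 + ((x + 1) * d x) ^+ 2.
    by rewrite normrM (gtr0_norm e0); apply: le_trans AB; rewrite ler_piMl.
  rewrite ler_norml => /andP[+ _]; rewrite /LL /K; lra.
have LLle x : 1 <= x -> LL x - LL 1 <= - (e * eps) * ln (x + 1) - (- (e * eps) * ln (1 + 1)).
  move=> x1.
  have cL y : 1 <= y <= x -> {for y, continuous LL}.
    by move=> y1; apply: der_cont (LL_der _); lra.
  pose lnf (y : R) := - (e * eps) * ln (y + 1).
  have dln (y : R) : 1 <= y -> has_deriv lnf y (- (e * eps) / (y + 1)).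
    move=> y1; have yp : 0 < y + 1 by lra.
    apply: (der_eq (derM (derC y (- (e * eps))) (der_comp (g := fun y => y + 1)
      (is_derive1_ln yp) (derD (derI y) (derC y 1))))); field; lra.
  have cl y : 1 <= y <= x -> {for y, continuous lnf}.
    by move=> /andP[y1 _]; apply: der_cont (dln y y1).
  have dL y : 1 < y < x -> has_deriv LL y (dLL y) by move=> ?; apply: LL_der; lra.
  have dl y : 1 < y < x -> has_deriv lnf y (- (e * eps) / (y + 1)).
    by move=> ?; apply: dln; lra.
  have le_d y : 1 < y < x -> dLL y <= - (e * eps) / (y + 1).
    move=> /andP[y1 _]; rewrite ler_pdivlMr; last lra.
    rewrite mulrC; apply: le_trans (dLL_le (ltW y1)) _.
    by rewrite mulNr lerN2 ler_wpM2l ?(ltW e0)// Hge// ltW.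
  exact: (der_le x1 cL cl dL dl le_d).
pose T := (LL 1 + K) / (e * eps) + ln (1 + 1) + 1.
pose x := expR `|T| + 1.
have x1 : 1 <= x by rewrite /x lerDr expR_ge0.
have Tx : T <= ln (x + 1).
  have xp : 0 < x + 1 by lra.
  have ex : expR `|T| <= x + 1 by rewrite /x; lra.
  by apply: le_trans (ler_norm _) _; rewrite -[leLHS]expRK ler_ln ?posrE ?expR_gt0.
have ee : 0 < e * eps by rewrite mulr_gt0.
have := LLle x x1; have := LLge x x1.
have := ler_wpM2l (ltW ee) Tx.
have -> : e * eps * T = LL 1 + K + e * eps * ln (1 + 1) + e * eps.
  by rewrite /T; field; rewrite !gt_eqF.
lra.
Qed.

End Decay.

(** * Slow decay and trapping *)

Section Trap.
Variables (R : realType) (N : nat) (lam : R).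
Hypothesis N7 : (7 <= N)%N.
Local Notation n := (N%:R : R).
Hypothesis lam_lo : n * (n - 2) / 4 < lam.
Hypothesis lam_hi : lam < ((n - 1) / 2) ^+ 2.
Local Notation q := (4 / (n - 2)).
Local Notation f := (nonlin lam q).
Local Notation D := (((n - 1) / 2) ^+ 2 - lam).
Local Notation b := ((n - 1) / 2 + D).

Lemma D_gt0 : 0 < D. Proof. by rewrite subr_gt0. Qed.

(** The two bounds on [lam] differ by exactly 1/4. Hence D < sqrt D, and [b] lies strictly below the
    larger root (n - 1) / 2 + sqrt D of the indicial equation at infinity. *)
Lemma D_lt : D < 1 / 4.
Proof. by have := lam_lo; nra. Qed.

Lemma gronwall_pos (g dg : R -> R) (K x t : R) : x <= t ->
  (forall y, x <= y <= t -> {for y, continuous g}) ->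
  (forall y, x < y < t -> has_deriv g y (dg y)) ->
  (forall y, x < y < t -> 0 <= dg y + K * g y) -> 0 < g x -> 0 < g t.
Proof.
move=> xt cg dgg h gx.
pose G y := g y * expR (K * y).
have dE (y : R) : has_deriv (fun y => expR (K * y)) y (expR (K * y) * K).
  by apply: (der_eq (der_comp (is_derive_expR _) (derM (derC y K) (derI y)))); ring.
have cG y : x <= y <= t -> {for y, continuous G}.
  by move=> xyt; apply: contM; [exact: cg|exact: der_cont (dE y)].
have dG y : x < y < t -> has_deriv G y ((dg y + K * g y) * expR (K * y)).
  by move=> xyt; apply: (der_eq (derM (dgg y xyt) (dE y))); ring.
have G0 y : x < y < t -> 0 <= (dg y + K * g y) * expR (K * y).
  by move=> xyt; rewrite mulr_ge0 ?h ?expR_ge0.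
have := der_ge0_le xt cG dG G0; rewrite /G => h1.
have : 0 < g t * expR (K * t) by apply: lt_le_trans h1; rewrite mulr_gt0 ?expR_gt0.
by rewrite pmulr_lgt0 ?expR_gt0.
Qed.

Lemma sol_opp a v d : sol N f a v d -> sol N f (- a) (fun x => - v x) (fun x => - d x).
Proof.
have fo t : f (- t) = - f t by rewrite /nonlin phi_odd mulrN -opprD.
move=> [v0 dv [cd d0 dd]]; split; first by rewrite v0.
  by move=> x; exact: derN.
split; first by move=> x; apply: contN; exact: cd.
  by rewrite d0 fo !mulNr.
move=> x x0; have -> : (fun y => sinhN N y * - d y) = (fun y => - (sinhN N y * d y)).
  by apply/funext => y; rewrite mulrN.
by rewrite fo mulrN; apply: derN; exact: dd.
Qed.

(* [wtrap] vanishes on [(x + 1) `^ (- b)]: where it has the sign of [v], [v] decays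
   more slowly than that power. *)
Definition wtrap (v d : R -> R) x := (x + 1) * d x + b * v x.

Local Ltac prune := clear -N7 lam_lo lam_hi.
Local Ltac lra0 := prune; lra.

(** Let t be the first point where the minimum of [v] and w = [wtrap v d] reaches 0. Before t both
    are positive, which gives [d + b v >= 0] and [w' + (4 n / 3) w >= 0]; multiplied by
    exponentials, these inequalities keep both positive at t. *)
Lemma trap_pos a v d x0 : sol N f a v d -> 1 <= x0 ->
  (forall x, x0 <= x -> `|v x| `^ q <= D / 2) -> 0 < v x0 -> 0 < wtrap v d x0 ->
  forall x, x0 <= x -> 0 < v x.
Proof.
move=> s x01 small vp wp x x0x; have h := n7 R N7; have D0 := D_gt0; have D4 := D_lt.
have b0 : 0 < b by lra.
have [_ dv _] := s; have cd := sol_dcont s; have cv := sol_cont s.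
pose m y := Num.min (v y) (wtrap v d y).
have cX (y : R) : {for y, continuous (fun y : R => y + 1)} by apply: contD; [exact: contI|exact: contC].
have cw y : {for y, continuous (wtrap v d)}.
  apply: contD; apply: contM; [exact: cX|exact: cd|exact: contC|exact: cv].
have cm y : {for y, continuous m}.
  have -> : m = (fun y => v y - Num.max (v y - wtrap v d y) 0).
    by apply/funext => z; rewrite /m; case: (leP (v z)); case: (leP (v z - wtrap v d z)); lra.
  apply: contB; first exact: cv.
  apply: (@cont_comp R _ (fun z => Num.max z 0) (fun y => v y - wtrap v d y)).
    by apply: contB; [exact: cv|exact: cw].
  apply/cont_epsP => e e0; exists e => // z; rewrite ![Num.max _ 0]maxC.
  exact: le_lt_trans (max_lip _ _ _).
have mp : 0 < m x0 by rewrite lt_min vp.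
suff : 0 < m x by rewrite lt_min => /andP[].
rewrite ltNge; apply/negP => mx.
have [t [x0t tx mt pos]] := first_hit x0x (fun y _ => cm y) mp mx.
have vw y : x0 <= y < t -> 0 < v y /\ 0 < wtrap v d y.
  by move=> /pos; rewrite lt_min => /andP.
have vt : 0 < v t.
  have g0 y : x0 < y < t -> 0 <= d y + b * v y.
    move=> /andP[y1 y2]; have [vy wy] := vw y ltac:(lra); rewrite /wtrap in wy.
    have y0 : 0 < y + 1 by move: y1 x01; lra0.
    rewrite -(pmulr_rge0 _ y0); have : 0 <= b * v y * y by rewrite !mulr_ge0 ?(ltW b0) ?(ltW vy)//; move: y1 x01; lra0.
    by move: wy; lra0.
  exact: (gronwall_pos (ltW x0t) (fun y _ => @cv y) (fun y _ => dv y) g0 vp).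
have wt : 0 < wtrap v d t.
  have dX (y : R) := derD (derI y) (derC y 1).
  pose dw y := d y + (y + 1) * ((- f (v y) - n * (y + 1) * d y) / sinh2 y) + b * d y.
  have dwt y : x0 < y < t -> has_deriv (wtrap v d) y (dw y).
    move=> /andP[y1 y2]; have y0 : 0 < y by move: y1 x01; lra0.
    apply: (der_eq (derD (derM (dX y) (sol_der2 N7 s y0)) (derM (derC y b) (dv y)))).
    by rewrite /dw; ring.
  have g0 y : x0 < y < t -> 0 <= dw y + 4 * n / 3 * wtrap v d y.
    move=> /andP[y1 y2]; have y0 : 0 < y by move: y1 x01; lra0.
    have [vy wy] := vw y ltac:(move: y1 y2; lra0); have P0 := sinh2_gt0 y0.
    have sm := small y ltac:(move: y1; lra0).
    pose X := y + 1; pose r := X ^+ 2 / sinh2 y.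
    have XE : X ^+ 2 = sinh2 y + 1 by rewrite /X /sinh2; ring.
    have P3 : 3 <= sinh2 y by rewrite /sinh2; move: y1 x01; prune; nra.
    have r1 : 1 <= r by rewrite /r ler_pdivlMr// mul1r XE; lra0.
    have r4 : r <= 4 / 3 by rewrite /r ler_pdivrMr// XE; move: P3; lra0.
    have X0 : 0 < X by rewrite /X; move: y0; lra0.
    rewrite -(pmulr_rge0 _ X0).
    pose W := wtrap v d y; pose z := `|v y| `^ q.
    have -> : X * (dw y + 4 * n / 3 * wtrap v d y) =
      (1 + b - n * r + 4 * n / 3 * X) * W
      + v y * (- (1 + b) * b + r * (n * b - lam - z)).
      by rewrite /W /dw /wtrap /nonlin /phi -/z /r /X; field; rewrite gt_eqF.
    have z0 : 0 <= z by exact: powR_ge0.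
    have nb : 0 <= n * b - lam - z by rewrite -/z in sm; move: sm h D0 D4; prune; nra.
    apply: addr_ge0; apply: mulr_ge0; rewrite ?(ltW vy) ?(ltW wy)//.
      have X1 : 1 <= X by rewrite /X; move: y0; lra0.
      have n0 : 0 <= n by move: h; lra0.
      have h1 := ler_wpM2l n0 r4.
      have n43 : 0 <= 4 * n / 3 by move: n0; lra0.
      have h2 := ler_wpM2l n43 X1.
      by move: h1 h2 b0; lra0.
    have : n * b - lam - z <= r * (n * b - lam - z) by rewrite ler_peMl.
    (* With [b = (n - 1) / 2 + D] the right-hand side is [D - D ^+ 2 - z], nonnegative since
       [z <= D / 2] and D < 1/4. This is the origin of the smallness threshold [D / 2]. *)
    suff : 0 <= - (1 + b) * b + (n * b - lam - z) by lra0.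
    by rewrite -/z in sm; move: sm z0 h D0 D4; prune; nra.
  exact: (gronwall_pos (ltW x0t) (fun y _ => cw y) dwt g0 wp).
have : 0 < m t by rewrite lt_min vt.
by rewrite mt ltxx.
Qed.

End Trap.

Section TrapSet.
Variables (R : realType) (N : nat) (lam : R).
Hypothesis N7 : (7 <= N)%N.
Local Notation n := (N%:R : R).
Hypothesis lam_lo : n * (n - 2) / 4 < lam.
Hypothesis lam_hi : lam < ((n - 1) / 2) ^+ 2.
Local Notation q := (4 / (n - 2)).
Local Notation f := (nonlin lam q).
Local Notation D := (((n - 1) / 2) ^+ 2 - lam).
Local Notation b := ((n - 1) / 2 + D).

(** The amplitude below which [|v| ^ q <= D / 2], the smallness under which the signs of [v] and
    [wtrap] persist. *)
Definition trap_radius : R := (D / 2) `^ (q^-1).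

Lemma trap_radius_gt0 : 0 < trap_radius. Proof. by rewrite powR_gt0// divr_gt0// (D_gt0 lam_hi). Qed.

Lemma trap_radius_pow : trap_radius `^ q = D / 2.
Proof.
have := q_gt0 R N7 => q0; have D0 := (D_gt0 lam_hi).
by rewrite -powRrM mulVf ?gt_eqF// powRr1// divr_ge0// ltW.
Qed.

(* The energy bound makes the nonlinear term negligible, and then the sign of
   [v * wtrap] persists. *)
Definition trapped v d x := [/\ 1 <= x, energy N lam v d x < lam * trap_radius ^+ 2 / 2
  & 0 < v x * wtrap N lam v d x].

Lemma energy_small_v a v d x0 : sol N f a v d -> 0 <= x0 ->
  energy N lam v d x0 < lam * trap_radius ^+ 2 / 2 -> forall x, x0 <= x -> `|v x| <= trap_radius.
Proof.
move=> s x00 hs x xx; have x1 : 0 <= x := le_trans x00 xx.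
have := energy_mono N7 s x00 xx; have := energy_v lam N7 v d x1; have l := lam_gt0 N7 lam_lo.
move=> h1 h2; have {h1 h2} : lam * v x ^+ 2 < lam * trap_radius ^+ 2 by lra.
rewrite ltr_pM2l// => h.
rewrite -(@ler_pXn2r _ 2)// ?nnegrE//; last exact: ltW trap_radius_gt0.
by rewrite real_normK ?num_real// ltW.
Qed.

Lemma trapped_nz a v d x0 : sol N f a v d -> trapped v d x0 ->
  forall x, x0 <= x -> v x != 0.
Proof.
move=> s [x01 hs tr] x xx.
have small y : x0 <= y -> `|v y| `^ q <= D / 2.
  move=> xy; rewrite -trap_radius_pow le_powq ?(q_gt0 R N7)//.
  by apply: (energy_small_v s _ hs xy); lra.
have [vp|vn|v0] := ltgtP 0 (v x0).
- have wp : 0 < wtrap N lam v d x0 by rewrite pmulr_rgt0 in tr.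
  by rewrite gt_eqF// (trap_pos N7 lam_lo lam_hi s x01 small vp wp xx).
- have wn : wtrap N lam v d x0 < 0 by rewrite nmulr_rgt0 in tr.
  have small' y : x0 <= y -> `|- v y| `^ q <= D / 2 by move=> ?; rewrite normrN small.
  have vp : 0 < - v x0 by rewrite oppr_gt0.
  have wp : 0 < wtrap N lam (fun x => - v x) (fun x => - d x) x0.
    by move: wn; rewrite /wtrap; lra.
  have := trap_pos N7 lam_lo lam_hi (sol_opp s) x01 small' vp wp xx.
  by rewrite oppr_gt0 => /ltr0_neq0.
- by move: tr; rewrite -v0 mul0r ltxx.
Qed.

Lemma le_exp (x y : R) k : 0 <= x -> x <= y -> x ^+ k <= y ^+ k.
Proof. by move=> x0 xy; apply: lerXn2r => //; rewrite nnegrE// (le_trans x0). Qed.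

Lemma powR_pred (x r : R) : 0 < x -> x `^ r = x `^ (r - 1) * x.
Proof.
move=> x0; rewrite -[X in _ * X](powRr1 (ltW x0)) -powRD ?subrK//.
by rewrite (gt_eqF x0) implybT.
Qed.

Lemma powR_der (x r : R) : 0 < x + 1 ->
  has_deriv (fun y => (y + 1) `^ r) x (r * (x + 1) `^ (r - 1)).
Proof.
move=> x0; apply: (der_eq (der_comp (g := fun y => y + 1) (is_derive1_powR r x0)
  (derD (derI x) (derC x 1)))); ring.
Qed.

Lemma bounded_segment (g : R -> R) (x0 x1 : R) : x0 <= x1 -> continuous g ->
  exists2 M, 0 <= M & forall x, x0 <= x <= x1 -> `|g x| <= M.
Proof.
move=> x01 cg; have cn : {within `[x0, x1], continuous (fun x => `|g x|)}.
  by apply: continuous_itv => x _; apply: cont_norm; exact: cg.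
have [y _ hy] := EVT_max x01 cn.
by exists `|g y| => // x xx; apply: hy; rewrite in_itv.
Qed.

Lemma decay_from_tail (v d : R -> R) (x1 B A A' : R) : 0 <= x1 -> 0 < B -> 0 <= A -> 0 <= A' ->
  continuous v -> continuous d ->
  (forall x, x1 <= x -> `|v x| <= A * (x + 1) `^ (- B)) ->
  (forall x, x1 <= x -> `|d x| <= A' * (x + 1) `^ (- B - 1)) ->
  exists C, forall x, 0 <= x -> `|v x| <= C * (x + 1) `^ (- B) /\
    `|d x| <= C * (x + 1) `^ (- B - 1).
Proof.
move=> x10 B0 A0 A'0 cv cd vA dA.
have gen x r : 0 <= x -> x <= x1 -> 0 < r -> 1 <= (x1 + 1) `^ r * (x + 1) `^ (- r).
  move=> x0 xx r0; have X0 : 0 < x + 1 by rewrite ltr_wpDl.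
  rewrite powRN ler_pdivlMr ?powR_gt0// mul1r.
  by apply: ge0_ler_powR; rewrite ?nnegrE ?(ltW r0) ?(ltW X0) ?lerD2r// addr_ge0.
have bnd (f : R -> R) (K r : R) : 0 < r -> 0 <= K -> continuous f ->
    (forall x, x1 <= x -> `|f x| <= K * (x + 1) `^ (- r)) ->
    exists2 C, 0 <= C & forall x, 0 <= x -> `|f x| <= C * (x + 1) `^ (- r).
  move=> r0 K0 cf fK; have [M M0 hM] := bounded_segment x10 cf.
  have M1 : 0 <= M * (x1 + 1) `^ r by rewrite mulr_ge0 ?powR_ge0.
  exists (K + M * (x1 + 1) `^ r); first exact: addr_ge0.
  move=> x x0; have [xx|/ltW xx] := leP x1 x.
    by apply: le_trans (fK x xx) _; rewrite ler_wpM2r ?powR_ge0// lerDl.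
  have x01 : 0 <= x <= x1 by rewrite x0.
  apply: le_trans (hM x x01) _; apply: (@le_trans _ _ (M * (x1 + 1) `^ r * (x + 1) `^ (- r))).
    by rewrite -mulrA ler_peMr// gen.
  by rewrite ler_wpM2r ?powR_ge0// lerDr.
have [C C0 hC] := bnd v A B B0 A0 cv vA.
have B1 : 0 < B + 1 by rewrite addr_gt0.
have BE : - B - 1 = - (B + 1) by rewrite opprD.
rewrite BE in dA *; have [C' C'0 hC'] := bnd d A' (B + 1) B1 A'0 cd dA.
exists (C + C') => x x0; split.
  by apply: le_trans (hC x x0) _; rewrite ler_wpM2r ?powR_ge0// lerDl.
by apply: le_trans (hC' x x0) _; rewrite ler_wpM2r ?powR_ge0// lerDr.
Qed.

(** Once the energy is small, not being trapped means [v * wtrap <= 0], which says that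
    [v ^+ 2 * (x + 1) ^ (2 b)] does not increase. The decay of [d] follows by integrating the
    equation in divergence form: the derivative of [sinhN * d] is of order
    [(x + 1) ^ (n - 2 - b)]. *)
Lemma not_trapped_decay a v d : sol N f a v d -> (forall x, ~ trapped v d x) ->
  exists C, forall x, 0 <= x -> `|v x| <= C * (x + 1) `^ (- b) /\
     `|d x| <= C * (x + 1) `^ (- b - 1).
Proof.
move=> s nt; have h := n7 R N7; have D0 := D_gt0 lam_hi; have D4 := D_lt lam_lo.
have l := lam_gt0 N7 lam_lo; have q0 := q_gt0 R N7.
have [_ dv [_ _ dd]] := s; have cd := sol_dcont s; have cv := sol_cont s.
have h0 : 0 < lam * trap_radius ^+ 2 / 2.
  by rewrite divr_gt0// mulr_gt0// exprn_gt0// trap_radius_gt0.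
have [x1 x11 hx1] := energy_small N7 lam_lo s h0.
have x10 : 0 <= x1 by lra.
have vw x : x1 <= x -> v x * wtrap N lam v d x <= 0.
  move=> xx; rewrite leNgt; apply/negP => vw; apply: (nt x); split => //; first lra.
  exact: le_lt_trans (energy_mono N7 s x10 xx) hx1.
have vs := energy_small_v s x10 hx1.
pose B := b; have BE : B = b by []; have Bp : 0 < B by rewrite BE; lra.
have Xgt x : x1 <= x -> 0 < x + 1 by lra.
pose G x := - (v x ^+ 2 * (x + 1) `^ (2 * B)).
have dG x : x1 <= x -> has_deriv G x
    (- (2 * (x + 1) `^ (2 * B - 1) * (v x * wtrap N lam v d x))).
  move=> xx; have X0 := Xgt x xx.
  apply: (der_eq (derN (derM (derX 2 (dv x)) (powR_der (2 * B) X0)))).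
  have -> : (x + 1) `^ (2 * B) = (x + 1) `^ (2 * B - 1) * (x + 1).
    exact: powR_pred.
  by rewrite /wtrap -BE expr1 /=; ring.
pose K1 := v x1 ^+ 2 * (x1 + 1) `^ (2 * B).
have K10 : 0 <= K1 by apply: mulr_ge0; [exact: sqr_ge0|exact: powR_ge0].
have vK x : x1 <= x -> v x ^+ 2 * (x + 1) `^ (2 * B) <= K1.
  move=> xx; rewrite -lerN2.
  have cG y : x1 <= y <= x -> {for y, continuous G}.
    by move=> /andP[y1 _]; exact: der_cont (dG y y1).
  have dG' y : x1 < y < x -> has_deriv G y
      (- (2 * (y + 1) `^ (2 * B - 1) * (v y * wtrap N lam v d y))).
    by move=> /andP[y1 _]; apply: dG; exact: ltW.
  apply: (der_ge0_le xx cG dG') => y /andP[y1 _].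
  rewrite oppr_ge0; apply: mulr_ge0_le0; last by apply: vw; exact: ltW.
  by rewrite mulr_ge0 ?powR_ge0.
pose A := 1 + K1.
have vA x : x1 <= x -> `|v x| <= A * (x + 1) `^ (- B).
  move=> xx; have X0 := Xgt x xx; have pB : 0 < (x + 1) `^ B by rewrite powR_gt0.
  rewrite powRN ler_pdivlMr//.
  have := vK x xx; have -> : (x + 1) `^ (2 * B) = ((x + 1) `^ B) ^+ 2.
    rewrite -powR_mulrn ?powR_ge0// -powRrM mulrC//.
  rewrite -[v x ^+ 2]real_normK ?num_real// -exprMn /A.
  set t := `|v x| * _; have : 0 <= t by rewrite mulr_ge0 ?powR_ge0.
  by move=> t0 t2; nra.
have fA x : x1 <= x -> `|- f (v x)| <= (lam + 1) * A * (x + 1) `^ (- B).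
  move=> xx; rewrite normrN -mulrA; apply: le_trans (ler_wpM2l _ (vA x xx)); last lra.
  have -> : f (v x) = (lam + `|v x| `^ q) * v x by rewrite /nonlin /phi; ring.
  rewrite normrM ler_wpM2r// ger0_norm ?addr_ge0 ?powR_ge0 ?(ltW l)// lerD2l.
  apply: (@le_trans _ _ (D / 2)); last lra.
  by rewrite -trap_radius_pow le_powq ?vs.
(* Since [p = (n - 1) / 2 - D] is positive, the integral of [(y + 1) ^ (p - 1)] is governed by its
   upper end, and division by [sinhN] leaves the exponent [p - n = - B - 1]. *)
pose p := n - 1 - B; have pp : 0 < p by rewrite /p BE; lra.
have wwX x : x1 <= x -> sinhN2 N x <= (x + 1) `^ (n - 2).
  move=> xx; have X0 := Xgt x xx.
  have -> : n - 2 = (N - 2)%:R :> R by rewrite natrB// (leq_trans _ N7).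
  rewrite powR_mulrn ?(ltW X0)// /sinhN2; apply: le_exp; first exact: sqrtr_ge0.
  rewrite -[leRHS]ger0_norm ?(ltW X0)// -sqrtr_sqr ler_wsqrtr// /sinh2; nra.
have mmX x : x1 <= x -> 2 ^- N * (x + 1) `^ n <= sinhN N x.
  move=> xx; have X0 := Xgt x xx.
  rewrite powR_mulrn ?(ltW X0)// /sinhN -exprVn -exprMn; apply: le_exp; first by rewrite mulr_ge0// ltW.
  have -> : 2^-1 * (x + 1) = Num.sqrt ((2^-1 * (x + 1)) ^+ 2).
    by rewrite sqrtr_sqr ger0_norm// mulr_ge0// ltW.
  rewrite ler_wsqrtr// /sinh2; nra.
pose A2 := (lam + 1) * A; have A1 : 1 <= A by rewrite /A; lra.
have A20 : 0 <= A2 by rewrite /A2 mulr_ge0; lra.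
pose A3 := `|sinhN N x1 * d x1| + A2 / p.
have A2p : 0 <= A2 / p by rewrite divr_ge0// ltW.
have mdA x : x1 <= x -> `|sinhN N x * d x| <= A3 * (x + 1) `^ p.
  move=> xx; have X0 := Xgt x xx.
  pose G2 y := A2 / p * (y + 1) `^ p.
  have dG2 y : x1 <= y -> has_deriv G2 y (A2 * (y + 1) `^ (p - 1)).
    move=> yy; apply: (der_eq (derM (derC y (A2 / p)) (powR_der p (Xgt y yy)))).
    by field; rewrite gt_eqF.
  have cG2 y : x1 <= y <= x -> {for y, continuous G2}.
    by move=> /andP[yy _]; exact: der_cont (dG2 y yy).
  have cmd y : x1 <= y <= x -> {for y, continuous (fun y => sinhN N y * d y)}.
    by move=> _; apply: contM; [exact: sinhN_cont|exact: cd].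
  have dG2' y : x1 < y < x -> has_deriv G2 y (A2 * (y + 1) `^ (p - 1)).
    by move=> /andP[yy _]; apply: dG2; exact: ltW.
  have dmd y : x1 < y < x -> has_deriv (fun y => sinhN N y * d y) y (sinhN2 N y * - f (v y)).
    by move=> /andP[yy _]; apply: dd; lra.
  have le_d y : x1 < y < x -> `|sinhN2 N y * - f (v y)| <= A2 * (y + 1) `^ (p - 1).
    move=> /andP[/ltW yy _]; have Y0 := Xgt y yy.
    rewrite normrM ger0_norm ?sinhN2_ge0//.
    have -> : p - 1 = (n - 2) + - B by rewrite /p; ring.
    rewrite powRD; last by rewrite (gt_eqF Y0) implybT.
    have := ler_pM (sinhN2_ge0 N y) (normr_ge0 _) (wwX y yy) (fA y yy).
    by rewrite mulrCA -/A2.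
  have := der_norm_le xx cmd cG2 dmd dG2' le_d.
  have X1 : 1 <= (x + 1) `^ p by rewrite -[leLHS](powRr0 (x + 1)) ler_powR ?(ltW pp)//; lra.
  have : 0 <= G2 x1 by rewrite mulr_ge0// powR_ge0.
  have := ler_normD (sinhN N x1 * d x1) (sinhN N x * d x - sinhN N x1 * d x1).
  rewrite [X in `|X| <= _]addrC subrK /A3 mulrDl /G2.
  have : `|sinhN N x1 * d x1| <= `|sinhN N x1 * d x1| * (x + 1) `^ p by rewrite ler_peMr.
  lra.
have dA x : x1 <= x -> `|d x| <= 2 ^+ N * A3 * (x + 1) `^ (- B - 1).
  move=> xx; have X0 := Xgt x xx.
  have m0 : 0 < 2 ^- N * (x + 1) `^ n by rewrite mulr_gt0 ?invr_gt0 ?exprn_gt0// powR_gt0.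
  rewrite -(ler_pM2l m0); apply: (@le_trans _ _ `|sinhN N x * d x|).
    by rewrite normrM ler_wpM2r// ger0_norm ?sinhN_ge0// mmX.
  apply: le_trans (mdA x xx) _.
  have -> : p = n + (- B - 1) by rewrite /p; ring.
  rewrite [in leLHS]powRD; last by rewrite (gt_eqF X0) implybT.
  rewrite le_eqVlt; apply/orP; left; apply/eqP; field.
  by rewrite expf_neq0.
have A30 : 0 <= A3 by rewrite /A3 addr_ge0.
have P0 : 0 <= 2 ^+ N * A3 by rewrite mulr_ge0// exprn_ge0.
rewrite -BE; have A0 := le_trans ler01 A1.
exact: decay_from_tail x10 Bp A0 P0 cv cd vA dA.
Qed.

End TrapSet.

(** Only one of the two points is confined to the compact set, so the bound can be used at boundary
    points without extending [f]. *)
Lemma heine (R : realType) (V : normedModType R) (K : set V) (f : V -> R) :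
  compact K -> (forall x, K x -> f y @[y --> x] --> f x) ->
  forall e : R, 0 < e -> exists2 r : R, 0 < r &
    forall x y, K x -> `|y - x| < r -> `|f y - f x| < e.
Proof.
move=> /compact_near_coveringP cK cf e e0; have e2 : 0 < e / 2 by lra.
have := cK R (0^'+) (fun r x => forall y, `|y - x| < r -> `|f y - f x| < e) _.
case.
  move=> x Kx; have /cvgrPdist_lt/(_ _ e2) := cf x Kx.
  move=> /nbhs_ballP[r /= r0 hr]; have r2 : 0 < r / 2 by lra.
  exists (ball x (r / 2), [set s : R | 0 < s < r / 2]); first split => /=.
  - exact: nbhsx_ballx.
  - by near=> s; apply/andP; split; near: s; [exact: nbhs_right_gt|exact: nbhs_right_lt].
  move=> [z s] /= [xz /andP[s0 sr]] y yz.
  have h1 : `|f x - f z| < e / 2.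
    by apply: hr; apply: le_ball xz; lra.
  have h2 : `|f x - f y| < e / 2.
    apply: hr; rewrite -ball_normE /=; move: xz; rewrite -ball_normE /= => xz.
    have -> : x - y = (x - z) - (y - z) by rewrite opprB addrA subrK.
    by apply: le_lt_trans (ler_normB _ _) _; lra.
  have -> : f y - f z = (f x - f z) - (f x - f y) by ring.
  by apply: le_lt_trans (ler_normB _ _) _; lra.
move=> r /= r0 hr.
exists (r / 2); first lra.
move=> x y Kx yx; apply: (hr (r / 2)) => //=; rewrite ?sub0r ?normrN ?gtr0_norm; lra.
Unshelve. all: by end_near.
Qed.

(** * Zeros and their dependence on the initial value *)

Section Zeros.
Variable R : realType.
Implicit Types (v d : R -> R) (lo hi z x : R) (k : nat).

(* At least [k] distinct zeros in the open interval [(lo, hi)]. *)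
Fixpoint zeros k v lo hi : Prop :=
  if k is k'.+1 then exists z, [/\ lo < z, z < hi, v z = 0 & zeros k' v z hi] else True.

Lemma zeros_mono k v lo hi lo' hi' : lo' <= lo -> hi <= hi' ->
  zeros k v lo hi -> zeros k v lo' hi'.
Proof.
elim: k lo lo' => [//|k ih] lo lo' l h [z [z1 z2 vz hz]]; exists z; split => //; [lra|lra|].
exact: ih hz.
Qed.

Lemma zeros_le k v lo hi x : (forall z, x <= z -> v z <> 0) -> lo < x ->
  zeros k v lo hi -> zeros k v lo x.
Proof.
move=> nz; elim: k lo => [//|k ih] lo lox [z [z1 z2 vz hz]].
have zx : z < x by rewrite ltNge; apply/negP => /nz; exact.
by exists z; split => //; exact: ih.
Qed.

Lemma zeros_sep k v z hi del : 0 < del -> v z = 0 -> z < hi ->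
  (forall t t', z <= t -> t < t' -> t' < hi -> v t = 0 -> v t' = 0 -> del <= t' - t) ->
  zeros k v z hi -> z + del * k%:R < hi.
Proof.
move=> d0; elim: k z => [|k ih] z vz zhi sep; first by rewrite mulr0 addr0.
case=> z' [zz' z'hi vz' hz'].
have s := sep z z' (lexx _) zz' z'hi vz vz'.
have h := ih z' vz' z'hi (fun t t' h => sep t t' (le_trans (ltW zz') h)) hz'.
by rewrite -natr1 mulrDr mulr1; lra.
Qed.

Lemma IVT_sign v x1 x2 : continuous v -> x1 < x2 -> v x1 * v x2 < 0 ->
  exists z, [/\ x1 < z, z < x2 & v z = 0].
Proof.
move=> cv x12 neg.
have cn : {within `[x1, x2], continuous v} by apply: continuous_itv => x _; exact: cv.
have ne y : v y = 0 -> y != x1 /\ y != x2.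
  by move=> vy; split; apply/eqP => E; move: neg; rewrite -E vy ?mul0r ?mulr0 ltxx.
have [|z] := IVT (v := 0) (ltW x12) cn.
  rewrite ge_min le_max; case: (ltgtP (v x1) 0) => [h|h|h].
  - by have : 0 < v x2 by [rewrite nmulr_rlt0 in neg]; move=> /ltW ->; rewrite orbT.
  - by have : v x2 < 0 by [rewrite pmulr_rlt0 in neg]; move=> /ltW ->; rewrite orbT.
  - by move: neg; rewrite h mul0r ltxx.
rewrite in_itv /= => /andP[h1 h2] vz; have [n1 n2] := ne z vz.
by exists z; split => //; rewrite lt_neqAle ?h1 ?h2 ?n2 // eq_sym n1.
Qed.

Lemma close_sign (x y : R) : `|y - x| < `|x| -> 0 < x * y.
Proof.
have [h|h|->] := ltgtP x 0.
- by rewrite (ltr0_norm h) ltr_norml => /andP[h1 h2]; rewrite nmulr_rgt0//; lra.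
- by rewrite (gtr0_norm h) ltr_norml => /andP[h1 h2]; rewrite pmulr_rgt0//; lra.
- by rewrite subr0 normr0 ltNge normr_ge0.
Qed.

(** The difference quotients with steps h and -h both have the sign of [dz]. *)
Lemma sign_change v z dz (e : R) : has_deriv v z dz -> v z = 0 -> dz != 0 -> 0 < e ->
  exists h, [/\ 0 < h, h < e & v (z - h) * v (z + h) < 0].
Proof.
move=> /der_epsP hd vz dz0 e0; have n0 : 0 < `|dz| by rewrite normr_gt0.
have [r r0 hr] := hd _ n0.
pose h := Num.min (r / 2) (e / 2).
have h0 : 0 < h by rewrite lt_min; apply/andP; split; lra.
have hr2 : h <= r / 2 by rewrite ge_min lexx.
have he2 : h <= e / 2 by rewrite ge_min lexx orbT.
have sgn s : s != 0 -> `|s| < r -> 0 < v (z + s) / s * dz.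
  by move=> s0 /(hr s s0); rewrite vz subr0 => /close_sign; rewrite mulrC.
have hn : h != 0 by rewrite gt_eqF.
exists h; split => //; first lra.
have p1 := sgn h hn ltac:(by rewrite gtr0_norm//; lra).
have p2 := sgn (- h) ltac:(by rewrite oppr_eq0) ltac:(by rewrite normrN gtr0_norm//; lra).
have := mulr_gt0 p1 p2.
have -> : v (z + h) / h * dz * (v (z + - h) / - h * dz) =
  - (v (z - h) * v (z + h)) * (dz / h) ^+ 2 by field.
by rewrite pmulr_lgt0 ?oppr_gt0// exprn_even_gt0//= mulf_neq0// invr_neq0.
Qed.

Lemma der0_of_zeros v d x y : continuous v -> (forall t, has_deriv v t (d t)) ->
  x < y -> v x = 0 -> v y = 0 -> exists2 t, x < t < y & d t = 0.
Proof.
move=> cv dv xy vx vy.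
have [t txy] := MVT_itv xy (fun z _ => @cv z) (fun z _ => dv z).
rewrite vx vy subrr => /esym/eqP; rewrite mulf_eq0 => /orP[/eqP ? |]; first by exists t.
by rewrite subr_eq0 gt_eqF.
Qed.

(** As [v] and [d] have no common zero, compactness gives [|d| >= m > 0] at all zeros of [v].
    Between two zeros [d] vanishes by Rolle, so uniform continuity of [d] separates them by a fixed
    distance. *)
Lemma finite_zeros v d hi : 0 < hi -> continuous v -> continuous d ->
  (forall t, has_deriv v t (d t)) -> (forall t, 0 <= t -> v t = 0 -> d t != 0) ->
  exists k, ~ zeros k v 0 hi.
Proof.
move=> hi0 cv cd dv simple.
have cg : {within `[0, hi], continuous (fun t => - (`|v t| + `|d t|))}.
  apply: continuous_itv => t _; apply: contN; apply: contD; apply: cont_norm; [exact: cv|exact: cd].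
have [t0] := EVT_max (ltW hi0) cg; rewrite in_itv /= => /andP[t00 t0h] hmin.
pose m := `|v t0| + `|d t0|.
have m0 : 0 < m.
  rewrite /m; have [vt|vt] := eqVneq (v t0) 0.
    by rewrite vt normr0 add0r normr_gt0 simple.
  by rewrite ltr_wpDr// normr_gt0.
have dm t : 0 <= t -> t <= hi -> v t = 0 -> m <= `|d t|.
  move=> t1 t2 vt; have := hmin t; rewrite in_itv /= t1 t2 vt normr0 add0r lerN2.
  exact.
have [r r0 hr] := heine (@segment_compact R 0 hi) (fun x _ => @cd x) m0.
have sep t t' : 0 <= t -> t < t' -> t' < hi -> v t = 0 -> v t' = 0 -> r <= t' - t.
  move=> t1 tt' t'h vt vt'; rewrite leNgt; apply/negP => lt_r.
  have [c /andP[tc ct'] dc] := der0_of_zeros cv dv tt' vt vt'.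
  have : `|d c - d t| < m.
    by apply: hr; [rewrite /= in_itv /=; lra|rewrite gtr0_norm; lra].
  by rewrite dc sub0r normrN ltNge dm//; lra.
exists (Num.truncn (hi / r)).+2 => -[z [z1 z2 vz hz]].
have {}hz : zeros (Num.truncn (hi / r)).+1 v z hi := hz.
have := zeros_sep r0 vz z2 (fun t t' h => sep t t' (le_trans (ltW z1) h)) hz.
have := truncnS_gt (hi / r); rewrite ltr_pdivrMr// mulrC.
lra.
Qed.

End Zeros.

Lemma near3 (R : realType) (a : R) (P Q S W : R -> Prop) :
  (forall x, P x -> Q x -> S x -> W x) -> (\forall x \near a, P x) ->
  (\forall x \near a, Q x) -> (\forall x \near a, S x) -> \forall x \near a, W x.
Proof. by move=> h *; near=> x; apply: h; near: x. Unshelve. all: by end_near. Qed.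

(** * Zeros in a continuous family *)

Section Family.
Variable R : realType.
Variables V D : R -> R -> R.
Implicit Types (lo hi z x a : R) (k : nat).
Hypothesis dV : forall a x, has_deriv (V a) x (D a x).
Hypothesis cD : forall a, continuous (D a).
Hypothesis fam : forall (a T e : R), 0 < e -> \forall a' \near a, forall x, 0 <= x <= T ->
  `|V a' x - V a x| < e /\ `|D a' x - D a x| < e.

Let cV a : continuous (V a). Proof. by move=> x; exact: der_cont (dV a x). Qed.

Local Ltac lra0 := clear -dV cD fam cV; lra.

(** Peel off the smallest zero z. Being simple, it is a sign change between z - h and z + h, which
    survives a small change of [a]; the gap [e > h] keeps it apart from the remaining zeros, to
    which the induction hypothesis applies on (z + e, hi). *)
Lemma zeros_open k a lo hi : (forall z, 0 <= z -> V a z = 0 -> D a z != 0) ->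
  0 <= lo -> lo < hi -> zeros k (V a) lo hi -> \forall a' \near a, zeros k (V a') lo hi.
Proof.
move=> simple; elim: k lo => [|k ih] lo lo0 lohi; first by move=> _; near=> a'.
case=> z [z1 z2 vz hz].
have [e [e0 elo ehi hze]] : exists e, [/\ 0 < e, e < z - lo, e < hi - z & zeros k (V a) (z + e) hi].
  case: k {ih} hz => [_|k [z' [zz' z'h vz' hz']]].
    pose e := Num.min ((z - lo) / 2) ((hi - z) / 2).
    have e1 : e <= (z - lo) / 2 by rewrite ge_min lexx.
    have e2 : e <= (hi - z) / 2 by rewrite ge_min lexx orbT.
    by exists e; split => //; [rewrite lt_min; apply/andP; split; lra|lra|lra].
  pose e := Num.min ((z - lo) / 2) ((z' - z) / 2).
  have e1 : e <= (z - lo) / 2 by rewrite ge_min lexx.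
  have e2 : e <= (z' - z) / 2 by rewrite ge_min lexx orbT.
  exists e; split => //; [rewrite lt_min; apply/andP; split; lra|lra|lra|].
  by exists z'; split => //; move: e2 zz'; lra0.
have z0 : 0 <= z by lra.
have [h [h0 he neg]] := sign_change (dV a z) vz (simple z z0 vz) e0.
have n1 : 0 < `|V a (z - h)|.
  by rewrite normr_gt0; apply/eqP => E; move: neg; rewrite E mul0r ltxx.
have n2 : 0 < `|V a (z + h)|.
  by rewrite normr_gt0; apply/eqP => E; move: neg; rewrite E mulr0 ltxx.
have f1 := fam a hi n1; have f2 := fam a hi n2.
have zlo : 0 <= z + e by move: z0 e0; lra0.
have zhi : z + e < hi by move: ehi; lra0.
have {}ih := ih (z + e) zlo zhi hze.
near=> a'.
have /(_ (z - h))[|/close_sign s1 _] : forall x, 0 <= x <= hi ->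
  `|V a' x - V a x| < `|V a (z - h)| /\ `|D a' x - D a x| < `|V a (z - h)| by near: a'.
  by move: h0 he elo lo0 z2; lra0.
have /(_ (z + h))[|/close_sign s2 _] : forall x, 0 <= x <= hi ->
  `|V a' x - V a x| < `|V a (z + h)| /\ `|D a' x - D a x| < `|V a (z + h)| by near: a'.
  by move: h0 he ehi z0; lra0.
have neg' : V a' (z - h) * V a' (z + h) < 0.
  have := mulr_gt0 s1 s2.
  have -> : V a (z - h) * V a' (z - h) * (V a (z + h) * V a' (z + h)) =
    (V a (z - h) * V a (z + h)) * (V a' (z - h) * V a' (z + h)) by ring.
  by rewrite nmulr_rgt0.
have zh : z - h < z + h by move: h0; lra0.
have [z' [z1' z2' vz']] := IVT_sign (@cV a') zh neg'.
exists z'; split => //; [by move: z1' he elo; lra0|by move: z2' he ehi; lra0|].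
apply: (@zeros_mono _ _ _ (z + e) hi) => //; first by move: z2' he; lra0.
by near: a'.
Unshelve. all: by end_near.
Qed.

Lemma near_nonzero (W : R -> R -> R) a x y : x <= y -> continuous (W a) ->
  (forall e, 0 < e -> \forall a' \near a, forall t, x <= t <= y -> `|W a' t - W a t| < e) ->
  (forall t, x <= t <= y -> W a t != 0) ->
  \forall a' \near a, forall t, x <= t <= y -> W a' t != 0.
Proof.
move=> xy cW famW nz.
have cg : {within `[x, y], continuous (fun t => - `|W a t|)}.
  by apply: continuous_itv => t _; apply: contN; apply: cont_norm; exact: cW.
have [t0] := EVT_max xy cg; rewrite in_itv /= => t0xy hmin.
have m0 : 0 < `|W a t0| by rewrite normr_gt0 nz.
have h := famW _ m0; near=> a'; move=> t txy.
have : `|W a' t - W a t| < `|W a t0| by move: t txy; near: a'.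
have : `|W a t0| <= `|W a t| by rewrite -lerN2 hmin// in_itv.
move=> h1 h2; have /close_sign := lt_le_trans h2 h1.
by apply: contraTneq => ->; rewrite mulr0 ltxx.
Unshelve. all: by end_near.
Qed.

(** Around the first zero z of [V a], for nearby parameters: no zero on [lo, z - e], where [V a]
    does not vanish; at most one on [z - e, z + e], where [D a] does not vanish; and induction on (z
    + e, hi). *)
Lemma zeros_closed k a lo hi : (forall z, 0 <= z -> V a z = 0 -> D a z != 0) ->
  0 <= lo -> lo < hi -> V a lo != 0 -> V a hi != 0 -> ~ zeros k (V a) lo hi ->
  \forall a' \near a, ~ zeros k (V a') lo hi.
Proof.
move=> simple; elim: k lo => [|k ih] lo lo0 lohi vlo vhi nzk; first by exfalso; exact: nzk.
have famV x y : 0 <= x -> y <= hi -> forall e : R, 0 < e -> \forall a' \near a, forall t,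
    x <= t <= y -> `|V a' t - V a t| < e.
  move=> x0 yhi e e0; have := fam a hi e0; apply: filterS => a' h t /andP[xt ty].
  by have [] := h t ltac:(lra).
have famD x y : 0 <= x -> y <= hi -> forall e : R, 0 < e -> \forall a' \near a, forall t,
    x <= t <= y -> `|D a' t - D a t| < e.
  move=> x0 yhi e e0; have := fam a hi e0; apply: filterS => a' h t /andP[xt ty].
  by have [] := h t ltac:(lra).
have [[w /andP[low whi] vw]|noz] := pselect (exists2 w, lo < w < hi & V a w = 0); last first.
  have nz t : lo <= t <= hi -> V a t != 0.
    move=> /andP[]; rewrite le_eqVlt => /predU1P[<-//|lot].
    rewrite le_eqVlt => /predU1P[->//|thi].
    by apply/eqP => vt; apply: noz; exists t => //; rewrite lot.
  have := near_nonzero (ltW lohi) (@cV a) (famV lo hi lo0 (lexx _)) nz.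
  apply: filterS => a' nz' [z [z1 z2 vz _]].
  by have := nz' z ltac:(lra); rewrite vz eqxx.
have [z [loz zw vz pos]] : exists z, [/\ lo < z, z <= w, V a z = 0
    & forall s, lo <= s < z -> V a s != 0].
  have cn y : lo <= y <= w -> {for y, continuous (fun t => `|V a t|)}.
    by move=> _; apply: cont_norm; exact: cV.
  have h1 : 0 < `|V a lo| by rewrite normr_gt0.
  have h2 : `|V a w| <= 0 by rewrite vw normr0.
  have [z [z1 z2 vz hz]] := first_hit (ltW low) cn h1 h2.
  exists z; split => //; first by apply/eqP; rewrite -normr_eq0 vz.
  by move=> s /hz; rewrite normr_gt0.
have z0 : 0 <= z by lra.
have dz : 0 < `|D a z| by rewrite normr_gt0 simple.
have [r r0 hr] := cont_gt (cont_norm (@cD a z)) dz.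
pose m := Num.min (z - lo) (hi - z); have m0 : 0 < m.
  by rewrite lt_min; apply/andP; split; move: loz zw whi; lra0.
have m1 : m <= z - lo by rewrite ge_min lexx.
have m2 : m <= hi - z by rewrite ge_min lexx orbT.
pose e := Num.min (r / 2) (m / 2).
have e0 : 0 < e by rewrite lt_min; apply/andP; split; move: r0 m0; lra0.
have e1 : e <= r / 2 by rewrite ge_min lexx.
have e2 : e <= m / 2 by rewrite ge_min lexx orbT.
have nzD t : z - e <= t <= z + e -> D a t != 0.
  by move=> tz; rewrite -normr_gt0; apply: hr; rewrite ltr_norml; move: tz e1 r0; lra0.
have vze : V a (z + e) != 0.
  have ze : z < z + e by move: e0; lra0.
  apply/eqP => E; have [t tz dt] := der0_of_zeros (@cV a) (dV a) ze vz E.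
  by have := nzD t ltac:(move: tz e0; lra0); rewrite dt eqxx.
have nzk' : ~ zeros k (V a) (z + e) hi.
  move=> hk; apply: nzk; exists z; split => //; first by move: zw whi; lra0.
  by apply: (zeros_mono _ _ hk) => //; move: e0; lra0.
have {}ih := ih (z + e) ltac:(move: z0 e0; lra0) ltac:(move: e2 m2 m0; lra0) vze vhi nzk'.
have nzV t : lo <= t <= z - e -> V a t != 0 
  by move=> tz; apply: pos; move: tz e0; lra0.
have N1 := near_nonzero (ltac:(move: e2 m1 m0; lra0) : lo <= z - e) (@cV a)
  (famV lo (z - e) lo0 ltac:(move: zw whi e0; lra0)) nzV.
have N2 := near_nonzero (ltac:(move: e0; lra0) : z - e <= z + e) (@cD a)
  (famD (z - e) (z + e) ltac:(move: lo0 e2 m1 m0; lra0) ltac:(move: e2 m2 m0; lra0)) nzD.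
move: N1 N2 ih.
apply: (@near3 R a _ _ _ (fun a' => ~ zeros k.+1 (V a') lo hi)) => a' P1 P2 Pih.
case=> z' [z1' z2' vz' hz'].
have z'e : z - e < z'.
  rewrite ltNge; apply/negP => le_z'.
  by have := P1 z' ltac:(move: z1' le_z'; lra0); rewrite vz' eqxx.
have [z'2|z'2] := leP (z + e) z'.
  by apply: Pih; apply: (zeros_mono _ _ hz').
(* Here z' is within e of z, where [D a'] has no zero. By Rolle the next zero lies beyond z + e, so
   all the remaining ones are counted there. *)
case: k Pih hz' {nzk nzk'} => [|k] Pih hz'; first exact: Pih.
case: hz' => y [z'y yhi vy hy]; apply: Pih; exists y; split => //.
rewrite ltNge; apply/negP => yz.
have [t tz dt] := der0_of_zeros (@cV a') (dV a') z'y vz' vy.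
by have := P2 t ltac:(move: tz z'e yz; lra0); rewrite dt eqxx.
Qed.

End Family.

(** Connectedness of the half-line, through the supremum of the points of [a1, a] where [Q]
    fails. *)
Lemma clopen_interval (R : realType) (Q : R -> Prop) (a1 : R) :
  (forall a, a1 <= a -> Q a -> \forall a' \near a, Q a') ->
  (forall a, a1 <= a -> ~ Q a -> \forall a' \near a, ~ Q a') ->
  ~ Q a1 -> forall a, a1 <= a -> ~ Q a.
Proof.
move=> op cl nQ a a1a Qa.
pose S := [set x | a1 <= x <= a /\ ~ Q x].
have hS : has_sup S by split; [exists a1; split => //; rewrite lexx|exists a => x [/andP[]]].
set t := sup S.
have ta1 : a1 <= t by apply: ub_le_sup; [case: hS|split => //; rewrite lexx].
have ta : t <= a by apply: ge_sup; [case: hS|move=> x [/andP[]]].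
have [Qt|nQt] := pselect (Q t).
  have /near_dist[r r0 hr] := op t ta1 Qt.
  have [x [xa nQx] tx] := sup_adherent r0 hS.
  have xt : x <= t by apply: ub_le_sup => //; case: hS.
  by apply: nQx; apply: hr; rewrite ler0_norm -?/t in tx *; lra.
have /near_dist[r r0 hr] := cl t ta1 nQt.
have ta' : t < a by rewrite lt_neqAle ta andbT; apply/eqP => E; apply: nQt; rewrite E.
pose x := Num.min (t + r / 2) a.
have x1 : x <= t + r / 2 by rewrite ge_min lexx.
have x2 : x <= a by rewrite ge_min lexx orbT.
have x3 : t < x by rewrite lt_min ta' andbT; lra.
have : x <= t.
  apply: ub_le_sup; first by case: hS.
  by split; [lra|apply: hr; rewrite gtr0_norm; lra].
lra.
Qed.

(** * Oscillation *)

(* Phase plane analysis of [y'' = y (c^2 - Q - |y|^q)] on [t <= T]: an orbit with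
   [|y| >= 1/2] at [t0] is back at the other side before [t0 / 9 + bumpC].  Here [c]
   is [(N - 2) / 2], and [N >= 7] is used through [c > 9/4]. *)
Section Bump.
Variables (R : realType) (c q q0 T : R).
Hypotheses (c52 : 5 / 2 <= c) (qpos : 0 < q) (q0pos : 0 < q0) (T0 : T <= 0).

(** While y >= 1/2 the angle atan (z / y) decreases at rate at least [del2], and its range has
    length pi, so [C1] bounds the time of descent to 1/2. [K1] bounds [|z|] below that level when
    the energy is at most 1, so that y stays above 1/4 for the time [dd]; [e1] measures the energy
    gained meanwhile. [K2] is large enough to contradict a passage past the saddle lasting longer
    than the time L fixed in [bump_L]. *)
Let del := (1 / 2) `^ q * (q / (q + 2)).
Let del2 := Num.min (1 / 2) (del / (2 + 2 * c ^+ 2)).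
Let C1 := pi / del2.
Let K1 := 2 + c ^+ 2 / 4.
Let dd := 1 / (4 * K1).
Let e1 := Num.min 1 (dd * q0 / 32).
Let K2 := 4 + c ^+ 2 / 2.
Definition bumpC := C1 + dd + 4 / 9 * ln (2 * K2 / e1).

Let del_gt0 : 0 < del.
Proof. by rewrite mulr_gt0 ?powR_gt0 ?divr_gt0//; have := qpos; lra. Qed.

Let c2_ge : 25 / 4 <= c ^+ 2. Proof. have := c52; nra. Qed.

Let del2_gt0 : 0 < del2.
Proof.
rewrite lt_min; apply/andP; split; first lra.
by rewrite divr_gt0//; have := c2_ge; lra.
Qed.

Let C1_gt0 : 0 < C1. Proof. by rewrite divr_gt0 ?pi_gt0. Qed.
Let K1_gt1 : 3 < K1. Proof. by rewrite /K1; have := c2_ge; lra. Qed.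
Let dd_gt0 : 0 < dd. Proof. by rewrite divr_gt0//; have := K1_gt1; lra. Qed.
Let ddK : K1 * dd = 1 / 4. Proof. by rewrite /dd; field; rewrite gt_eqF//; have := K1_gt1; lra. Qed.
Let e1_gt0 : 0 < e1. Proof. by rewrite lt_min ltr01 divr_gt0// mulr_gt0. Qed.
Let e1_le1 : e1 <= 1. Proof. by rewrite ge_min lexx. Qed.
Let e1_le : e1 <= dd * q0 / 32. Proof. by rewrite ge_min lexx orbT. Qed.
Let K2_gt : 4 < K2. Proof. by rewrite /K2; have := c2_ge; lra. Qed.

Section Orbit.
Variables (y z Q dQ : R -> R).
Hypothesis dy : forall t, t <= T -> has_deriv y t (z t).
Hypothesis dz : forall t, t <= T -> has_deriv z t (y t * (c ^+ 2 - Q t - `|y t| `^ q)).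
Hypothesis dQQ : forall t, t <= T -> has_deriv Q t (dQ t).
Hypothesis Q_rng : forall t, t <= T -> 0 <= Q t <= 3 / 16.
Hypothesis dQ_ge : forall t, t <= T -> q0 * expR (2 * t) <= dQ t.

(** The Pohozaev quantity in these variables. Its derivative is [dQ t * y t ^+ 2 / 2]: all its
    growth comes from the drift of [Q]. *)
Definition En t := z t ^+ 2 / 2 - c ^+ 2 * y t ^+ 2 / 2 + Phi q (y t) + Q t * y t ^+ 2 / 2.
Hypothesis En_gt0 : forall t, t <= T -> 0 < En t.

Let cy t : t <= T -> {for t, continuous y}. Proof. by move=> /dy; exact: der_cont. Qed.
Let cz t : t <= T -> {for t, continuous z}. Proof. by move=> /dz; exact: der_cont. Qed.

Let dQ_ge0 t : t <= T -> 0 <= dQ t.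
Proof. by move=> /dQ_ge; apply: le_trans; rewrite mulr_ge0 ?expR_ge0// ltW. Qed.

Let dEn t : t <= T -> has_deriv En t (dQ t * y t ^+ 2 / 2).
Proof.
move=> tT; have hy := dy tT; have hz := dz tT; have hQ := dQQ tT.
apply: (der_eq (derD (derD (derB (derM (derX 2 hz) (derC t 2^-1))
  (derM (derM (derC t (c ^+ 2)) (derX 2 hy)) (derC t 2^-1)))
  (der_comp (Phi_der qpos (y t)) hy)) (derM (derM hQ (derX 2 hy)) (derC t 2^-1)))).
by rewrite /phi expr1 /=; field.
Qed.

Let En_mono s t : s <= t -> t <= T -> En s <= En t.
Proof.
move=> st tT.
have cE x : s <= x <= t -> {for x, continuous En}.
  by move=> /andP[_ xt]; exact: der_cont (dEn (le_trans xt tT)).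
have dE x : s < x < t -> has_deriv En x (dQ x * y x ^+ 2 / 2).
  by move=> /andP[_ xt]; apply: dEn; lra.
apply: (der_ge0_le st cE dE) => x /andP[_ xt].
by apply: divr_ge0 => //; apply: mulr_ge0; [apply: dQ_ge0; lra|exact: sqr_ge0].
Qed.

Let Phi_le t : Phi q (y t) = `|y t| `^ q * y t ^+ 2 / (q + 2). Proof. by []. Qed.

Let zsq t : z t ^+ 2 = 2 * En t + (c ^+ 2 - Q t) * y t ^+ 2 - 2 * Phi q (y t).
Proof. by rewrite /En; field. Qed.

Let Phi_half t : 2 * Phi q (y t) <= `|y t| `^ q * y t ^+ 2.
Proof.
rewrite Phi_le mulrA ler_pdivrMr; last by have := qpos; lra.
have : 0 <= `|y t| `^ q * y t ^+ 2 by apply: mulr_ge0; [exact: powR_ge0|exact: sqr_ge0].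
by set A := _ * _; have := qpos; nra.
Qed.

Let z_le t : t <= T -> z t ^+ 2 <= 2 * En t + c ^+ 2 * y t ^+ 2.
Proof.
move=> tT; rewrite zsq; have := Q_rng tT; have := Phi_ge0 qpos (y t).
have := sqr_ge0 (y t); nra.
Qed.

Let powq_le1 t : `|y t| <= 1 / 2 -> `|y t| `^ q <= 1.
Proof.
move=> h; have <- : (1 : R) `^ q = 1 by rewrite powR1.
apply: le_powq => //; lra.
Qed.

(** The source of the rate 9/4: [c ^+ 2 - Q - |y| ^ q] is at least 25/4 - 3/16 - 1 = 81/16. *)
Let z_ge t : t <= T -> `|y t| <= 1 / 2 -> 2 * En t + (9 / 4) ^+ 2 * y t ^+ 2 <= z t ^+ 2.
Proof.
move=> tT h; rewrite zsq; have := Q_rng tT; have := Phi_half t.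
have := powq_le1 h; have := sqr_ge0 (y t); have := c2_ge.
set Y := y t ^+ 2; set p := _ `^ q => h1 Y0 h2 h3 h4.
have : p * Y <= Y by nra.
nra.
Qed.

(** At a first zero of [z] one would have [|y| <= 1 / 2], and [z_ge] together with the positive
    energy forbids [z = 0] there. So a descending orbit keeps descending as long as it stays above
    -1/2. *)
Let region s0 s1 : s0 <= s1 -> s1 <= T -> z s0 < 0 -> y s0 <= 1 / 2 ->
  (forall t, s0 <= t <= s1 -> - (1 / 2) <= y t) ->
  forall t, s0 <= t <= s1 -> z t < 0 /\ y t <= y s0.
Proof.
move=> s01 s1T zs ys yge.
have mono t : s0 <= t <= s1 -> (forall s, s0 < s < t -> z s < 0) -> y t <= y s0.
  move=> /andP[st ts] hz; rewrite -lerN2.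
  have cn x : s0 <= x <= t -> {for x, continuous (fun x => - y x)}.
    by move=> xt; apply: contN; apply: cy; lra.
  have dn x : s0 < x < t -> has_deriv (fun x => - y x) x (- z x).
    by move=> xt; apply: derN; apply: dy; lra.
  by apply: (der_ge0_le st cn dn) => x /hz; rewrite oppr_ge0 => /ltW.
have zneg t : s0 <= t <= s1 -> z t < 0.
  move=> ts; rewrite ltNge; apply/negP => zt.
  have cn x : s0 <= x <= t -> {for x, continuous (fun x => - z x)}.
    by move=> xt; apply: contN; apply: cz; lra.
  have zs' : 0 < - z s0 by rewrite oppr_gt0.
  have zt' : - z t <= 0 by rewrite oppr_le0.
  have [u [s0u ut zu pos]] := first_hit (ltac:(lra) : s0 <= t) cn zs' zt'.
  have uT : u <= T by lra.
  have yu : y u <= y s0.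
    by apply: mono; [lra|move=> s su; rewrite -oppr_gt0; apply: pos; lra].
  have yu2 : `|y u| <= 1 / 2.
    by rewrite ler_norml; have := yge u ltac:(lra); lra.
  have := z_ge uT yu2; have -> : z u = 0 by apply/eqP; rewrite -oppr_eq0 zu.
  have := En_gt0 uT; have := sqr_ge0 (y u); rewrite expr0n /=; lra.
move=> t ts; split; first exact: zneg.
by apply: mono => // s st; apply: zneg; lra.
Qed.

Local Ltac prune := clear -c52 qpos q0pos T0 dy dz dQQ Q_rng dQ_ge En_gt0 del_gt0 c2_ge
  del2_gt0 C1_gt0 K1_gt1 dd_gt0 ddK e1_gt0 e1_le1 e1_le K2_gt cy cz dQ_ge0 dEn En_mono Phi_le zsq
  Phi_half z_le powq_le1 z_ge region.
Local Ltac lra0 := prune; lra.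

(** If y stayed above 1/2 for the time [C1], the angle atan (z / y) would turn by pi, the whole
    length of its open range. *)
Let descend t0 : t0 + C1 <= T -> 1 / 2 <= y t0 ->
  exists t, [/\ t0 <= t, t <= t0 + C1, y t = 1 / 2 & z t < 0].
Proof.
move=> t0T yt0.
have [t2 [t2a t2b yt2]] : exists t2, [/\ t0 <= t2, t2 <= t0 + C1 & y t2 < 1 / 2].
  apply: contrapT => H.
  have yge t : t0 <= t <= t0 + C1 -> 1 / 2 <= y t.
    move=> /andP[h1 h2]; rewrite leNgt; apply/negP => h3; apply: H.
    by exists t.
  pose rho t := z t / y t.
  pose drho t := c ^+ 2 - Q t - `|y t| `^ q - rho t ^+ 2.
  have drhoE t : t0 <= t <= t0 + C1 -> has_deriv rho t (drho t).
    move=> tt; have yt := yge t tt; have yn : y t != 0 by rewrite gt_eqF//; lra.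
    have tT : t <= T by lra.
    apply: (der_eq (derM (dz tT) (derV yn (dy tT)))).
    by rewrite /drho /rho; field.
  pose ph t := atan (rho t).
  have dph t : t0 <= t <= t0 + C1 -> has_deriv ph t ((1 + rho t ^+ 2)^-1 * drho t).
    by move=> tt; apply: (der_comp (is_derive1_atan (rho t)) (drhoE t tt)).
  have rate t : t0 <= t <= t0 + C1 -> (1 + rho t ^+ 2)^-1 * drho t <= - del2.
    move=> tt; have yt := yge t tt; have tT : t <= T by lra.
    have y0 : 0 < y t by lra.
    have r2 := sqr_ge0 (rho t).
    have r1 : 0 < 1 + rho t ^+ 2 by lra.
    rewrite mulrC ler_pdivrMr//.
    have pge : (1 / 2) `^ q <= `|y t| `^ q.
      by rewrite gtr0_norm// le_powq//; lra.
    have Eq : drho t = - (2 * En t / y t ^+ 2) - `|y t| `^ q * (q / (q + 2)).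
      rewrite /drho /rho exprMn exprVn zsq Phi_le; field.
      by rewrite !gt_eqF//; have := qpos; lra.
    have d1 : drho t <= - del.
      rewrite Eq; have : 0 <= 2 * En t / y t ^+ 2.
        by rewrite divr_ge0 ?sqr_ge0// mulr_ge0// ltW// En_gt0.
      have : del <= `|y t| `^ q * (q / (q + 2)).
        by rewrite /del ler_wpM2r// divr_ge0//; have := qpos; lra.
      lra.
    have d2 : drho t <= c ^+ 2 - rho t ^+ 2.
      by rewrite /drho; have := Q_rng tT; have := powR_ge0 `|y t| q; lra.
    have dl1 : del2 <= 1 / 2 by rewrite /del2 ge_min lexx.
    have dl2 : del2 * (2 + 2 * c ^+ 2) <= del.
      rewrite -ler_pdivlMr; last by have := c2_ge; lra.
      by rewrite /del2 ge_min lexx orbT.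
    have dl0 := del2_gt0.
    (* For moderate slopes the bound [- del] is divided by at most [2 + 2 c ^+ 2]; for steep ones
       [c ^+ 2 - rho ^+ 2] is below [- (1 + rho ^+ 2) / 2]. These are the two terms of the minimum
       [del2]. *)
    have [h|h] := leP (rho t ^+ 2) (2 * c ^+ 2 + 1); move: d1 d2 dl1 dl2 dl0 h r2; prune; nra.
  have C10 := C1_gt0; have tt1 : t0 < t0 + C1 by lra.
  have cph t : t0 <= t <= t0 + C1 -> {for t, continuous ph}.
    by move=> tt; exact: der_cont (dph t tt).
  have dph' t : t0 < t < t0 + C1 -> has_deriv ph t ((1 + rho t ^+ 2)^-1 * drho t).
    by move=> tt; apply: dph; lra.
  have [u uu e] := MVT_itv tt1 cph dph'.
  have := rate u ltac:(lra); have -> : (1 + rho u ^+ 2)^-1 * drho u = (ph (t0 + C1) - ph t0) / C1.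
    by rewrite e [t0 + C1]addrC addrK mulfK// gt_eqF.
  rewrite ler_pdivrMr// mulNr /C1 [del2 * _]mulrC divfK ?gt_eqF//.
  have := atan_gtNpi2 (rho (t0 + C1)); have := atan_ltpi2 (rho t0); rewrite -/(ph _) -/(ph _).
  lra.
(* Time is reversed to find the last instant before [t2] at which y = 1/2. There [z] is nonzero by
   [z_ge], and [z > 0] would put y above 1/2 again just afterwards. *)
pose g s := - y (t2 - s).
have cg s : 0 <= s <= t2 - t0 -> {for s, continuous g}.
  move=> ss; apply: contN; apply: (@cont_comp R _ y (fun s => t2 - s)); last by apply: cy; lra.
  by apply: contB; [exact: contC|exact: contI].
have g0 : - (1 / 2) < g 0 by rewrite /g subr0; lra.
have g1 : g (t2 - t0) <= - (1 / 2) by rewrite /g opprB addrC subrK; lra.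
have [s [s0 st gs pos]] := first_hit (ltac:(lra) : 0 <= t2 - t0) cg g0 g1.
have yt : y (t2 - s) = 1 / 2 by move: gs; rewrite /g; lra.
exists (t2 - s); split => //; [by move: st; lra0|by move: t2b s0; lra0|].
have tT : t2 - s <= T by lra.
have zn : z (t2 - s) != 0.
  apply/eqP => zE; have := z_ge tT; rewrite yt zE ger0_norm; last lra.
  by have := En_gt0 tT => h1 /(_ (lexx _)); rewrite expr0n /=; nra.
rewrite lt_neqAle zn leNgt /=; apply/negP => zp.
have /der_epsP/(_ _ zp)[r r0 hr] := dy tT.
pose h := Num.min (r / 2) (s / 2).
have h0 : 0 < h by rewrite lt_min; apply/andP; split; move: r0 s0; lra0.
have hr2 : h <= r / 2 by rewrite ge_min lexx.
have hs2 : h <= s / 2 by rewrite ge_min lexx orbT.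
have hg : - (1 / 2) < g (s - h) by apply: pos; move: h0 hs2 s0; lra0.
have gE : g (s - h) = - y (t2 - s + h) by rewrite /g; congr (- y _); ring.
have hn : h != 0 by rewrite gt_eqF.
have hr3 : `|h| < r by rewrite gtr0_norm//; move: hr2 r0; lra0.
have := hr h hn hr3; rewrite ltr_norml yt => /andP[h2 _].
have : 0 < (y (t2 - s + h) - 1 / 2) / h by move: h2; lra0.
rewrite pmulr_lgt0 ?invr_gt0//; move: hg; rewrite gE; lra0.
Qed.

(** Unless the energy already exceeds 1, the speed is at most [K1]; so y cannot reach 0 before the
    time [dd] and stays above 1/4 until then, while [En] grows at rate at least
    [q0 * expR (2 t0) / 32]. *)
Let energy_gain t0 ta s : t0 <= ta -> ta <= s -> s <= T -> y ta = 1 / 2 -> z ta < 0 ->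
  (forall t, ta <= t <= s -> 0 <= y t) -> (ta + dd <= s \/ y s = 0) ->
  e1 * expR (2 * t0) <= En s.
Proof.
move=> t0ta tas sT yta zta y0 alt.
have eT : expR (2 * t0) <= 1.
  by rewrite -[leRHS]expR0 ler_expR; have := T0; lra.
have ep := expR_gt0 (2 * t0).
have [Es|Es] := leP 1 (En s).
  by apply: le_trans Es; have := e1_gt0; have := e1_le1; nra.
have reg t : ta <= t <= s -> z t < 0 /\ y t <= 1 / 2.
  move=> tt; rewrite -[in leRHS]yta.
  by apply: (region tas sT zta _ _ tt); [rewrite yta|move=> u /y0; lra].
have zK t : ta <= t <= s -> `|z t| <= K1.
  move=> tt; have [zt yt] := reg t tt; have yt0 := y0 t tt.
  have tT : t <= T by lra.
  have Et : En t <= 1 by apply: le_trans (ltW Es); apply: En_mono; move: tt sT; lra0.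
  have := z_le tT; have : y t ^+ 2 <= 1 / 4 by nra.
  rewrite -[z t ^+ 2]real_normK ?num_real// => h1 h2.
  have h3 : `|z t| ^+ 2 <= K1 by rewrite /K1; have := c2_ge; move: h1 h2 Et; prune; nra.
  by have := K1_gt1; have := normr_ge0 (z t); move: h3; prune; nra.
have low t : ta <= t <= s -> 1 / 2 - K1 * (t - ta) <= y t.
  move=> tt; have [|h|E] := ltgtP ta t; [|by move: h tt; lra0|by rewrite E subrr mulr0 subr0 -E yta].
  move=> lt_t; have cy' x : ta <= x <= t -> {for x, continuous y} by move=> xt; apply: cy; lra.
  have dy' x : ta < x < t -> has_deriv y x (z x) by move=> xt; apply: dy; lra.
  have [u ut e] := MVT_itv lt_t cy' dy'.
  have := zK u ltac:(lra); rewrite ler_norml => /andP[zu _].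
  have : (- K1) * (t - ta) <= z u * (t - ta) by rewrite ler_wpM2r//; lra.
  rewrite -e yta; lra.
have dK := ddK; have K1p := K1_gt1; have dp := dd_gt0.
have tds : ta + dd <= s.
  case: alt => // ys0; have := low s ltac:(lra); rewrite ys0 => h2.
  rewrite leNgt; apply/negP => h.
  have : K1 * (s - ta) <= K1 * dd by rewrite ler_pM2l; move: h K1p; lra0.
  by move: h2 dK; lra0.
have cE x : ta <= x <= ta + dd -> {for x, continuous En}.
  by move=> xt; apply: der_cont (dEn _); move: xt tds sT; lra0.
pose k := q0 * expR (2 * t0) / 32.
have ck x : ta <= x <= ta + dd -> {for x, continuous (fun x => k * x)}.
  by move=> _; apply: contM; [exact: contC|exact: contI].
have dE x : ta < x < ta + dd -> has_deriv En x (dQ x * y x ^+ 2 / 2).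
  by move=> xt; apply: dEn; move: xt tds sT; lra0.
have dk x : ta < x < ta + dd -> has_deriv (fun x => k * x) x k.
  by move=> _; apply: (der_eq (derM (derC x k) (derI x))); ring.
have le_d x : ta < x < ta + dd -> k <= dQ x * y x ^+ 2 / 2.
  move=> xt; have xT : x <= T by move: xt tds sT; lra0.
  have yx := low x ltac:(move: xt tds; lra0).
  have yx4 : 1 / 4 <= y x.
    have : K1 * (x - ta) <= K1 * dd by rewrite ler_pM2l; move: xt K1p; lra0.
    by move: yx dK; lra0.
  have e2 : expR (2 * t0) <= expR (2 * x) by rewrite ler_expR; move: t0ta xt; lra0.
  have dq := dQ_ge xT; have q00 := q0pos.
  have dq' : q0 * expR (2 * t0) <= dQ x by apply: le_trans dq; rewrite ler_pM2l.
  have y16 : 1 / 16 <= y x ^+ 2 by move: yx4; prune; nra.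
  have : q0 * expR (2 * t0) * (1 / 16) <= dQ x * y x ^+ 2.
    have p1 : 0 <= q0 * expR (2 * t0) by rewrite mulr_ge0// ltW.
    have p2 : (0 : R) <= 1 / 16 by lra0.
    exact: (ler_pM p1 p2 dq' y16).
  by rewrite /k; lra0.
have h1 := der_le (ltac:(move: dp; lra0) : ta <= ta + dd) ck cE dk dE le_d.
have h2 := En_mono tds sT.
have h3 := En_gt0 (ltac:(move: tas sT; lra0) : ta <= T).
have : e1 * expR (2 * t0) <= k * dd.
  have -> : k * dd = dd * q0 / 32 * expR (2 * t0) by rewrite /k; field.
  by rewrite ler_wpM2r// ltW.
by move: h1 h2 h3; lra0.
Qed.

(** Duration of one leg past the saddle at rate 9/4. With e of order exp(2 t0) it is about (4/9)
    |t0|, and a bump needs two legs. *)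
Let bump_L (e : R) : 0 < e -> e <= 1 ->
  exists2 L, 0 < L & L = 2 / 9 * ln (2 * K2 / e) /\ expR (9 / 2 * L) = 2 * K2 / e.
Proof.
move=> e0 e1'; have K := K2_gt.
have K2e : 1 < 2 * K2 / e by rewrite ltr_pdivlMr//; lra.
exists (2 / 9 * ln (2 * K2 / e)).
  by rewrite mulr_gt0 ?divr_gt0// ln_gt0.
split => //; have -> : 9 / 2 * (2 / 9 * ln (2 * K2 / e)) = ln (2 * K2 / e) by field.
by rewrite lnK// posrE; lra.
Qed.

Let sq_exp (h1 h2 L : R) : 0 <= h2 -> h2 <= h1 * expR (- (9 / 4) * L) ->
  h2 ^+ 2 * expR (9 / 2 * L) <= h1 ^+ 2.
Proof.
move=> h20 h; have e0 := expR_gt0 (9 / 4 * L).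
have E : expR (9 / 2 * L) = expR (9 / 4 * L) ^+ 2.
  by rewrite -expRM_natl; congr expR; field.
rewrite E -exprMn; apply: lerXn2r; rewrite ?nnegrE.
- by rewrite mulr_ge0// ltW.
- have := le_trans h20 h; rewrite pmulr_lge0// expR_gt0//.
- by move: h; rewrite mulNr expRN -ler_pdivlMr ?invr_gt0// invrK.
Qed.

Local Ltac prune ::= clear -c52 qpos q0pos T0 dy dz dQQ Q_rng dQ_ge En_gt0 del_gt0 c2_ge
  del2_gt0 C1_gt0 K1_gt1 dd_gt0 ddK e1_gt0 e1_le1 e1_le K2_gt cy cz dQ_ge0 dEn En_mono Phi_le zsq
  Phi_half z_le powq_le1 z_ge region descend energy_gain bump_L sq_exp.

(** As long as y stays in [0, 1/2], (9/4 y - z) exp(9 t / 4) does not increase. Over the time [L]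
    the square of 9/4 y - z would then shrink by the factor [2 * K2 / e], whereas it remains at
    least [2 * En], which is at least [2 * e]. *)
Let cross_down t0 ta L e : t0 <= ta -> y ta = 1 / 2 -> z ta < 0 ->
  e = e1 * expR (2 * t0) -> 0 < L -> expR (9 / 2 * L) = 2 * K2 / e -> ta + dd + L <= T ->
  exists s, [/\ ta < s, s <= ta + dd + L, y s = 0, z s < 0 & e <= En s].
Proof.
move=> t0ta yta zta eE L0 LE tT.
have dp := dd_gt0; have e0 : 0 < e by rewrite eE mulr_gt0// expR_gt0.
have [[w /andP[w1 w2] yw]|noz] := pselect (exists2 w, ta <= w <= ta + dd + L & y w <= 0).
  have cn x : ta <= x <= w -> {for x, continuous y} by move=> xt; apply: cy; lra.
  have yp : 0 < y ta by rewrite yta.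
  have [s [tas sw ys pos]] := first_hit w1 cn yp yw.
  have y0 t : ta <= t <= s -> 0 <= y t.
    move=> /andP[h1]; rewrite le_eqVlt => /predU1P[->|h2]; first by rewrite ys.
    by apply/ltW/pos; rewrite h1.
  have sT : s <= T by lra.
  have ytale : y ta <= 1 / 2 by rewrite yta.
  have yge t : ta <= t <= s -> - (1 / 2) <= y t by move=> /y0; lra.
  have ss : ta <= s <= s by rewrite lexx (ltW tas).
  have [zs _] := region (ltW tas) sT zta ytale yge ss.
  exists s; split => //; first lra.
  by rewrite eE; apply: (energy_gain t0ta (ltW tas) sT yta zta y0); right.
exfalso; set te := ta + dd + L; set tb := ta + dd; have teT : te <= T := tT.
have y0 t : ta <= t <= te -> 0 <= y t.
  by move=> tt; rewrite leNgt; apply/negP => h; apply: noz; exists t => //; exact: ltW.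
have tate : ta <= te by rewrite /te; lra.
have ytale : y ta <= 1 / 2 by rewrite yta.
have yge t : ta <= t <= te -> - (1 / 2) <= y t by move=> /y0; lra.
have reg := region tate tT zta ytale yge.
have tbte : tb <= te by rewrite /tb /te; lra.
have tatb : ta <= tb by rewrite /tb; lra.
have tbT : tb <= T := le_trans tbte tT.
have Eb : e <= En tb.
  rewrite eE; apply: (energy_gain t0ta tatb tbT yta zta); last by left.
  by move=> t tt; apply: y0; lra.
have Ebe := En_mono tbte tT.
pose h t := (9 / 4 * y t - z t) * expR (9 / 4 * t).
have dh t : tb <= t <= te -> has_deriv h t ((9 / 4 * z t - y t * (c ^+ 2 - Q t - `|y t| `^ q)
   + 9 / 4 * (9 / 4 * y t - z t)) * expR (9 / 4 * t)).
  move=> tt; have t'T : t <= T by move: tt teT; lra0.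
  apply: (der_eq (derM (derB (derM (derC t (9 / 4)) (dy t'T)) (dz t'T))
    (der_comp (is_derive_expR _) (derM (derC t (9 / 4)) (derI t))))); ring.
have h_le : h te <= h tb.
  rewrite -lerN2.
  have cn t : tb <= t <= te -> {for t, continuous (fun t => - h t)}.
    by move=> tt; apply: contN; exact: der_cont (dh t tt).
  have dn t : tb < t < te -> has_deriv (fun t => - h t) t (- ((9 / 4 * z t -
     y t * (c ^+ 2 - Q t - `|y t| `^ q) + 9 / 4 * (9 / 4 * y t - z t)) * expR (9 / 4 * t))).
    by move=> tt; apply: derN; apply: dh; move: tt; lra0.
  apply: (der_ge0_le tbte cn dn) => t tt; have t'T : t <= T by move: tt teT; lra0.
  rewrite oppr_ge0 pmulr_lle0 ?expR_gt0//.
  have tte : ta <= t <= te by move: tt tatb; lra0.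
  have [_ yt] := reg t tte; have yt0 := y0 t tte.
  have : `|y t| `^ q <= 1 by apply: powq_le1; rewrite ger0_norm//; move: yt yta; lra0.
  by have := Q_rng t'T; have := c2_ge; move: yt0; prune; nra.
have [zte yte] := reg te ltac:(move: tate; lra0).
have [ztb ytb] := reg tb ltac:(move: tatb tbte; lra0).
have yte0 := y0 te ltac:(move: tate; lra0); have ytb0 := y0 tb ltac:(move: tatb tbte; lra0).
have hE : 9 / 4 * y te - z te <= (9 / 4 * y tb - z tb) * expR (- (9 / 4) * L).
  rewrite -(ler_pM2r (expR_gt0 (9 / 4 * te))) -[leRHS]mulrA -expRD.
  by have -> : - (9 / 4) * L + 9 / 4 * te = 9 / 4 * tb by rewrite /te /tb; ring.
have := sq_exp _ hE; rewrite LE => /(_ ltac:(move: yte0 zte; lra0)) {}hE.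
have z1 := z_ge tT; have z2 := z_le tbT.
have a1 : 2 * En te <= (9 / 4 * y te - z te) ^+ 2.
  have : `|y te| <= 1 / 2 by rewrite ger0_norm//; move: yte yta; lra0.
  by move/z1; have := sqr_ge0 (y te); move: yte0 zte; prune; nra.
have a2 : (9 / 4 * y tb - z tb) ^+ 2 <= c ^+ 2 + 4 * En tb.
  have : y tb ^+ 2 <= 1 / 4 by move: ytb0 ytb yta; prune; nra.
  have := c2_ge; have := sqr_ge0 (9 / 4 * y tb + z tb); move: z2; prune; nra.
have a3 : 2 * En tb * (2 * K2) <= (c ^+ 2 + 4 * En tb) * e.
  have : 2 * En tb * (2 * K2 / e) <= c ^+ 2 + 4 * En tb.
    apply: le_trans a2; apply: le_trans hE; rewrite ler_wpM2r//; last by move: Ebe a1; lra0.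
    by rewrite divr_ge0 ?(ltW e0)// mulr_ge0//; have := K2_gt; lra0.
  by rewrite mulrA ler_pdivrMr.
have e_le1 : e <= 1.
  rewrite eE; have : expR (2 * t0) <= 1 by rewrite -[leRHS]expR0 ler_expR; have := T0; move: t0ta tatb tbT; lra0.
  by have := e1_gt0; have := e1_le1; have := expR_gt0 (2 * t0); prune; nra.
move: a3; rewrite /K2; have := c2_ge; move: e_le1 e0 Eb; prune; nra.
Qed.

Local Ltac prune ::= clear -c52 qpos q0pos T0 dy dz dQQ Q_rng dQ_ge En_gt0 del_gt0 c2_ge
  del2_gt0 C1_gt0 K1_gt1 dd_gt0 ddK e1_gt0 e1_le1 e1_le K2_gt cy cz dQ_ge0 dEn En_mono Phi_le zsq
  Phi_half z_le powq_le1 z_ge region descend energy_gain bump_L sq_exp cross_down.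

(** The outgoing leg: while y stays in [-1/2, 0], (- 9/4 y - z) exp(- 9 t / 4) does not decrease.
    The square of - 9/4 y - z starts at [z tz ^+ 2 >= 2 * En tz] and grows by the factor
    [2 * K2 / e], too much for the bound that y >= -1/2 imposes. *)
Let cross_neg tz L e : y tz = 0 -> z tz < 0 -> e <= En tz -> 0 < e -> e <= 1 ->
  0 < L -> expR (9 / 2 * L) = 2 * K2 / e -> tz + L <= T ->
  exists s, [/\ tz < s, s <= tz + L & y s <= - (1 / 2)].
Proof.
move=> ytz ztz Ez e0 e_le1 L0 LE tT.
apply: contrapT => H; set te := tz + L; have teT : te <= T := tT.
have yge t : tz <= t <= te -> - (1 / 2) <= y t.
  move=> /andP[h1 h2]; rewrite leNgt; apply/negP => h; apply: H.
  exists t; split => //; last exact: ltW.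
  by rewrite lt_neqAle h1 andbT; apply/eqP => E; move: h; rewrite -E ytz; lra.
have tzte : tz <= te by rewrite /te; lra.
have ytz2 : y tz <= 1 / 2 by rewrite ytz.
have reg := region tzte tT ztz ytz2 yge.
pose h t := (- (9 / 4) * y t - z t) * expR (- (9 / 4) * t).
have dh t : tz <= t <= te -> has_deriv h t ((- (9 / 4) * z t - y t * (c ^+ 2 - Q t - `|y t| `^ q)
   - 9 / 4 * (- (9 / 4) * y t - z t)) * expR (- (9 / 4) * t)).
  move=> tt; have t'T : t <= T by move: tt teT; lra0.
  apply: (der_eq (derM (derB (derM (derC t (- (9 / 4))) (dy t'T)) (dz t'T))
    (der_comp (is_derive_expR _) (derM (derC t (- (9 / 4))) (derI t))))); ring.
have h_le : h tz <= h te.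
  have cn t : tz <= t <= te -> {for t, continuous h}.
    by move=> tt; exact: der_cont (dh t tt).
  have dn t : tz < t < te -> has_deriv h t ((- (9 / 4) * z t -
     y t * (c ^+ 2 - Q t - `|y t| `^ q) - 9 / 4 * (- (9 / 4) * y t - z t)) * expR (- (9 / 4) * t)).
    by move=> tt; apply: dh; move: tt; lra0.
  apply: (der_ge0_le tzte cn dn) => t tt; have t'T : t <= T by move: tt teT; lra0.
  rewrite mulr_ge0 ?expR_ge0//.
  have tte : tz <= t <= te by move: tt; lra0.
  have [_ yt] := reg t tte; have yt0 := yge t tte; rewrite ytz in yt.
  have : `|y t| `^ q <= 1 by apply: powq_le1; rewrite ler_norml; move: yt yt0; lra0.
  by have := Q_rng t'T; have := c2_ge; move: yt yt0; prune; nra.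
have [zte yte] := reg te ltac:(move: tzte; lra0); rewrite ytz in yte.
have yte0 := yge te ltac:(move: tzte; lra0).
have hE : - z tz <= (- (9 / 4) * y te - z te) * expR (- (9 / 4) * L).
  rewrite -(ler_pM2r (expR_gt0 (- (9 / 4) * tz))) -[leRHS]mulrA -expRD.
  have -> : - (9 / 4) * L + - (9 / 4) * tz = - (9 / 4) * te by rewrite /te; ring.
  by move: h_le; rewrite /h ytz mulr0 sub0r.
have := sq_exp _ hE; rewrite LE sqrrN => /(_ ltac:(move: ztz; lra0)) {}hE.
have tzT : tz <= T := le_trans tzte tT.
have a1 : 2 * En tz <= z tz ^+ 2.
  by have := z_ge tzT; rewrite ytz normr0 expr0n /= mulr0 addr0; apply; lra0.
(* The final energy enters the upper bound and must not outgrow the initial one: on this leg y^2 <=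
   1/4, so [En] gains at most an eighth of the variation of [Q]. *)
have Ete : En te - En tz <= Q te / 8 - Q tz / 8.
  have cE x : tz <= x <= te -> {for x, continuous En}.
    by move=> xt; apply: der_cont (dEn _); move: xt teT; lra0.
  have dQ8 x : tz <= x <= te -> has_deriv (fun x => Q x / 8) x (dQ x / 8).
    move=> xt; have xT : x <= T by move: xt teT; lra0.
    by apply: (der_eq (derM (dQQ xT) (derC x 8^-1))); rewrite mulr0 addr0.
  have cQ x : tz <= x <= te -> {for x, continuous (fun x => Q x / 8)}.
    by move=> xt; exact: der_cont (dQ8 x xt).
  have dE x : tz < x < te -> has_deriv En x (dQ x * y x ^+ 2 / 2).
    by move=> xt; apply: dEn; move: xt teT; lra0.
  have dQ8' x : tz < x < te -> has_deriv (fun x => Q x / 8) x (dQ x / 8).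
    by move=> xt; apply: dQ8; move: xt; lra0.
  apply: (der_le tzte cE cQ dE dQ8') => x xt.
  have xte : tz <= x <= te by move: xt; lra0.
  have [_ yx] := reg x xte; have yx0 := yge x xte; rewrite ytz in yx.
  have : y x ^+ 2 <= 1 / 4 by move: yx yx0; prune; nra.
  have xT : x <= T by move: xt teT; lra0.
  have := dQ_ge0 xT; prune; nra.
have a2 : (- (9 / 4) * y te - z te) ^+ 2 <= c ^+ 2 + 4 * En te.
  have := z_le tT; have : y te ^+ 2 <= 1 / 4 by move: yte yte0; prune; nra.
  have := c2_ge; have := sqr_ge0 (- (9 / 4) * y te + z te); prune; nra.
have Qte := Q_rng tT; have Qtz := Q_rng tzT.
have a3 : 2 * En tz * (2 * K2) <= (c ^+ 2 + 4 + 4 * En tz) * e.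
  have : 2 * En tz * (2 * K2 / e) <= c ^+ 2 + 4 + 4 * En tz.
    apply: (@le_trans _ _ (z tz ^+ 2 * (2 * K2 / e))).
      by rewrite ler_wpM2r// divr_ge0 ?(ltW e0)// mulr_ge0//; have := K2_gt; lra0.
    by apply: le_trans hE _; apply: le_trans a2 _; move: Ete Qte Qtz; lra0.
  by rewrite mulrA ler_pdivrMr.
move: a3; rewrite /K2; have := c2_ge; move: e_le1 e0 Ez; prune; nra.
Qed.

Lemma bump_pos t0 : 1 / 2 <= y t0 -> t0 / 9 + bumpC <= T ->
  exists s t1, [/\ t0 < s, s < t1, t1 <= t0 / 9 + bumpC, y s = 0 & y t1 <= - (1 / 2)].
Proof.
move=> yt0 tT; have c1 := C1_gt0; have dp := dd_gt0; have k2 := K2_gt; have e1p := e1_gt0.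
pose e := e1 * expR (2 * t0).
have t00 : t0 <= 0.
  have lnp : 0 <= ln (2 * K2 / e1).
    by rewrite ln_ge0// ler_pdivlMr// mul1r; have := e1_le1; lra.
  by have := T0; move: tT; rewrite /bumpC; lra.
have e0 : 0 < e by rewrite mulr_gt0// expR_gt0.
have e_le1 : e <= 1.
  have : expR (2 * t0) <= 1 by rewrite -[leRHS]expR0 ler_expR; lra.
  by rewrite /e; have := e1_le1; have := expR_gt0 (2 * t0); nra.
have [L L0 [LE Lexp]] := bump_L e0 e_le1.
have L2 : 2 * L = 4 / 9 * ln (2 * K2 / e1) - 8 / 9 * t0.
  have eE : 2 * K2 / e = (2 * K2 / e1) * expR (- (2 * t0)) by rewrite /e invfM expRN mulrA.
  have k20 : 0 < 2 * K2 / e1 by rewrite divr_gt0//; lra.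
  by rewrite LE eE lnM ?posrE ?expR_gt0// expRK; field.
(* The two legs use up (8/9) |t0|; a rate above 2 is what leaves a positive fraction of t0. *)
have tot : t0 + C1 + dd + 2 * L = t0 / 9 + bumpC by rewrite L2 /bumpC; field.
have [ta [ta0 ta1 yta zta]] := descend (ltac:(lra) : t0 + C1 <= T) yt0.
have [s [tas sle ys zs Es]] :=
  cross_down ta0 yta zta (erefl e) L0 Lexp (ltac:(lra) : ta + dd + L <= T).
have [t1 [st1 t1le yt1]] := cross_neg ys zs Es e0 e_le1 L0 Lexp (ltac:(lra) : s + L <= T).
by exists s, t1; split => //; lra.
Qed.

End Orbit.

Definition orbit (y z Q dQ : R -> R) := forall t, t <= T ->
  [/\ has_deriv y t (z t), has_deriv z t (y t * (c ^+ 2 - Q t - `|y t| `^ q)),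
    has_deriv Q t (dQ t), 0 <= Q t <= 3 / 16 & q0 * expR (2 * t) <= dQ t /\ 0 < En y z Q t].

Lemma orbit_opp y z Q dQ : orbit y z Q dQ ->
  orbit (fun t => - y t) (fun t => - z t) Q dQ.
Proof.
move=> o t tT; have [h1 h2 h3 h4 [h5 h6]] := o t tT; split => //.
- exact: derN.
- by apply: (der_eq (derN h2)); rewrite normrN mulNr.
- by split => //; rewrite /En !sqrrN /Phi normrN sqrrN.
Qed.

Lemma bump y z Q dQ t0 : orbit y z Q dQ -> 1 / 2 <= `|y t0| -> t0 / 9 + bumpC <= T ->
  exists s t1, [/\ t0 < s, s < t1, t1 <= t0 / 9 + bumpC, y s = 0 & 1 / 2 <= `|y t1|].
Proof.
have pos y' z' : orbit y' z' Q dQ -> 1 / 2 <= y' t0 -> t0 / 9 + bumpC <= T ->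
    exists s t1, [/\ t0 < s, s < t1, t1 <= t0 / 9 + bumpC, y' s = 0 & 1 / 2 <= `|y' t1|].
  move=> o yt tT; have [||||||s [t1 [h1 h2 h3 h4 h5]]] := @bump_pos y' z' Q dQ _ _ _ _ _ _ t0 yt tT;
    try by move=> t /o [? ? ? ? []].
  by exists s, t1; split => //; rewrite ler0_norm; lra.
move=> o; case: (leP 0 (y t0)) => y0; first by rewrite ger0_norm//; exact: pos o.
rewrite ltr0_norm// => yt tT.
have [s [t1 [h1 h2 h3 h4 h5]]] := pos _ _ (orbit_opp o) yt tT.
exists s, t1; split => //; first by apply/eqP; rewrite -oppr_eq0 h4.
by rewrite -normrN.
Qed.

(** Each bump costs one application of t -> t / 9 + bumpC. Pulling [T] back k times through this map
    gives a starting time early enough for k zeros. *)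
Lemma many_zeros k : exists s, forall y z Q dQ t0, orbit y z Q dQ -> t0 <= s ->
  1 / 2 <= `|y t0| -> zeros k y t0 T.
Proof.
elim: k => [|k [s hs]]; first by exists 0.
exists (9 * (Num.min s T - bumpC)) => y z Q dQ t0 o t0s yt0.
have m1 : Num.min s T <= s by rewrite ge_min lexx.
have m2 : Num.min s T <= T by rewrite ge_min lexx orbT.
have h : t0 / 9 + bumpC <= Num.min s T by rewrite -lerBrDr ler_pdivrMr// mulrC.
have [x [t1 [h1 h2 h3 h4 h5]]] := bump o yt0 (le_trans h m2).
exists x; split => //; first lra.
apply: (zeros_mono (ltW h2) (lexx _)); apply: (hs y z Q dQ) => //; lra.
Qed.

End Bump.

(** * Emden-Fowler variables *)

Section Oscillation.
Variables (R : realType) (N : nat) (lam : R).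
Hypothesis N7 : (7 <= N)%N.
Local Notation n := (N%:R : R).
Hypothesis lam_lo : n * (n - 2) / 4 < lam.
Hypothesis lam_hi : lam < ((n - 1) / 2) ^+ 2.
Local Notation q := (4 / (n - 2)).
Local Notation f := (nonlin lam q).
Local Notation c := ((n - 2) / 2).
Local Notation mu := (lam - n * (n - 2) / 4).

Lemma zeros_map k (y v : R -> R) (xi_em : R -> R) (lo hi : R) :
  (forall s t, lo <= s -> s < t -> t <= hi -> xi_em s < xi_em t) ->
  (forall t, lo < t < hi -> y t = 0 -> v (xi_em t) = 0) -> lo <= hi ->
  zeros k y lo hi -> zeros k v (xi_em lo) (xi_em hi).
Proof.
move=> mono; elim: k lo mono => [//|k ih] lo mono yv lohi [z [z1 z2 yz hz]].
exists (xi_em z); split; [exact: mono (ltW z2)|by apply: mono => //; exact: ltW| |].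
  by apply: yv => //; rewrite z1.
apply: ih => //; last exact: ltW.
  by move=> s t zs; apply: mono; lra.
by move=> t tz; apply: yv; lra.
Qed.

(* Emden-Fowler time: [exp t] is the Euclidean distance to the origin. *)
Definition emden_T : R := ln (1 / 9) / 2.
(** This is cosh r - 1 at Euclidean distance exp t from the origin. Stopping at [emden_T], that is
    at distance 1/3, gives [sinh2 <= 9 / 16], which keeps the perturbation [mu * sinh2] below
    3/16. *)
Definition xi_em (t : R) : R := 2 * expR (2 * t) / (1 - expR (2 * t)).

Lemma emden_T_le0 : emden_T <= 0.
Proof. by rewrite /emden_T pmulr_lle0 ?invr_gt0// ln_le0//; lra. Qed.

Lemma exp_emden_T t : t <= emden_T -> 0 < expR (2 * t) <= 1 / 9.
Proof.
move=> h; rewrite expR_gt0 /=; have <- : expR (2 * emden_T) = 1 / 9.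
  have -> : 2 * emden_T = ln (1 / 9) by rewrite /emden_T; field.
  by rewrite lnK// posrE; lra.
by rewrite ler_expR ler_pM2l.
Qed.

Lemma sinh2_xi_em t : t <= emden_T -> sinh2 (xi_em t) = 4 * expR (2 * t) / (1 - expR (2 * t)) ^+ 2.
Proof.
move=> /exp_emden_T; set e := expR _ => he; rewrite /sinh2 /xi_em -/e; field.
by rewrite subr_eq0 eq_sym; lra.
Qed.

Lemma xi_em_gt0 t : t <= emden_T -> 0 < xi_em t.
Proof. by move=> /exp_emden_T he; rewrite divr_gt0 ?mulr_gt0 ?expR_gt0//; lra. Qed.

Lemma xi_em_der t : t <= emden_T -> has_deriv xi_em t (sinh2 (xi_em t)).
Proof.
move=> tT; have he := exp_emden_T tT; rewrite (sinh2_xi_em tT).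
have dE : has_deriv (fun t => expR (2 * t)) t (2 * expR (2 * t)).
  by apply: (der_eq (der_comp (is_derive_expR _) (derM (derC t 2) (derI t)))); ring.
have n0 : 1 - expR (2 * t) != 0 by rewrite gt_eqF//; lra.
apply: (der_eq (derM (derM (derC t 2) dE) (derV (f := fun t => 1 - expR (2 * t)) n0 (derB (derC t 1) dE)))).
by field.
Qed.

Lemma xi_em_mono s t : s < t -> t <= emden_T -> xi_em s < xi_em t.
Proof.
move=> st tT; have sT : s <= emden_T by lra.
have hs := exp_emden_T sT; have ht := exp_emden_T tT.
have : expR (2 * s) < expR (2 * t) by rewrite ltr_expR ltr_pM2l.
move: hs ht; rewrite /xi_em; set a := expR (2 * s); set b := expR (2 * t) => hs ht ab.
rewrite -subr_gt0; have -> : 2 * b / (1 - b) - 2 * a / (1 - a) = 2 * (b - a) / ((1 - b) * (1 - a)).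
  by field; rewrite !gt_eqF//; lra.
by apply: divr_gt0; apply: mulr_gt0; lra.
Qed.

Lemma mu_lt : mu < 1 / 4. Proof. by have := lam_hi; nra. Qed.

Lemma sinhN2_powR x : 0 < x -> sinhN2 N x = (sinh2 x `^ (c / 2)) ^+ 2.
Proof.
move=> x0; have P0 := sinh2_gt0 x0.
have -> : (sinh2 x `^ (c / 2)) ^+ 2 = sinh2 x `^ (2^-1 * (n - 2)).
  have p0 := powR_ge0 (sinh2 x) (c / 2).
  by rewrite -(powR_mulrn 2 p0) -powRrM; congr (_ `^ _); field.
have -> : n - 2 = (N - 2)%:R :> R by rewrite natrB// (leq_trans _ N7).
by rewrite powRrM powR12_sqrt ?(ltW P0)// powR_mulrn ?sqrtr_ge0.
Qed.

(** Emden-Fowler substitution y = sinh(r)^c v. Since [c / 2 * q = 1], one has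
    [|y| ^ q = sinh2 * |v| ^ q], which makes the equation autonomous up to [Q = mu * sinh2]; [En]
    becomes the Pohozaev quantity, hence is positive. The constant [8 * mu] comes from
    [sinh2 >= 4 * expR (2 t)]. *)
Lemma orbit_sol a v d : a != 0 -> sol N f a v d ->
  orbit c q (8 * mu) emden_T (fun t => sinh2 (xi_em t) `^ (c / 2) * v (xi_em t))
   (fun t => sinh2 (xi_em t) `^ (c / 2) * (c * (xi_em t + 1) * v (xi_em t) + sinh2 (xi_em t) * d (xi_em t)))
   (fun t => mu * sinh2 (xi_em t)) (fun t => mu * (2 * (xi_em t + 1) * sinh2 (xi_em t))).
Proof.
move=> a0 s t tT; have h := n7 R N7; have mu0 := mu_gt0 lam_lo; have mu1 := mu_lt.
have x0 := xi_em_gt0 tT; have P0 := sinh2_gt0 x0; have dx := xi_em_der tT.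
have [_ dv _] := s; have dd := sol_der2 N7 s x0.
have dP : has_deriv (fun t => sinh2 (xi_em t)) t (2 * (xi_em t + 1) * sinh2 (xi_em t)).
  exact: der_comp (sinh2_der (xi_em t)) dx.
pose kap t := sinh2 (xi_em t) `^ (c / 2).
have k0 : 0 < kap t by rewrite powR_gt0.
have dk : has_deriv kap t (c * (xi_em t + 1) * kap t).
  have dp : has_deriv (fun x : R => x `^ (c / 2)) (sinh2 (xi_em t)) (c / 2 * sinh2 (xi_em t) `^ (c / 2 - 1)).
    exact: is_derive1_powR.
  have dk0 := @der_comp R (fun x => x `^ (c / 2)) (fun t => sinh2 (xi_em t)) _ _ _ dp dP.
  apply: (der_eq dk0).
  by rewrite /kap [in RHS](powR_pred _ P0); field.
have dvx : has_deriv (fun t => v (xi_em t)) t (d (xi_em t) * sinh2 (xi_em t)) by exact: der_comp (dv _) dx.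
have ddx := der_comp dd dx.
have q0 := q_gt0 R N7.
have absy : `|kap t * v (xi_em t)| `^ q = sinh2 (xi_em t) * `|v (xi_em t)| `^ q.
  rewrite normrM (gtr0_norm k0) powRM ?(ltW k0)// /kap -powRrM.
  have -> : c / 2 * q = 1 by field; rewrite gt_eqF//; lra.
  by rewrite powRr1// ltW.
split.
- by apply: (der_eq (derM dk dvx)); rewrite -/(kap t); ring.
- apply: (der_eq (derM dk (derD (derM (derM (derC t c) (derD dx (derC t 1))) dvx) (derM dP ddx)))).
  rewrite -/(kap t) absy /nonlin /phi; set p := `|v (xi_em t)| `^ q; set K := kap t.
  set x := xi_em t in x0 P0 *; have -> : sinh2 x = x * (x + 2) by [].
  by field; rewrite !gt_eqF//; lra.
- by apply: (der_eq (derM (derC t mu) dP)); ring.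
- have he := exp_emden_T tT; rewrite mulr_ge0 ?(ltW mu0) ?(ltW P0)//=.
  have : sinh2 (xi_em t) <= 9 / 16.
    rewrite sinh2_xi_em// ler_pdivrMr; last by rewrite exprn_gt0//; lra.
    by set e := expR _ in he *; nra.
  nra.
- split.
    have he := exp_emden_T tT.
    have : 4 * expR (2 * t) <= sinh2 (xi_em t).
      rewrite sinh2_xi_em// ler_pdivlMr; last by rewrite exprn_gt0//; lra.
      by set e := expR _ in he *; nra.
    move=> h1; have h2 : sinh2 (xi_em t) <= (xi_em t + 1) * sinh2 (xi_em t) by nra.
    have := ler_wpM2l (ltW mu0) h1; have := ler_wpM2l (ltW mu0) h2; lra.
  have := pohozaev_gt0 N7 lam_lo s a0 x0; congr (0 < _).
  rewrite /pohozaev /En -/(kap t).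
  have -> : sinhN2 N (xi_em t) = kap t ^+ 2.
    by apply: sinhN2_powR.
  rewrite /Phi absy; set p := `|v (xi_em t)| `^ q; set K := kap t; set x := xi_em t; set P := sinh2 x.
  by field; rewrite !gt_eqF//; lra.
Qed.

Lemma nonlin_prim_le_abs (s t : R) : nonlin_prim lam q s <= nonlin_prim lam q t -> `|s| <= `|t|.
Proof.
have q0 := q_gt0 R N7; have l := lam_gt0 N7 lam_lo.
rewrite leNgt => h; rewrite leNgt; apply/negP => ts; move/negP: h; apply.
rewrite /nonlin_prim ltr_leD//.
  rewrite ltr_pM2r ?invr_gt0// ltr_pM2l// -[t ^+ 2]real_normK ?num_real//.
  by rewrite -[s ^+ 2]real_normK ?num_real// ltr_pXn2r ?nnegrE.
rewrite /Phi ler_wpM2r//; first by rewrite invr_ge0; lra.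
apply: ler_pM; rewrite ?powR_ge0 ?sqr_ge0//; first by rewrite le_powq// ltW.
by rewrite -[t ^+ 2]real_normK ?num_real// -[s ^+ 2]real_normK ?num_real// le_exp// ltW.
Qed.

(** The length a^(-q) is the natural concentration scale. The energy gives [|v| <= a], hence
    [|d| <= 2 a^q a / n], so over that length [v] changes by at most 2 a / n, which is below a /
    2. *)
Lemma sol_start a v d : 1 <= a -> lam <= a `^ q -> sol N f a v d ->
  forall x, 0 <= x -> x <= (a `^ q)^-1 -> a / 2 <= v x.
Proof.
move=> a1 la s x x0 xa; have h := n7 R N7; have q0 := q_gt0 R N7; have l := lam_gt0 N7 lam_lo.
have ap : 0 < a `^ q by rewrite powR_gt0//; lra.
have [v0 dv ld] := s.
have va y : 0 <= y -> `|v y| <= a.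
  move=> y0; have -> : a = `|a| by rewrite ger0_norm//; lra.
  apply: nonlin_prim_le_abs; have := energy_mono N7 s (lexx _) y0.
  rewrite /energy {2}/sinh2 mul0r !mul0r add0r v0; apply: le_trans.
  by rewrite lerDr divr_ge0// mulr_ge0 ?sinh2_ge0// sqr_ge0.
have hf y : 0 <= y -> `|- f (v y)| <= 2 * (a `^ q * a) * expR (0 * y).
  move=> y0; rewrite mul0r expR0 mulr1 normrN /nonlin /phi.
  have -> : lam * v y + `|v y| `^ q * v y = (lam + `|v y| `^ q) * v y by ring.
  rewrite normrM ger0_norm; last by rewrite addr_ge0 ?powR_ge0// ltW.
  rewrite mulrA; apply: ler_pM => //; first by rewrite addr_ge0 ?powR_ge0// ltW.
    have : `|v y| `^ q <= a `^ q by rewrite le_powq// va.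
    lra.
  exact: va.
have hd := lin_bound N7 (lexx _) ld hf.
move: x0; rewrite le_eqVlt => /predU1P[<-|x0]; first by rewrite v0; lra.
have cv y : 0 <= y <= x -> {for y, continuous v} by move=> _; exact: der_cont (dv y).
have [y /andP[y0 yx] e] := MVT_itv x0 cv (fun y _ => dv y).
have := hd y (ltW y0); rewrite mul0r expR0 mulr1 => dy.
move: e; rewrite v0 subr0 => e.
have : `|v x - a| <= a / 2.
  rewrite e normrM (gtr0_norm x0); apply: (@le_trans _ _ (2 * (a `^ q * a) / n * (a `^ q)^-1)).
    by apply: ler_pM => //; exact: ltW.
  have -> : 2 * (a `^ q * a) / n * (a `^ q)^-1 = 2 * a / n by field; rewrite !gt_eqF//; lra.
  by rewrite ler_pdivrMr; nra.
by rewrite ler_norml; lra.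
Qed.

Local Ltac prune := clear -N7 lam_lo lam_hi.
Local Ltac lra0 := prune; lra.

(** At x1 = a^(-q) one has [v >= a / 2] and [sinh2 x1 ^ (c / 2) >= 1 / a], so the Emden-Fowler orbit
    has size at least 1/2 there. The corresponding time tends to minus infinity as [a] grows, and
    [many_zeros] applies. *)
Lemma oscillation k : exists2 A : R, 0 < A & forall a v d, A <= a -> sol N f a v d ->
  exists hi, zeros k v 0 hi.
Proof.
have h := n7 R N7; have q0 := q_gt0 R N7; have l := lam_gt0 N7 lam_lo.
have mu0 := mu_gt0 lam_lo.
have c52 : 5 / 2 <= c by lra.
have mu8 : 0 < 8 * mu by rewrite mulr_gt0.
have [s hs] := many_zeros c52 q0 mu8 emden_T_le0 k.
(* From [a ^ q >= B] follow [a >= 1], [a ^ q >= lam], and [expR (2 t0) <= a^(-q) <= expR (2 *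
   Num.min s emden_T)], so the starting time is early enough. *)
pose B := lam + 1 + expR (- (2 * Num.min s emden_T)).
have eB := expR_gt0 (- (2 * Num.min s emden_T)).
have B0 : 1 < B by rewrite /B; lra.
exists (B `^ q^-1); first by rewrite powR_gt0; lra.
move=> a v d Aa so.
have Ba : B <= a `^ q.
  have -> : B = (B `^ q^-1) `^ q by rewrite -powRrM mulVf ?gt_eqF// powRr1//; lra.
  by rewrite le_powq// powR_ge0.
have a1 : 1 <= a.
  apply: le_trans Aa; have E1 : (1 : R) `^ q^-1 = 1 by rewrite powR1.
  by rewrite -[leLHS]E1; apply: le_powq; [rewrite invr_gt0|lra|lra].
have la : lam <= a `^ q by apply: le_trans Ba; rewrite /B; move: l eB; lra0.
have ap : 0 < a `^ q by move: la l; lra0.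
pose x1 := (a `^ q)^-1; have x10 : 0 < x1 by rewrite invr_gt0.
pose t0 := ln (x1 / (x1 + 2)) / 2.
have et0 : expR (2 * t0) = x1 / (x1 + 2).
  have -> : 2 * t0 = ln (x1 / (x1 + 2)) by rewrite /t0; field.
  by rewrite lnK// posrE divr_gt0//; move: x10; lra0.
have t0m : t0 <= Num.min s emden_T.
  rewrite -(@ler_pM2l _ 2)// -ler_expR et0; apply: (@le_trans _ _ x1).
    by rewrite ler_pdivrMr; move: x10; prune; nra.
  rewrite -[expR (2 * _)]invrK -expRN /x1 lef_pV2 ?posrE//.
  by apply: le_trans Ba; rewrite /B; move: l eB; lra0.
have t0s : t0 <= s by apply: le_trans t0m _; rewrite ge_min lexx.
have t0T : t0 <= emden_T by apply: le_trans t0m _; rewrite ge_min lexx orbT.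
have xt0 : xi_em t0 = x1.
  by rewrite /xi_em et0; field; rewrite !gt_eqF//; move: x10; lra0.
have an0 : a != 0 by rewrite gt_eqF//; move: a1; lra0.
have o := orbit_sol an0 so.
have y0 : 1 / 2 <= `|sinh2 (xi_em t0) `^ (c / 2) * v (xi_em t0)|.
  rewrite xt0; have vx := sol_start a1 la so (ltW x10) (lexx _).
  have P1 : x1 <= sinh2 x1 by rewrite /sinh2; move: x10; prune; nra.
  have P2 : a^-1 <= sinh2 x1 `^ (c / 2).
    have -> : a^-1 = x1 `^ (c / 2).
      rewrite /x1 -powRN -powRrM; have -> : - q * (c / 2) = -1 by field; rewrite gt_eqF//; move: h; lra0.
      by rewrite powR_inv1//; move: a1; lra0.
    by rewrite le_powq//; [by move: c52; lra0|exact: ltW].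
  have a0 : 0 < a by move: a1; lra0.
  apply: le_trans (ler_norm _); apply: (@le_trans _ _ (a^-1 * (a / 2))).
    by have -> : a^-1 * (a / 2) = 1 / 2 by field; rewrite gt_eqF.
  have p1 : 0 <= a^-1 by rewrite invr_ge0 ltW.
  have p2 : 0 <= a / 2 by move: a0; lra0.
  exact: ler_pM p1 p2 P2 vx.
have hz := hs _ _ _ _ _ o t0s y0.
exists (xi_em emden_T); apply: (@zeros_mono _ _ _ (xi_em t0) (xi_em emden_T)) => //.
  by rewrite xt0 ltW.
apply: zeros_map hz => //.
- by move=> u t _; exact: xi_em_mono.
- move=> t /andP[_ tT] /eqP; rewrite mulf_eq0 => /orP[|/eqP //].
  by rewrite gt_eqF// powR_gt0// sinh2_gt0// xi_em_gt0// ltW.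
Qed.

End Oscillation.

(** * Fast decaying profiles *)

Section Profiles.
Variables (R : realType) (N : nat) (lam : R).
Hypothesis N7 : (7 <= N)%N.
Local Notation n := (N%:R : R).
Hypothesis lam_lo : n * (n - 2) / 4 < lam.
Hypothesis lam_hi : lam < ((n - 1) / 2) ^+ 2.
Local Notation q := (4 / (n - 2)).
Local Notation f := (nonlin lam q).
Local Notation b := ((n - 1) / 2 + (((n - 1) / 2) ^+ 2 - lam)).

Lemma sol_family (V D : R -> R -> R) : (forall a, sol N f a (V a) (D a)) ->
  forall a T e : R, 0 < e -> \forall a' \near a, forall x, 0 <= x <= T ->
    `|V a' x - V a x| < e /\ `|D a' x - D a x| < e.
Proof.
move=> s a T e e0.
have A0 : 0 <= `|a| + 1 by rewrite addr_ge0.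
have [C [K [C0 K0 dep]]] := sol_cont_dep N7 (lam_gt0 N7 lam_lo) (q_gt0 R N7) A0.
pose E := C * expR (K * T); have E0 : 0 < E by rewrite mulr_gt0 ?expR_gt0.
apply/near_dist; exists (Num.min 1 (e / E)); first by rewrite lt_min ltr01 divr_gt0.
move=> a'; rewrite lt_min => /andP[a1 ae] x /andP[x0 xT].
have aA : `|a| <= `|a| + 1 by rewrite lerDl.
have aA' : `|a'| <= `|a| + 1.
  have -> : a' = a + (a' - a) by ring.
  by apply: le_trans (ler_normD _ _) _; rewrite lerD2l ltW.
have [h1 h2] := dep a' a _ _ _ _ aA' aA (s a') (s a) x x0.
have lt_e : C * expR (K * x) * `|a' - a| < e.
  apply: (@le_lt_trans _ _ (E * `|a' - a|)).
    by rewrite ler_wpM2r// /E ler_pM2l// ler_expR ler_wpM2l.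
  by move: ae; rewrite ltr_pdivlMr// mulrC.
by split; [exact: le_lt_trans lt_e|exact: le_lt_trans lt_e].
Qed.

Lemma trapped_open (V D : R -> R -> R) a x0 : (forall a, sol N f a (V a) (D a)) ->
  trapped N lam (V a) (D a) x0 -> \forall a' \near a, trapped N lam (V a') (D a') x0.
Proof.
move=> s [x1 hH hw]; have fam := sol_family s.
have cV : {for a, continuous (fun a' => V a' x0)}.
  apply/cont_epsP => e e0; have /near_dist[r r0 hr] := fam a x0 e e0.
  by exists r => // a' /hr h; have [] := h x0 ltac:(lra).
have cD : {for a, continuous (fun a' => D a' x0)}.
  apply/cont_epsP => e e0; have /near_dist[r r0 hr] := fam a x0 e e0.
  by exists r => // a' /hr h; have [] := h x0 ltac:(lra).
have cH : {for a, continuous (fun a' => energy N lam (V a') (D a') x0)}.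
  apply: contD.
    apply: contM; last exact: contC.
    by apply: contM; [exact: contC|exact: contX].
  apply: (@cont_comp R _ (nonlin_prim lam q) (fun a' => V a' x0)) => //.
  exact: der_cont (nonlin_prim_der lam (q_gt0 R N7) _).
have cw : {for a, continuous (fun a' => V a' x0 * wtrap N lam (V a') (D a') x0)}.
  by apply: contM => //; apply: contD; apply: contM => //; exact: contC.
have [r1 r10 h1] := cont_lt cH hH; have [r2 r20 h2] := cont_gt cw hw.
apply/near_dist; exists (Num.min r1 r2); first by rewrite lt_min r10.
by move=> a'; rewrite lt_min => /andP[/h1 ? /h2 ?].
Qed.

Theorem radial_profiles (A : R) : exists a v d, [/\ A < a, 0 < a, sol N f a v d,
  exists2 x, 0 < x & v x < 0 &
  exists C, forall x, 0 <= x -> `|v x| <= C * (x + 1) `^ (- b) /\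
     `|d x| <= C * (x + 1) `^ (- b - 1)].
Proof.
have q0 := q_gt0 R N7; have l := lam_gt0 N7 lam_lo.
have [V hV] := choice (sol_exists N7 l q0); have [D s] := choice hV.
have dV a x : has_deriv (V a) x (D a x) by have [_ dv _] := s a.
have cD a : continuous (D a) by exact: sol_dcont (s a).
have cV a : continuous (V a) by exact: sol_cont (s a).
have fam := sol_family s.
(* One zero suffices for the change of sign, because zeros are simple. *)
have [A1 A10 osc1] := oscillation N7 lam_lo lam_hi 1.
pose a1 := Num.max A A1 + 1.
have a1A : A + 1 <= a1 by rewrite lerD2r le_max lexx.
have a1A1 : A1 + 1 <= a1 by rewrite lerD2r le_max lexx orbT.
suff [a [aa nt]] : exists a, a1 <= a /\ forall x, ~ trapped N lam (V a) (D a) x.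
  exists a, (V a), (D a); split => //; [lra|lra| |].
    have [hi [z [z0 zhi vz _]]] := osc1 a (V a) (D a) ltac:(lra) (s a).
    have an0 : a != 0 by rewrite gt_eqF//; lra.
    have dz := simple_zero N7 lam_lo (s a) an0 (ltW z0) vz.
    have [h [h0 hz neg]] := sign_change (dV a z) vz dz z0.
    have [vn|vp] := ltP (V a (z - h)) 0; first by exists (z - h) => //; lra.
    exists (z + h); first lra.
    by rewrite ltNge; apply/negP => vp'; move: neg; rewrite ltNge mulr_ge0.
  exact: (not_trapped_decay N7 lam_lo lam_hi (s a) nt).
apply: contrapT => H.
have tr a : a1 <= a -> exists x, trapped N lam (V a) (D a) x.
  move=> aa; apply: contrapT => H'; apply: H; exists a; split => // x t.
  by apply: H'; exists x.
have simple a : a1 <= a -> forall z, 0 <= z -> V a z = 0 -> D a z != 0.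
  move=> aa z z0 vz; apply: (simple_zero N7 lam_lo (s a)) => //.
  by rewrite gt_eqF//; lra.
have Va0 a : V a 0 = a by have [] := s a.
have nz a x0 : trapped N lam (V a) (D a) x0 -> forall x, x0 <= x -> V a x <> 0.
  by move=> t x xx; apply/eqP; exact: (trapped_nz N7 lam_lo lam_hi (s a) t xx).
pose Q k a := exists hi, zeros k (V a) 0 hi.
(* The zeros of a trapped solution all precede the trapping point, and nearby solutions are trapped
   at the same point. So no zero can escape to infinity, and a count on the half-line is a count on
   a fixed segment. *)
have Qtr k a x0 : trapped N lam (V a) (D a) x0 -> Q k a -> zeros k (V a) 0 x0.
  move=> t [hi]; apply: zeros_le; first exact: nz t.
  by have [x1 _ _] := t; lra.
have Qop k a : a1 <= a -> Q k a -> \forall a' \near a, Q k a'.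
  move=> aa [hi hz]; have hi1 : 0 < Num.max hi 1 by rewrite lt_max ltr01 orbT.
  have hz' : zeros k (V a) 0 (Num.max hi 1).
    by apply: (zeros_mono _ _ hz) => //; rewrite le_max lexx.
  have := zeros_open dV fam (simple a aa) (lexx _) hi1 hz'.
  by apply: filterS => a' h; exists (Num.max hi 1).
have Qcl k a : a1 <= a -> ~ Q k a -> \forall a' \near a, ~ Q k a'.
  move=> aa nQ; have [x0 t] := tr a aa; have [x1 _ _] := t.
  have va0 : V a 0 != 0 by rewrite Va0 gt_eqF//; lra.
  have vx0 : V a x0 != 0 by apply/eqP; exact: (nz a x0 t x0 (lexx _)).
  have nzk : ~ zeros k (V a) 0 x0 by move=> h; apply: nQ; exists x0.
  have x00 : 0 < x0 by lra.
  have N1 := zeros_closed dV cD fam (simple a aa) (lexx _) x00 va0 vx0 nzk.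
  have N2 := trapped_open s t.
  apply: (@near3 R a _ _ _ (fun a' => ~ Q k a') _ N1 N2 N2) => a' n1 n2 _ hq.
  exact: n1 (Qtr _ _ _ n2 hq).
have Qall k : Q k a1.
  apply: contrapT => nQ.
  have [Ak Ak0 osck] := oscillation N7 lam_lo lam_hi k.
  pose a := Num.max a1 Ak.
  have h1 : a1 <= a by rewrite le_max lexx.
  have h2 : Ak <= a by rewrite le_max lexx orbT.
  exact: (clopen_interval (Qop k) (Qcl k) nQ h1) (osck a (V a) (D a) h2 (s a)).
have [x0 t] := tr a1 (lexx _); have [x1 _ _] := t.
have x00 : 0 < x0 by lra.
have [k hk] := finite_zeros x00 (@cV a1) (@cD a1) (dV a1) (simple a1 (lexx _)).
exact: hk (Qtr _ _ _ t (Qall k)).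
Qed.

End Profiles.

(** * Iterated integrals *)

Section OneDim.
Variable R : realType.
Local Notation mu := (@lebesgue_measure R).

(** The integral of a nonnegative function is a supremum over the simple functions below it, hence
    monotone for arbitrary functions. Iterated integrals can therefore be compared without tracking
    measurability of the inner ones. *)
Lemma le_integral_pos (f g : R -> \bar R) : (forall t, (0 <= f t)%E) ->
  (forall t, (f t <= g t)%E) ->
  (\int[mu]_(t in [set: R]) f t <= \int[mu]_(t in [set: R]) g t)%E.
Proof.
move=> f0 fg; have g0 t : (0 <= g t)%E by exact: le_trans (f0 t) (fg t).
rewrite !ge0_integralE//; apply: ereal_sup_le => _ [h hf <-]; exists h => // x.
by apply: le_trans (hf x) _; rewrite !patchE; case: ifP.
Qed.

Definition int1 (h : R -> R) : R := \int[mu]_(t in `[-1, 1]) h t.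

Lemma int1_integrable (h : R -> R) : continuous h -> mu.-integrable `[-1, 1] (EFin \o h).
Proof.
move=> ch; apply: continuous_compact_integrable; first exact: segment_compact.
exact: continuous_subspaceT.
Qed.

Lemma int1B (h k : R -> R) : continuous h -> continuous k ->
  int1 (fun t => h t - k t) = int1 h - int1 k.
Proof. by move=> ch ck; apply: RintegralB => //; exact: int1_integrable. Qed.

Lemma measure_segment : mu `[-1, 1]%classic = 2%:E.
Proof.
rewrite lebesgue_measure_itv /= lte_fin; have -> : (-1 < 1 :> R) = true by lra.
by rewrite -EFinD; congr (_%:E); lra.
Qed.

Lemma int1_bound (h : R -> R) (B : R) : continuous h ->
  (forall t, `|h t| <= B) -> `|int1 h| <= 2 * B.
Proof.
move=> ch hB; apply: le_trans (le_normr_Rintegral _ (int1_integrable ch)) _ => //.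
have -> : 2 * B = \int[mu]_(t in `[-1, 1]) B.
  by rewrite Rintegral_cst// mulrC; congr (_ * _); exact: esym (congr1 fine measure_segment).
apply: le_Rintegral => //.
- by apply: int1_integrable => t; apply: cont_norm; exact: ch.
- by apply: int1_integrable => t; exact: contC.
Qed.

Lemma int1_0 : int1 (fun=> 0) = 0.
Proof. by rewrite /int1 Rintegral_cst// mul0r. Qed.

Lemma int1_ge0 (h : R -> R) : (forall t, 0 <= h t) -> 0 <= int1 h.
Proof. by move=> h0; apply: Rintegral_ge0. Qed.

Lemma int1_integral (h : R -> R) : continuous h -> (forall t, 0 <= h t) ->
  (forall t, 1 <= `|t| -> h t = 0) ->
  (\int[mu]_(t in [set: R]) (h t)%:E = (int1 h)%:E)%E.
Proof.
move=> ch h0 hs; have ci := int1_integrable ch.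
have -> : (\int[mu]_(t in [set: R]) (h t)%:E = \int[mu]_(t in [set` `[(-1)%R, 1%R] ]) (h t)%:E)%E.
  rewrite [RHS]integral_mkcond; apply: eq_integral => t _; rewrite patchE.
  case: ifPn => //; rewrite notin_setE /= in_itv /= => /negP; rewrite -ler_norml -ltNge.
  by move=> /ltW /hs ->.
by rewrite /int1 /Rintegral fineK//; apply: integrable_fin_num.
Qed.

Lemma int1_deriv (H g : R -> R) : continuous g -> (forall t, has_deriv H t (g t)) ->
  H 1 = 0 -> H (-1) = 0 -> int1 g = 0.
Proof.
move=> cg dH H1 Hm1; have cH t : {for t, continuous H} by exact: der_cont (dH t).
have := @continuous_FTC2 R g H (-1) 1.
rewrite /int1 /Rintegral => -> //; first by rewrite H1 Hm1 -EFinD subrr.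
- exact: continuous_subspaceT.
- split.
  + by move=> t _; have [] := dH t.
  + by apply: cvg_at_right_filter; exact: cH.
  + by apply: cvg_at_left_filter; exact: cH.
- by move=> t _; rewrite derive1E; have [_ ->] := dH t.
Qed.

End OneDim.

(** * Divergence theorem for iterated integrals *)

Section Iterated.
Variable R : realType.
Implicit Types (g h : (nat -> R) -> R) (y : nat -> R) (k : nat).

Lemma iter_int_ge0 k (g : (nat -> R) -> \bar R) : (forall y, (0 <= g y)%E) ->
  (0 <= iter_int k g)%E.
Proof. by elim: k g => [|k ih] g g0 //=; apply: integral_ge0 => t _; exact: ih. Qed.

Lemma le_iter_int k (g h : (nat -> R) -> \bar R) : (forall y, (0 <= g y)%E) ->
  (forall y, (g y <= h y)%E) -> (iter_int k g <= iter_int k h)%E.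
Proof.
elim: k g h => [|k ih] g h g0 gh //=; apply: le_integral_pos => t.
  by apply: iter_int_ge0.
by apply: ih => y.
Qed.

Definition upd (k : nat) (t : R) y : nat -> R := fun i => if i == k then t else y i.

(* The functions of the coordinates [y 0], ..., [y k.-1] to which [iter_int] is
   applied; those integrals are real numbers, computed by [iint] on [-1, 1]^k. *)
Record unif_supp (k : nat) (g : (nat -> R) -> R) : Prop := UnifSupp {
  uc_cont : forall e : R, 0 < e -> exists2 r : R, 0 < r &
    forall y y', (forall i, (i < k)%N -> `|y i - y' i| < r) -> `|g y - g y'| < e;
  uc_supp : forall y i, (i < k)%N -> 1 <= `|y i| -> g y = 0;
  uc_bound : exists B : R, forall y, `|g y| <= B }.

Fixpoint iint k g : R :=
  if k is k'.+1 then int1 (fun t => iint k' (fun y => g (upd k' t y))) else g (fun=> 0).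

Lemma unif_supp_slice k g t : unif_supp k.+1 g -> unif_supp k (fun y => g (upd k t y)).
Proof.
move=> [hc hs [B hB]]; split.
- move=> e /hc[r r0 hr]; exists r => // y y' yy; apply: hr => i ik'; rewrite /upd.
  case: eqP => [_|/eqP ik]; first by rewrite subrr normr0.
  by apply: yy; rewrite ltn_neqAle ik -ltnS.
- move=> y i ik yi; apply: (hs _ i); first by rewrite ltnS ltnW.
  by rewrite /upd ltn_eqF.
- by exists B.
Qed.

Lemma unif_suppB k g h : unif_supp k g -> unif_supp k h -> unif_supp k (fun y => g y - h y).
Proof.
move=> [gc gs [B gB]] [hc hs [C hC]]; split.
- move=> e e0; have e2 : 0 < e / 2 by lra.
  have [r r0 hr] := gc _ e2; have [s s0 hss] := hc _ e2.
  exists (Num.min r s); first by rewrite lt_min r0.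
  move=> y y' yy.
  have h1 : `|g y - g y'| < e / 2.
    by apply: hr => i ik; apply: lt_le_trans (yy i ik) _; rewrite ge_min lexx.
  have h2 : `|h y - h y'| < e / 2.
    by apply: hss => i ik; apply: lt_le_trans (yy i ik) _; rewrite ge_min lexx orbT.
  have -> : g y - h y - (g y' - h y') = (g y - g y') - (h y - h y') by ring.
  by apply: le_lt_trans (ler_normB _ _) _; lra.
- by move=> y i ik yi; rewrite (gs y i)// (hs y i)// subrr.
- by exists (B + C) => y; apply: le_trans (ler_normB _ _) _; rewrite lerD.
Qed.

Lemma unif_supp_lip k g (F : R -> R) : F 0 = 0 -> (forall s t, `|F s - F t| <= `|s - t|) ->
  unif_supp k g -> unif_supp k (fun y => F (g y)).
Proof.
move=> F0 lip [gc gs [B gB]]; split.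
- move=> e /gc[r r0 hr]; exists r => // y y' /hr; exact: le_lt_trans.
- by move=> y i ik yi; rewrite (gs y i).
- by exists B => y; have := lip (g y) 0; rewrite F0 !subr0 => /le_trans; apply.
Qed.

Lemma unif_supp0 k : unif_supp k (fun=> 0).
Proof.
split; [|by []|by exists 0 => y; rewrite normr0].
by move=> e e0; exists 1 => // y y' _; rewrite subrr normr0.
Qed.

(** The three facts support each other: additivity and the bound at level k make slices of level k +
    1 continuous, and continuous slices are integrable, which gives additivity and the bound at
    level k + 1. *)
Lemma iint_main k :
  (forall g h, unif_supp k g -> unif_supp k h -> iint k (fun y => g y - h y) = iint k g - iint k h) /\
  (forall g B, unif_supp k g -> (forall y, `|g y| <= B) -> `|iint k g| <= 2 ^+ k * B) /\
  (forall g, unif_supp k.+1 g -> continuous (fun t => iint k (fun y => g (upd k t y)))).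
Proof.
have cont m : (forall g h, unif_supp m g -> unif_supp m h -> iint m (fun y => g y - h y) = iint m g - iint m h) ->
    (forall g B, unif_supp m g -> (forall y, `|g y| <= B) -> `|iint m g| <= 2 ^+ m * B) ->
    forall g, unif_supp m.+1 g -> continuous (fun t => iint m (fun y => g (upd m t y))).
  move=> iintB Jb g ug t; apply/cont_epsP => e e0.
  have p0 : 0 < (2 : R) ^+ m by rewrite exprn_gt0.
  have ep : 0 < e / 2 ^+ m / 2 by rewrite !divr_gt0.
  have [r r0 hr] := uc_cont ug ep; exists r => // s st.
  rewrite -iintB; [|exact: unif_supp_slice|exact: unif_supp_slice].
  apply: (@le_lt_trans _ _ (2 ^+ m * (e / 2 ^+ m / 2))); last first.
    by rewrite mulrA mulrCA divff ?gt_eqF// mulr1; lra.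
  apply: Jb; first by apply: unif_suppB; exact: unif_supp_slice.
  move=> y; apply: ltW; apply: hr => i _; rewrite /upd; case: eqP => // _.
  by rewrite subrr normr0.
elim: k => [|k [iintB [Jb Jc]]].
  have iintB0 g h : unif_supp 0 g -> unif_supp 0 h -> iint 0 (fun y => g y - h y) = iint 0 g - iint 0 h by [].
  have Jb0 g B : unif_supp 0 g -> (forall y, `|g y| <= B) -> `|iint 0 g| <= 2 ^+ 0 * B.
    by move=> _ gB; rewrite expr0 mul1r; exact: gB.
  by split => //; split => //; exact: cont.
have iintBS g h : unif_supp k.+1 g -> unif_supp k.+1 h ->
    iint k.+1 (fun y => g y - h y) = iint k.+1 g - iint k.+1 h.
  move=> ug uh /=; rewrite -int1B; [|exact: Jc|exact: Jc].
  by congr int1; apply/funext => t; rewrite iintB//; exact: unif_supp_slice.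
have JbS g B : unif_supp k.+1 g -> (forall y, `|g y| <= B) -> `|iint k.+1 g| <= 2 ^+ k.+1 * B.
  move=> ug gB /=; rewrite exprS -mulrA; apply: int1_bound; first exact: Jc.
  by move=> t; apply: Jb => //; exact: unif_supp_slice.
by split => //; split => //; exact: cont.
Qed.

Lemma iintB k g h : unif_supp k g -> unif_supp k h -> iint k (fun y => g y - h y) = iint k g - iint k h.
Proof. by have [+ _] := iint_main k; apply. Qed.

Lemma iint_bound k g B : unif_supp k g -> (forall y, `|g y| <= B) -> `|iint k g| <= 2 ^+ k * B.
Proof. by have [_ [+ _]] := iint_main k; apply. Qed.

Lemma iint_slice_cont k g : unif_supp k.+1 g -> continuous (fun t => iint k (fun y => g (upd k t y))).
Proof. by have [_ [_ +]] := iint_main k; apply. Qed.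

Lemma iint0 k : iint k (fun=> 0) = 0.
Proof. by elim: k => [//|k ih] /=; rewrite ih int1_0. Qed.

Lemma iint_ge0 k g : (forall y, 0 <= g y) -> 0 <= iint k g.
Proof. by elim: k g => [|k ih] g g0 //=; apply: int1_ge0 => t; exact: ih. Qed.

Lemma iint_slice_supp k g t : unif_supp k.+1 g -> 1 <= `|t| -> iint k (fun y => g (upd k t y)) = 0.
Proof.
move=> ug t1; rewrite -(iint0 k); congr iint; apply/funext => y.
by apply: (uc_supp ug (i := k)) => //; rewrite /upd eqxx.
Qed.

Lemma iter_int_iint k g : unif_supp k g -> (forall y, 0 <= g y) ->
  iter_int k (fun y => (g y)%:E) = (iint k g)%:E.
Proof.
elim: k g => [//|k ih] g ug g0 /=.
rewrite -int1_integral; first last.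
- by move=> t; exact: iint_slice_supp.
- by move=> t; exact: iint_ge0.
- exact: iint_slice_cont.
by apply: eq_integral => t _; rewrite -ih//; exact: unif_supp_slice.
Qed.


Lemma unif_suppZ k c g : unif_supp k g -> unif_supp k (fun y => c * g y).
Proof.
move=> [gc gs [B gB]]; have c1 : 0 < `|c| + 1 by apply: ltr_wpDl.
split.
- move=> e e0; have [r r0 hr] := gc _ (divr_gt0 e0 c1); exists r => // y y' /hr.
  rewrite -mulrBr normrM ltr_pdivlMr// mulrC; apply: le_lt_trans.
  by rewrite ler_wpM2r// lerDl.
- by move=> y i ik yi; rewrite (gs y i)// mulr0.
- by exists (`|c| * B) => y; rewrite normrM ler_wpM2l.
Qed.

Lemma iintZ k c g : unif_supp k g -> iint k (fun y => c * g y) = c * iint k g.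
Proof.
elim: k g => [//|k ih] g ug /=.
rewrite /int1 -RintegralZl//; last exact/int1_integrable/iint_slice_cont.
by apply: eq_Rintegral => t _; rewrite ih//; exact: unif_supp_slice.
Qed.

Lemma unif_suppD k g h : unif_supp k g -> unif_supp k h -> unif_supp k (fun y => g y + h y).
Proof.
move=> ug uh; have := unif_suppB ug (unif_suppB (unif_supp0 k) uh).
by congr unif_supp; apply/funext => y; rewrite sub0r opprK.
Qed.

Lemma iintD k g h : unif_supp k g -> unif_supp k h -> iint k (fun y => g y + h y) = iint k g + iint k h.
Proof.
move=> ug uh; have uN := unif_suppB (unif_supp0 k) uh.
have <- : iint k (fun y => g y - (0 - h y)) = iint k (fun y => g y + h y).
  by congr iint; apply/funext => y; rewrite sub0r opprK.
by rewrite (iintB ug uN) (iintB (unif_supp0 k) uh) iint0 sub0r opprK.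
Qed.

Lemma iint_sum0 k (I : finType) (P : pred I) (g : I -> (nat -> R) -> R) :
  (forall i, unif_supp k (g i)) -> (forall i, iint k (g i) = 0) ->
  unif_supp k (fun y => \sum_(i | P i) g i y) /\ iint k (fun y => \sum_(i | P i) g i y) = 0.
Proof.
move=> ug g0; elim: index_enum => [|i s [us js]].
  have -> : (fun y => \sum_(i <- [::] | P i) g i y) = fun=> 0.
    by apply/funext => y; rewrite big_nil.
  by split; [exact: unif_supp0|exact: iint0].
case Pi : (P i); last first.
  have -> : (fun y => \sum_(i0 <- i :: s | P i0) g i0 y)
      = (fun y => \sum_(i0 <- s | P i0) g i0 y).
    by apply/funext => y; rewrite big_cons Pi.
  by [].
have -> : (fun y => \sum_(i0 <- i :: s | P i0) g i0 y)
      = (fun y => g i y + \sum_(i0 <- s | P i0) g i0 y).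
  by apply/funext => y; rewrite big_cons Pi.
by split; [exact: unif_suppD|rewrite iintD// g0 js addr0].
Qed.

(** Partial differentiability in coordinate [i], uniform in all the others, so that it passes under
    the inner integrals. *)
Definition unif_deriv i h g := forall e : R, 0 < e -> exists2 r : R, 0 < r &
  forall c y, `|c| < r -> `|h (upd i (y i + c) y) - h y - c * g y| <= `|c| * e.

Lemma upd_id i y : upd i (y i) y = y.
Proof. by apply/funext => j; rewrite /upd; case: eqP => [->|]. Qed.

Lemma updU i t t' y : upd i t (upd i t' y) = upd i t y.
Proof. by apply/funext => j; rewrite /upd; case: eqP. Qed.

Lemma updC i k t t' y : i != k -> upd i t (upd k t' y) = upd k t' (upd i t y).
Proof.
by move=> ik; apply/funext => j; rewrite /upd; case: eqP => // ->; rewrite (negbTE ik).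
Qed.

Lemma upd_eq i t y : upd i t y i = t. Proof. by rewrite /upd eqxx. Qed.

(** Outer coordinates are frozen until [i] is the outermost one. Then the inner integral of [h] is
    differentiated under the integral sign and vanishes at both ends of [-1, 1]. The order of
    integration is never changed. *)
Lemma iint_deriv k i g h : unif_supp k g -> unif_supp k h -> (i < k)%N -> unif_deriv i h g -> iint k g = 0.
Proof.
elim: k i g h => // k ih i g h ug uh ik du.
have [ik'|ik'] := boolP (i == k); last first.
  rewrite -[RHS](int1_0 R) /=; congr int1; apply/funext => t.
  have lik : (i < k)%N by rewrite ltn_neqAle ik' -ltnS.
  apply: (ih i _ (fun y => h (upd k t y))) => //; [exact: unif_supp_slice|exact: unif_supp_slice|].
  move=> e /du[r r0 hr]; exists r => // c y /hr => /(_ (upd k t y)).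
  by rewrite updC// /upd (negbTE ik').
move/eqP: ik' => ik'; subst k; rewrite /=.
apply: (@int1_deriv _ (fun t => iint i (fun y => h (upd i t y)))).
- exact: iint_slice_cont.
- move=> t; apply/der_epsP => e e0.
  have p0 : 0 < (2 : R) ^+ i by rewrite exprn_gt0.
  have e1 : 0 < e / 2 ^+ i / 2 by rewrite !divr_gt0.
  have [r r0 hr] := du _ e1; exists r => // c c0 cr.
  have ut s : unif_supp i (fun y => h (upd i s y)) by exact: unif_supp_slice.
  have gt s : unif_supp i (fun y => g (upd i s y)) by exact: unif_supp_slice.
  have -> : (iint i (fun y => h (upd i (t + c) y)) - iint i (fun y => h (upd i t y))) / c
       - iint i (fun y => g (upd i t y)) =
      iint i (fun y => h (upd i (t + c) y) - h (upd i t y) - c * g (upd i t y)) / c.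
    rewrite iintB; [|exact: unif_suppB|exact: unif_suppZ].
    by rewrite iintB// iintZ// [RHS]mulrBl [c * _]mulrC mulfK.
  rewrite normrM normfV ltr_pdivrMr ?normr_gt0//.
  apply: (@le_lt_trans _ _ (2 ^+ i * (`|c| * (e / 2 ^+ i / 2)))); last first.
    have -> : 2 ^+ i * (`|c| * (e / 2 ^+ i / 2)) = e * `|c| / 2 by field; rewrite gt_eqF.
    by have : 0 < e * `|c| by [rewrite mulr_gt0 ?normr_gt0]; lra.
  apply: iint_bound; first by apply: unif_suppB; [exact: unif_suppB|exact: unif_suppZ].
  by move=> y; have := hr c (upd i t y) cr; rewrite updU upd_eq.
- by apply: iint_slice_supp => //; rewrite normr1.
- by apply: iint_slice_supp => //; rewrite normrN normr1.
Qed.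

Lemma unif_derivP k i g h : unif_supp k g -> (i < k)%N ->
  (forall y, has_deriv (fun t => h (upd i t y)) (y i) (g y)) -> unif_deriv i h g.
Proof.
move=> ug ik dh e e0; have [r r0 hr] := uc_cont ug e0; exists r => // c y cr.
have dh' t : has_deriv (fun t => h (upd i t y)) t (g (upd i t y)).
  by have := dh (upd i t y); rewrite upd_eq; congr has_deriv; apply/funext => s; rewrite updU.
have close t : `|t - y i| <= `|c| -> `|g (upd i t y) - g y| <= e.
  move=> tc; apply/ltW/hr => j _; rewrite /upd; case: eqP => [->|_].
    exact: le_lt_trans cr.
  by rewrite subrr normr0.
have [->|c0] := eqVneq c 0.
  by rewrite addr0 upd_id subrr mul0r subr0 normr0 mul0r.
suff [z zc ->] : exists2 z, `|z - y i| <= `|c| &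
    h (upd i (y i + c) y) - h y = g (upd i z y) * c.
  by rewrite mulrC -mulrBr normrM ler_wpM2l// close.
have ct t : {for t, continuous (fun t => h (upd i t y))} by exact: der_cont (dh' t).
have [cp|cn] := ltP 0 c.
  have lt : y i < y i + c by lra.
  have [z /andP[z1 z2] hz] := MVT_itv lt (fun x _ => ct x) (fun x _ => dh' x).
  exists z; first by rewrite !ger0_norm; lra.
  by move: hz; rewrite upd_id => ->; congr (_ * _); ring.
have cn' : c < 0 by rewrite lt_neqAle c0.
have lt : y i + c < y i by lra.
have [z /andP[z1 z2] hz] := MVT_itv lt (fun x _ => ct x) (fun x _ => dh' x).
exists z; first by rewrite !ler0_norm; lra.
move: hz; rewrite upd_id => hz.
by rewrite -[LHS]opprB hz -mulrN; congr (_ * _); ring.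
Qed.

End Iterated.

(** * Functions on the ball in coordinates *)

Section RowVectors.
Variables (R : realType) (N : nat).
Local Notation V := 'rV[R]_N.
Implicit Types (x : V) (F : V -> R) (y : nat -> R).

Definition row_of y : V := \row_(i < N) y (nat_of_ord i).

Lemma row_norm_lt x (r : R) : 0 < r -> (forall i, `|x ord0 i| < r) -> `|x| < r.
Proof.
move=> r0 h; rewrite /Num.norm /= mx_normrE; apply/bigmax_ltP; split => // -[i j] _ /=.
by rewrite (ord1 i).
Qed.

Lemma cont_coord (i : 'I_N) : continuous (fun x : V => x ord0 i).
Proof. exact: coord_continuous. Qed.

Lemma cont_sum (T : topologicalType) (I : Type) (s : seq I) (f : I -> T -> R) (x : T) :
  (forall i, {for x, continuous (f i)}) ->
  {for x, continuous (fun z => \sum_(i <- s) f i z)}.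
Proof.
move=> cf; elim: s => [|i s ih].
  by apply: (cont_ext _ (@contC R T 0 x)); near=> y; rewrite big_nil.
by apply: cont_ext _ (contD (cf i) ih); near=> y; rewrite big_cons.
Unshelve. all: by end_near.
Qed.

Lemma near_gt (T : topologicalType) (f : T -> R) (x : T) (c : R) :
  {for x, continuous f} -> c < f x -> \forall y \near x, c < f y.
Proof.
move=> cf cx; have e0 : 0 < f x - c by lra.
have /cvgrPdist_lt/(_ _ e0) := cf; apply: filterS => y.
by move/(le_lt_trans (ler_norm _)) => h; lra.
Qed.

Lemma cont_sqn : continuous (@sqn R N).
Proof.
move=> x; apply: (@cont_sum V _ _ (fun i z => z ord0 i ^+ 2)) => i.
apply: (@contX R V (fun z => z ord0 i)); exact: cont_coord.
Qed.

Lemma sqn_ge0 x : 0 <= sqn x.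
Proof. by apply: sumr_ge0 => i _; exact: sqr_ge0. Qed.

Lemma coord_le_sqn x (i : 'I_N) : x ord0 i ^+ 2 <= sqn x.
Proof. by rewrite /sqn (bigD1 i)//= lerDl sumr_ge0// => j _; exact: sqr_ge0. Qed.

Lemma row_ofE y (i : 'I_N) : row_of y ord0 i = y i.
Proof. by rewrite mxE. Qed.

Lemma ge1_sqn y i : (i < N)%N -> 1 <= `|y i| -> 1 <= sqn (row_of y).
Proof.
move=> iN yi; apply: le_trans (coord_le_sqn _ (Ordinal iN)).
by rewrite row_ofE /= -real_normK ?num_real// expr_ge1.
Qed.

Lemma row_of_upd (i : 'I_N) t y :
  row_of (upd i t y) = row_of y + (t - y i) *: delta_mx ord0 i.
Proof.
apply/rowP => j; rewrite !mxE /upd /= (eq_sym j) -val_eqE /= eq_sym.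
by case: (@eqP nat i j) => [<-|_]; [rewrite mulr1 addrC subrK|rewrite mulr0 addr0].
Qed.

Definition ball_supp F := exists2 r : R, r < 1 & forall x, r <= sqn x -> F x = 0.

Lemma ball_supp_out F x : ball_supp F -> 1 <= sqn x -> F x = 0.
Proof. by move=> [r r1 h] x1; apply: h; apply: le_trans x1; exact: ltW. Qed.

Lemma cont_glue F : ball_supp F -> (forall x, sqn x < 1 -> {for x, continuous F}) ->
  continuous F.
Proof.
move=> [r r1 h] cF x; have [/cF//|x1] := ltP (sqn x) 1.
have nx : \forall y \near x, r < sqn y.
  by apply: near_gt; [exact: cont_sqn|exact: lt_le_trans x1].
apply: (cont_ext _ (@contC R V 0 x)); near=> y; rewrite h//.
by apply: ltW; near: y.
Unshelve. all: by end_near.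
Qed.

Lemma unif_supp_row F : continuous F -> ball_supp F -> unif_supp N (fun y => F (row_of y)).
Proof.
move=> cF sF.
(* The cube is larger than [-1, 1]^N by a margin 1: if [y] lies outside it and [y'] is within 1 of
   [y], both have a coordinate of size at least 1, and both values vanish. *)
pose K := [set x : V | forall i, `[-2, 2]%classic (x ord0 i)].
have cI (i : 'I_N) : compact (`[-2, 2]%classic : set R) by exact: segment_compact.
have cK : compact K by exact: rV_compact cI.
have outK y : ~ K (row_of y) -> exists2 i, (i < N)%N & 2 < `|y i|.
  apply: contra_notP => H i; rewrite row_ofE /= in_itv /= -ler_norml leNgt.
  by apply/negP => yi; apply: H; exists i.
split.
- move=> e e0; have [r r0 hr] := heine cK (fun x _ => cF x) e0.
  exists (Num.min r 1); first by rewrite lt_min r0 ltr01.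
  move=> y y' yy; have [Ky|/outK[i iN yi]] := pselect (K (row_of y)).
    rewrite distrC; apply: hr => //; apply: row_norm_lt => // i.
    rewrite !mxE distrC; apply: lt_le_trans (yy i (ltn_ord i)) _.
    by rewrite ge_min lexx.
  have y1 : 1 <= `|y i| by lra.
  have y2 : 1 <= `|y' i|.
    have h1 : `|y i - y' i| < 1 by apply: lt_le_trans (yy i iN) _; rewrite ge_min lexx orbT.
    by have := ler_normD (y i - y' i) (y' i); rewrite subrK; lra.
  by rewrite (ball_supp_out sF (ge1_sqn iN y1)) (ball_supp_out sF (ge1_sqn iN y2)) subrr normr0.
- by move=> y i iN yi; rewrite (ball_supp_out sF)//; exact: ge1_sqn yi.
- have : compact [set F x | x in K] by apply: continuous_compact => //; exact: continuous_subspaceT.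
  move=> /compact_bounded[B [_ hB]]; exists (Num.max (B + 1) 0) => y.
  have [Ky|/outK[i iN yi]] := pselect (K (row_of y)).
    by rewrite le_max (hB (B + 1)) ?ltrDl//; exists (row_of y).
  rewrite (ball_supp_out sF); first by rewrite normr0 le_max lexx orbT.
  by apply: ge1_sqn iN _; lra.
Qed.

Lemma upd_row_of (i : 'I_N) y t : row_of (upd i (y i + t) y) = t *: delta_mx ord0 i + row_of y.
Proof. by rewrite row_of_upd [y i + t]addrC addrK addrC. Qed.

Lemma has_deriv_derive (i : 'I_N) F y (d : R) :
  has_deriv (fun t => F (row_of (upd i t y))) (y i) d <->
  is_derive (row_of y) (delta_mx ord0 i : V) F d.
Proof.
have E : (fun h : R => h^-1 *: (((fun t => F (row_of (upd i t y))) \o shift (y i)) (h *: (1 : R))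
      - F (row_of (upd i (y i) y))))
   = (fun h : R => h^-1 *: ((F \o shift (row_of y)) (h *: (delta_mx ord0 i : V)) - F (row_of y))).
  apply/funext => h; congr (_ *: (_ - _)) => /=; last by rewrite upd_id.
  by rewrite -upd_row_of; congr (F (row_of (upd i _ y))); rewrite addrC /GRing.scale /= mulr1.
split=> -[].
- by rewrite /derivable E => dF; rewrite /derive E => <-; split.
- by rewrite /derivable -E => dF; rewrite /derive -E => <-; split.
Qed.

Lemma sqn_upd (i : 'I_N) t y :
  sqn (row_of (upd i t y)) = sqn (row_of y) - y i ^+ 2 + t ^+ 2.
Proof.
rewrite /sqn (bigD1 i)//= [X in _ = X - _ + _](bigD1 i)//= !row_ofE upd_eq.
have -> : \sum_(j < N | j != i) row_of (upd i t y) ord0 j ^+ 2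
        = \sum_(j < N | j != i) row_of y ord0 j ^+ 2.
  by apply: eq_bigr => j ji; rewrite !row_ofE /upd -val_eqE in ji *; rewrite (negbTE ji).
by ring.
Qed.

Lemma sqn_der (i : 'I_N) y :
  has_deriv (fun t => sqn (row_of (upd i t y))) (y i) (2 * y i).
Proof.
have E : (fun t => sqn (row_of (upd i t y))) = (fun t => (sqn (row_of y) - y i ^+ 2) + t ^+ 2).
  by apply/funext => t; exact: sqn_upd.
rewrite E; apply: der_eq (derD (derC _ _) (derX 2 (derI _))) _.
by rewrite /=; ring.
Qed.

End RowVectors.

(** * Smooth radial functions *)

Section Smooth.
Variable R : realType.
Implicit Types (f g d : R -> R) (x c : R).

Fixpoint Cn (k : nat) f : Prop :=
  if k is k'.+1 then exists2 d, (forall x, has_deriv f x (d x)) & Cn k' d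
  else continuous f.

Definition smooth f := forall k, Cn k f.

Lemma Cn_S k f : Cn k.+1 f -> Cn k f.
Proof.
elim: k f => [|k ih] f [d df Cd]; first by move=> x; exact: der_cont (df x).
by exists d => //; exact: ih.
Qed.

Lemma CnC k c : Cn k (fun=> c).
Proof.
elim: k c => [|k ih] c; first by move=> x; exact: contC.
by exists (fun=> 0) => // x; exact: derC.
Qed.

Lemma CnD k f g : Cn k f -> Cn k g -> Cn k (fun x => f x + g x).
Proof.
elim: k f g => [|k ih] f g; first by move=> /= cf cg x; exact: contD (cf x) (cg x).
by move=> [d df Cd] [e dg Ce]; exists (fun x => d x + e x); [move=> x; exact: derD|exact: ih].
Qed.

Lemma CnM k f g : Cn k f -> Cn k g -> Cn k (fun x => f x * g x).
Proof.
elim: k f g => [|k ih] f g; first by move=> /= cf cg x; exact: contM (cf x) (cg x).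
move=> Cf Cg; have [Cf' Cg'] := (Cn_S Cf, Cn_S Cg).
move: Cf Cg => [d df Cd] [e dg Ce]; exists (fun x => d x * g x + f x * e x).
  by move=> x; exact: derM.
by apply: CnD; exact: ih.
Qed.

Lemma Cn_aff k f c e : Cn k f -> Cn k (fun x => f (c * x + e)).
Proof.
elim: k f => [|k ih] f.
  move=> /= cf x; apply: (@cont_comp R _ f (fun x => c * x + e)); last exact: cf.
  by apply: contD; [apply: contM; [exact: contC|exact: contI]|exact: contC].
move=> [d df Cd]; exists (fun x => d (c * x + e) * c); last by apply: CnM; [exact: ih|exact: CnC].
move=> x; apply: der_comp; first exact: df.
by apply: der_eq (derD (derM (derC _ c) (derI _)) (derC _ e)) _; rewrite mul0r add0r mulr1 addr0.
Qed.

Lemma smooth_prim f d : (forall x, has_deriv f x (d x)) -> smooth d -> smooth f.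
Proof. by move=> df sd [|k]; [move=> x; exact: der_cont (df x)|exists d]. Qed.

Lemma smooth_deriv f : smooth f -> exists2 d, (forall x, has_deriv f x (d x)) & smooth d.
Proof.
move=> sf; have [d df _] := sf 1%N; exists d => // k.
have [e de Ce] := sf k.+1; suff -> : d = e by [].
by apply/funext => x; exact: der_uniq (df x) (de x).
Qed.

(* All derivatives of [exp(-1/x)] are combinations of these functions. *)
Definition rexp (j : nat) x : R := if 0 < x then x ^- j * expR (- x^-1) else 0.

Lemma expR_ge_pow (y : R) (m : nat) : 0 <= y -> y ^+ m <= m%:R ^+ m * expR y.
Proof.
move=> y0; case: m => [|m]; first by rewrite !expr0 mul1r -expR0 ler_expR.
have m0 : 0 < m.+1%:R :> R by rewrite ltr0n.
have -> : expR y = expR (y / m.+1%:R) ^+ m.+1.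
  by rewrite -expRM_natr mulrAC -mulrA divff ?gt_eqF// mulr1.
rewrite -exprMn; apply: lerXn2r; rewrite ?nnegrE// ?mulr_ge0 ?expR_ge0 ?ler0n//.
rewrite [leRHS]mulrC -ler_pdivrMr//; apply: le_trans (expR_ge1Dx _); rewrite lerDr; exact: ler01.
Qed.

Lemma rexp_norm j x : `|rexp j x| <= j.+1%:R ^+ j.+1 * `|x|.
Proof.
rewrite /rexp; have [x0|x0] := ltP 0 x; last by rewrite normr0 mulr_ge0 ?exprn_ge0.
have xV : 0 < x^-1 by rewrite invr_gt0.
rewrite ger0_norm; last by rewrite mulr_ge0 ?expR_ge0 ?invr_ge0 ?exprn_ge0 ?(ltW x0).
rewrite (gtr0_norm x0) expRN ler_pdivrMr ?expR_gt0//.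
have := expR_ge_pow j.+1 (ltW xV); rewrite exprS -exprVn => h.
have -> : (x^-1) ^+ j = x * (x^-1 * x^-1 ^+ j) by rewrite mulrA divff ?gt_eqF// mul1r.
by rewrite mulrAC [leRHS]mulrC ler_pM2l.
Qed.

Lemma rexp_der0 j : has_deriv (rexp j) 0 0.
Proof.
apply/der_epsP => e e0; set K := j.+2%:R ^+ j.+2 : R.
have K0 : 0 < K by rewrite exprn_gt0.
exists (e / K); first by rewrite divr_gt0.
move=> h h0 hlt; rewrite add0r [rexp j 0]/rexp ltxx !subr0.
have -> : rexp j h / h = rexp j.+1 h.
  rewrite /rexp; case: ifP => _; last by rewrite mul0r.
  by rewrite exprSr invfM; ring.
apply: le_lt_trans (rexp_norm _ _) _; rewrite -/K mulrC -ltr_pdivlMr//.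
Qed.

Lemma rexp_der j x : has_deriv (rexp j) x (- j%:R * rexp j.+1 x + rexp j.+2 x).
Proof.
have [x0|x0|x0] := ltgtP x 0; last by rewrite x0 /rexp ltxx mulr0 addr0; exact: rexp_der0.
- apply: der_eq (der_ext _ (derC x 0)) _; last first.
    by rewrite /rexp ltNge (ltW x0) mulr0 addr0.
  near=> y; rewrite /rexp; case: ltP => // y0.
  suff : y < 0 by rewrite ltNge ltW.
  by near: y; exact: lt_nbhsl.
- have xn : x != 0 by rewrite gt_eqF.
  have xjn : x ^+ j != 0 by rewrite expf_neq0.
  have dV := derV xn (derI x).
  have dj : has_deriv (fun y : R => (y ^+ j)^-1) x _ := derV (f := fun y : R => y ^+ j) xjn (derX j (derI x)).
  have de := der_comp (is_derive_expR _) (derN dV).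
  apply: der_eq (der_ext _ (derM dj de)) _; last first.
    rewrite /rexp x0.
    by case: j xjn {dj} => [|j] xjn; rewrite !exprS ?expr0 /=; field; rewrite xn ?expf_neq0.
  near=> y; rewrite /rexp ifT//; near: y; exact: lt_nbhsr.
Unshelve. all: by end_near.
Qed.

Lemma rexp_smooth j : smooth (rexp j).
Proof.
move=> k; elim: k j => [|k ih] j; first by move=> x; exact: der_cont (rexp_der j x).
eexists; first exact: rexp_der.
by apply: CnD; [apply: CnM; [exact: CnC|exact: ih]|exact: ih].
Qed.

(** The primitive of exp(-1/x) exp(-1/(1 - x)), extended by 0 outside (0, 1) and divided by its
    value at 1. *)
Lemma smooth_step : exists2 f : R -> R, smooth f &
  [/\ forall x, x <= 0 -> f x = 0, forall x, 1 <= x -> f x = 1 & forall x, 0 <= f x <= 1].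
Proof.
pose th x := rexp 0 x * rexp 0 (-1 * x + 1).
have sth : smooth th.
  by move=> k; apply: CnM; [exact: rexp_smooth|apply: Cn_aff; exact: rexp_smooth].
have rexp0 j x : x <= 0 -> rexp j x = 0 by rewrite /rexp ltNge => ->.
have rexpp x : 0 < x -> 0 < rexp 0 x by move=> x0; rewrite /rexp x0 mulr_gt0 ?expR_gt0 ?invr_gt0.
have rexp_ge x : 0 <= rexp 0 x.
  by have [/rexp0 ->//|/rexpp /ltW] := leP x 0.
have th0 x : x <= 0 -> th x = 0 by move=> x0; rewrite /th rexp0// mul0r.
have th1 x : 1 <= x -> th x = 0 by move=> x0; rewrite /th [X in _ * X]rexp0 ?mulr0//; lra.
have th_ge x : 0 <= th x by rewrite mulr_ge0.
have [F F0 dF] := primitive (sth 0%N : continuous th).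
have cF x : {for x, continuous F} by exact: der_cont (dF x).
have F1 : 0 < F 1.
  have [c /andP[c0 c1]] := MVT_itv ltr01 (fun x _ => cF x) (fun x _ => dF x).
  rewrite F0 !subr0 mulr1 => ->; rewrite mulr_gt0 ?rexpp//; lra.
have Fmono a b : a <= b -> F a <= F b.
  by move=> ab; apply: (der_ge0_le ab (fun x _ => cF x) (fun x _ => dF x)).
have Fl x : x <= 0 -> F x = 0.
  move=> x0; rewrite -F0; apply: (der0_eq x0) => y /andP[_ /th0 <-]; exact: dF.
have Fr x : 1 <= x -> F x = F 1.
  move=> x0; apply/esym; apply: (der0_eq x0) => y /andP[/th1 <- _]; exact: dF.
exists (fun x => F x * (F 1)^-1).
  by move=> k; apply: CnM; [exact: smooth_prim dF sth k|exact: CnC].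
split=> x; first by move/Fl => ->; rewrite mul0r.
- by move/Fr => ->; rewrite divff ?gt_eqF.
- rewrite divr_ge0 ?(ltW F1)//=; last first.
    by have [/Fl ->//|/ltW/Fmono] := leP x 0; rewrite F0.
  rewrite ler_pdivrMr// mul1r; have [/Fr -> //|/ltW/Fmono //] := leP 1 x.
Qed.

(** Nodes of a fine subdivision of [0, T] are joined by rescaled smooth steps. On each cell the
    approximant is a convex combination of two node values, both within [e] of [k]; the last node
    value is [k T = 0], so the approximant vanishes exactly from T on. *)
Lemma smooth_approx (k : R -> R) (T e : R) : continuous k -> 0 < T ->
  (forall s, T <= s -> k s = 0) -> 0 < e ->
  exists2 q : R -> R, smooth q &
    (forall s, T <= s -> q s = 0) /\ (forall s, 0 <= s -> `|k s - q s| <= e).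
Proof.
move=> ck T0 kT e0; have [st sst [st0 st1 st01]] := smooth_step.
have [r r0 hr] := heine (@segment_compact R 0 T) (fun x _ => ck x) e0.
pose n := (Num.truncn (T / r)).+1; pose h := T / n%:R.
have n0 : 0 < n%:R :> R by rewrite ltr0n.
have h0 : 0 < h by rewrite divr_gt0.
have hlt : h < r.
  by rewrite /h ltr_pdivrMr// mulrC -ltr_pdivrMr// truncnS_gt.
have nh : n%:R * h = T by rewrite /h mulrC divfK ?gt_eqF.
have hkk s s' : 0 <= s' <= T -> `|s - s'| <= h -> `|k s - k s'| <= e.
  by move=> s'T ss'; apply/ltW/hr; rewrite ?in_itv//=; exact: le_lt_trans hlt.
suff main m : (m <= n)%N -> exists2 q : R -> R, smooth q &
    (forall s, m%:R * h <= s -> q s = k (m%:R * h)) /\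
    (forall s, 0 <= s <= m%:R * h -> `|k s - q s| <= e).
  have [q sq [q1 q2]] := main n (leqnn _); rewrite nh (kT T)// in q1 q2.
  exists q => //; split => // s s0; have [sT|sT] := leP s T; first by apply: q2; rewrite s0.
  by rewrite q1 ?kT ?subrr ?normr0; apply: ltW.
elim: m => [|m ih] mn.
  exists (fun=> k 0); first by move=> j; exact: CnC.
  rewrite mul0r; split => // s s0; have -> : s = 0 by apply/eqP; rewrite eq_le andbC.
  by rewrite subrr normr0 ltW.
have [q sq [q1 q2]] := ih (ltnW mn).
set xm := m%:R * h in q1 q2 *; set xm' := m.+1%:R * h.
have xm0 : 0 <= xm by rewrite mulr_ge0 ?(ltW h0).
have xmE : xm' = xm + h by rewrite /xm' -natr1 mulrDl mul1r.
have xmT : xm' <= T by rewrite -nh ler_pM2r// ler_nat.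
have argE s : h^-1 * s + (- xm / h) = (s - xm) / h by rewrite mulrBl mulrC mulNr.
exists (fun s => q s + (k xm' - k xm) * st (h^-1 * s + (- xm / h))).
  by move=> j; apply: CnD => //; apply: CnM; [exact: CnC|apply: Cn_aff].
split=> s.
  move=> ss; rewrite argE st1; last by rewrite ler_pdivlMr//; lra.
  by rewrite q1; [ring|lra].
move=> /andP[s0 s1]; rewrite argE; have [sx|sx] := leP s xm.
  rewrite st0 ?mulr0 ?addr0; first by apply: q2; rewrite s0.
  by rewrite pmulr_lle0 ?invr_gt0//; lra.
rewrite q1 ?(ltW sx)//; have /andP[t0 t1] := st01 ((s - xm) / h); set t := st _ in t0 t1 *.
have -> : k s - (k xm + (k xm' - k xm) * t) = (1 - t) * (k s - k xm) + t * (k s - k xm') by ring.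
have k1 : `|k s - k xm| <= e.
  apply: hkk; first by rewrite xm0 (le_trans _ xmT)// xmE lerDl ltW.
  by rewrite ger0_norm ?subr_ge0 ?(ltW sx)// lerBlDl -xmE.
have k2 : `|k s - k xm'| <= e.
  apply: hkk; first by rewrite xmT (le_trans s0).
  by rewrite distrC ger0_norm ?subr_ge0// lerBlDr xmE [h + s]addrC lerD2r ltW.
apply: le_trans (ler_normD _ _) _; rewrite !normrM (ger0_norm t0) (@ger0_norm _ (1 - t)); last lra.
have t1' : 0 <= 1 - t by lra.
have := ler_wpM2l t1' k1; have := ler_wpM2l t0 k2; lra.
Qed.

End Smooth.

(** * Radial test functions *)

Section RadialSmooth.
Variables (R : realType) (N : nat).
Local Notation V := 'rV[R]_N.
Implicit Types (x w : V) (F : V -> R).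

Lemma is_derive_line F x w (d : R) :
  has_deriv (fun h => F (h *: w + x)) 0 d -> is_derive x w F d.
Proof.
have E : (fun h : R => h^-1 *: (((fun h => F (h *: w + x)) \o shift 0) (h *: (1 : R))
      - F (0 *: w + x)))
   = (fun h : R => h^-1 *: ((F \o shift x) (h *: w) - F x)).
  apply/funext => h; have hA : h *: (1 : R) = h by rewrite /GRing.scale /= mulr1.
  by rewrite hA /= addr0 scale0r add0r.
move=> -[]; rewrite /derivable E => dF; rewrite /derive E => <-; split => //.
Qed.

Lemma edot_line x w u (h : R) : edot (h *: w + x) u = h * edot w u + edot x u.
Proof.
rewrite /edot big_distrr -big_split /=; apply: eq_bigr => i _.
by rewrite !mxE mulrDl mulrA.
Qed.

Lemma sqn_line x w (h : R) : sqn (h *: w + x) = sqn x + h * (2 * edot x w) + h ^+ 2 * sqn w.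
Proof.
rewrite /sqn /edot !big_distrr -!big_split /=; apply: eq_bigr => i _.
by rewrite !mxE; ring.
Qed.

Lemma edot_derive x w u : is_derive x w (fun z => edot z u) (edot w u).
Proof.
apply: is_derive_line.
have -> : (fun h : R => edot (h *: w + x) u) = (fun h => h * edot w u + edot x u).
  by apply/funext => h; exact: edot_line.
apply: der_eq (derD (derM (derI _) (derC _ _)) (derC _ _)) _; ring.
Qed.

Lemma radial_derive (f : R -> R) (d : R) x w : has_deriv f (sqn x) d ->
  is_derive x w (fun z => f (sqn z)) (d * (2 * edot x w)).
Proof.
move=> df; apply: is_derive_line.
have ds : has_deriv (fun h => sqn (h *: w + x)) 0 (2 * edot x w).
  have -> : (fun h : R => sqn (h *: w + x)) =
      (fun h => (sqn x + h * (2 * edot x w)) + h ^+ 2 * sqn w).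
    by apply/funext => h; exact: sqn_line.
  apply: der_eq (derD (derD (derC _ _) (derM (derI _) (derC _ _)))
    (derM (derX 2 (derI _)) (derC _ _))) _; rewrite /=; ring.
by apply: der_comp ds; rewrite scale0r add0r.
Qed.

Lemma edot_differentiable u x : differentiable (fun z : V => edot z u) x.
Proof.
have -> : (fun z : V => edot z u) = \sum_(i < N) (fun z : V => z ord0 i * u ord0 i).
  by apply/funext => z; rewrite fct_sumE.
apply: differentiable_sum => i.
by apply: differentiableM; [exact: differentiable_coord|exact: differentiable_cst].
Qed.

Lemma sqn_differentiable x : differentiable (@sqn R N) x.
Proof.
have -> : @sqn R N = \sum_(i < N) (fun z : V => z ord0 i * z ord0 i).
  by apply/funext => z; rewrite fct_sumE.
by apply: differentiable_sum => i; apply: differentiableM; exact: differentiable_coord.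
Qed.

Lemma radial_differentiable (f : R -> R) (d : R) x : has_deriv f (sqn x) d ->
  differentiable (fun z => f (sqn z)) x.
Proof.
move=> [df _]; apply: (@differentiable_comp _ _ _ _ (@sqn R N) f); first exact: sqn_differentiable.
exact/derivable1_diffP.
Qed.

(* A class of differentiable functions closed under directional derivatives. *)
Inductive smV : (V -> R) -> Prop :=
| smV_radial f of smooth f : smV (fun x => f (sqn x))
| smV_edot u : smV (fun x => edot x u)
| smV_cst (c : R) : smV (fun=> c)
| smV_add F G of smV F & smV G : smV (fun x => F x + G x)
| smV_mul F G of smV F & smV G : smV (fun x => F x * G x).

Lemma smV_differentiable F : smV F -> forall x, differentiable F x.
Proof.
elim=> [f sf|u|c|G H _ dG _ dH|G H _ dG _ dH] x.
- by have [d df _] := smooth_deriv sf; exact: radial_differentiable (df _).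
- exact: edot_differentiable.
- exact: differentiable_cst.
- by apply: differentiableD.
- by apply: differentiableM.
Qed.

Lemma smV_derive F w : smV F -> exists2 D, smV D & forall x, is_derive x w F (D x).
Proof.
elim=> [f sf|u|c|G H sG [D sD dG] sH [E sE dH]|G H sG [D sD dG] sH [E sE dH]].
- have [d df sd] := smooth_deriv sf; exists (fun x => d (sqn x) * (2 * edot x w)).
    apply: smV_mul; first exact: smV_radial.
    by apply: smV_mul; [exact: smV_cst|exact: smV_edot].
  by move=> x; exact: radial_derive (df _).
- exists (fun=> edot w u); first exact: smV_cst.
  by move=> x; exact: edot_derive.
- by exists (fun=> 0) => [|x]; [exact: smV_cst|exact: is_derive_cst].
- exists (fun x => D x + E x); first exact: smV_add.
  by move=> x; apply: is_deriveD.
- exists (fun x => G x * E x + H x * D x).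
    by apply: smV_add; apply: smV_mul.
  by move=> x; apply: is_deriveM.
Qed.

Lemma smV_iterD F vs : smV F -> smV (Defs.iterD vs F).
Proof.
move=> sF; elim: vs => [//|w vs /(smV_derive w)[D sD dD]] /=.
suff -> : 'D_w (Defs.iterD vs F) = D by [].
by apply/funext => x; have [_ ->] := dD x.
Qed.

Lemma Cc_inf_radial (f : R -> R) (T : R) : smooth f -> T < 1 ->
  (forall s, T <= s -> f s = 0) -> Cc_inf (fun x : V => f (sqn x)).
Proof.
move=> sf T1 fT; split; last by exists T; split => // x /fT.
by move=> vs x; apply: smV_differentiable; apply: smV_iterD; exact: smV_radial.
Qed.

Lemma egrad_radial (f : R -> R) (d : R) x : has_deriv f (sqn x) d ->
  egrad (fun z => f (sqn z)) x = (2 * d) *: x.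
Proof.
move=> df; apply/rowP => i; rewrite !mxE.
have [_ ->] := radial_derive (delta_mx ord0 i) df.
have -> : edot x (delta_mx ord0 i) = x ord0 i.
  rewrite /edot (bigD1 i)//= mxE !eqxx mulr1 big1 ?addr0// => j ji.
  by rewrite mxE (negbTE ji) mulr0.
by ring.
Qed.

End RadialSmooth.

(** * Integrability of powers of the conformal factor *)

Section Singular.
Variable R : realType.
Local Notation mu := (@lebesgue_measure R).
Implicit Types (f g G : R -> R) (r t B : R).

Lemma segment_FTC_le (s B : R) g G : 0 < s ->
  (forall t, `|t| <= s -> has_deriv G t (g t)) ->
  (forall t, `|t| <= s -> {for t, continuous g}) ->
  (forall t, `|t| <= s -> `|G t| <= B) ->
  (\int[mu]_(t in [set` `[(- s)%R, s] ]) (g t)%:E <= (2 * B)%:E)%E.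
Proof.
move=> s0 dG cg GB.
have in_s t : - s <= t <= s -> `|t| <= s by rewrite ler_norml.
have cG t : `|t| <= s -> {for t, continuous G} by move=> /dG; exact: der_cont.
have s1 : `|s| <= s by rewrite gtr0_norm.
have s2 : `|- s| <= s by rewrite normrN.
rewrite (@continuous_FTC2 R g G (- s) s) //.
- rewrite -EFinB lee_fin.
  by have := GB _ s1; have := GB _ s2; rewrite !ler_norml; lra.
- by lra.
- by apply: continuous_itv => t /in_s; exact: cg.
- split.
  + move=> t; rewrite in_itv /= => /andP[/ltW t1 /ltW t2].
    by have [] := dG t (in_s _ (introT andP (conj t1 t2))).
  + by apply: cvg_at_right_filter; exact: cG.
  + by apply: cvg_at_left_filter; exact: cG.
- move=> t; rewrite in_itv /= => /andP[/ltW t1 /ltW t2].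
  by rewrite derive1E; have [_ ->] := dG t (in_s _ (introT andP (conj t1 t2))).
Qed.

(** The integrand may blow up at both ends, so (-r, r) is exhausted by closed segments and monotone
    convergence is applied; only the primitive has to be bounded. *)
Lemma open_FTC_le (r B : R) g G : 0 < r ->
  (forall t, `|t| < r -> has_deriv G t (g t)) ->
  (forall t, `|t| < r -> {for t, continuous g}) ->
  (forall t, `|t| < r -> 0 <= g t) ->
  (forall t, `|t| < r -> `|G t| <= B) ->
  (\int[mu]_(t in [set: R]) (if (`|t| < r)%R then (g t)%:E else 0) <= (2 * B)%:E)%E.
Proof.
move=> r0 dG cg g0 GB.
pose s (k : nat) : R := r * (1 - k.+2%:R^-1).
have kV (k : nat) : 0 < (k.+2%:R^-1 : R) < 1.
  by rewrite invr_gt0 ltr0n /= invf_lt1 ?ltr0n// ltr1n.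
have s_gt0 k : 0 < s k by rewrite mulr_gt0// subr_gt0; have /andP[] := kV k.
have s_lt k : s k < r by have /andP[h1 _] := kV k; rewrite /s gtr_pMr// ltrBlDr ltrDl.
have s_mono k l : (k <= l)%N -> s k <= s l.
  move=> kl; rewrite ler_pM2l// lerD2l lerN2 lef_pV2 ?posrE ?ltr0n//.
  by rewrite ler_nat.
pose F k : set R := [set` `[(- s k), (s k)] ].
have FE k t : F k t = (`|t| <= s k) :> Prop by rewrite /F /= in_itv /= -ler_norml.
have Fin k t : F k t -> `|t| < r by rewrite FE => /le_lt_trans; apply.
have -> : (\int[mu]_(t in [set: R]) (if (`|t| < r)%R then (g t)%:E else 0)
     = \int[mu]_(t in \bigcup_k F k) (g t)%:E)%E.
  rewrite [RHS]integral_mkcond; apply: eq_integral => t _; rewrite patchE.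
  have [tr|tr] := ltP `|t| r; last first.
    rewrite memNset// => -[k _ /Fin]; rewrite ltNge tr //.
  rewrite mem_set//.
  have e0 : 0 < r / (r - `|t|) by rewrite divr_gt0// subr_gt0.
  exists (Num.truncn (r / (r - `|t|))) => //; rewrite FE /s; set k := Num.truncn _.
  have kr : r / (r - `|t|) < k.+2%:R.
    by apply: lt_le_trans (truncnS_gt _) _; rewrite ler_nat.
  have k0 : 0 < k.+2%:R :> R by rewrite ltr0n.
  move: kr; rewrite ltr_pdivrMr ?subr_gt0// => kr.
  have : r / k.+2%:R <= r - `|t| by rewrite ler_pdivrMr// mulrC ltW.
  by rewrite mulrBr mulr1 => h; rewrite lerBrDr -lerBrDl.
have Fm k l : (k <= l)%N -> (F k <= F l)%O.
  by move=> kl; apply/subsetPset => t; rewrite !FE => /le_trans; apply; exact: s_mono.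
have ig k : mu.-integrable (F k) (EFin \o g).
  apply: continuous_compact_integrable; first exact: segment_compact.
  by apply: continuous_itv => t tk; apply: cg; apply: (Fin k); rewrite FE ler_norml.
have g0' k t : F k t -> (0 <= (EFin \o g) t)%E by move=> /Fin tr; rewrite lee_fin g0.
have cv := @ge0_nondecreasing_set_cvg_integral _ (measurableTypeR R) R F (EFin \o g) mu Fm
  (fun k => measurable_itv _) (fun k => measurable_int mu (ig k)) g0'.
have <- := cvg_lim (@ereal_hausdorff R) cv; apply: lime_le; first by apply/cvg_ex; eexists; exact: cv.
near=> k; apply: (segment_FTC_le (G := G)) => // t tk.
- by apply: dG; exact: le_lt_trans (s_lt k).
- by apply: cg; exact: le_lt_trans (s_lt k).
- by apply: GB; exact: le_lt_trans (s_lt k).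
Unshelve. all: by end_near.
Qed.

(* Each integration lowers the exponent of the singularity by 1/2. *)
Lemma int_beta (a c rho : R) : 0 < a < 1 -> 0 <= c -> 0 < rho ->
  (\int[mu]_(t in [set: R]) (if (t ^+ 2 < rho)%R then (c * (rho - t ^+ 2) `^ (- a))%:E else 0)
   <= (4 / (1 - a) * c * rho `^ (2^-1 - a))%:E)%E.
Proof.
move=> /andP[a0 a1] c0 rho0; set r := Num.sqrt rho.
have r0 : 0 < r by rewrite sqrtr_gt0.
have rr : r ^+ 2 = rho by rewrite sqr_sqrtr// ltW.
have a1' : 0 < 1 - a by lra.
pose k := c * r `^ (- a).
have k0 : 0 <= k by rewrite mulr_ge0 ?powR_ge0.
(* In [rho - t ^+ 2 = (r + t) * (r - t)] one factor is at least [r], so its negative power is at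
   most [r ^ (- a)]; the sum covers both signs of t and has an explicit primitive. *)
pose g t : R := k * ((r + t) `^ (- a) + (r - t) `^ (- a)).
pose G t : R := k / (1 - a) * ((r + t) `^ (1 - a) - (r - t) `^ (1 - a)).
have rt t : `|t| < r -> 0 < r + t /\ 0 < r - t by rewrite ltr_norml; lra.
have dpow e t : 0 < r + t -> has_deriv (fun z => (r + z) `^ e) t (e * (r + t) `^ (e - 1)).
  move=> h; apply: der_eq (der_comp (g := fun z => r + z) (is_derive1_powR e h)
    (derD (derC _ _) (derI _))) _; ring.
have dpow' e t : 0 < r - t -> has_deriv (fun z => (r - z) `^ e) t (- (e * (r - t) `^ (e - 1))).
  move=> h; apply: der_eq (der_comp (g := fun z => r - z) (is_derive1_powR e h)
    (derB (derC _ _) (derI _))) _; ring.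
have aE : 1 - a - 1 = - a by ring.
have pos t : 0 < t -> forall e : R, 0 <= t `^ e by move=> *; exact: powR_ge0.
have fg t : t ^+ 2 < rho -> `|t| < r.
  by rewrite -rr => h; rewrite -(@ltr_pXn2r _ 2) ?nnegrE ?(ltW r0)// real_normK ?num_real.
have step : (4 / (1 - a) * c * rho `^ (2^-1 - a))%:E
   = (2 * (k / (1 - a) * (2 * r `^ (1 - a))))%:E.
  congr (_%:E); rewrite /k.
  have -> : rho `^ (2^-1 - a) = r `^ (- a) * r `^ (1 - a).
    rewrite -powRD ?(gt_eqF r0) ?implybT// -rr -powR_mulrn ?ltW// -powRrM.
    by congr (_ `^ _); field.
  by ring.
rewrite step; apply: le_trans (open_FTC_le (G := G) (g := g) r0 _ _ _ _).
- apply: le_integral_pos => t.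
    by case: ifP => // _; rewrite lee_fin mulr_ge0 ?powR_ge0.
  case: ifP => [/fg tr|_]; last first.
    case: ifP => // /rt[t1 t2]; rewrite lee_fin.
    by apply: mulr_ge0 => //; apply: addr_ge0; exact: powR_ge0.
  rewrite tr lee_fin /g /k -mulrA ler_wpM2l//.
  have [t1 t2] := rt _ tr.
  have -> : rho - t ^+ 2 = (r + t) * (r - t) by rewrite -rr; ring.
  rewrite powRM ?(ltW t1) ?(ltW t2)//.
  have dec s : r <= s -> s `^ (- a) <= r `^ (- a).
    move=> rs; rewrite !powRN lef_pV2 ?posrE ?powR_gt0// ?(lt_le_trans r0)//.
    by apply: ge0_ler_powR; rewrite ?nnegrE ?(ltW a0) ?(ltW r0) ?(le_trans (ltW r0)).
  have p1 := pos _ t1 (- a); have p2 := pos _ t2 (- a).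
  rewrite mulrDr; have [tp|tn] := leP 0 t.
    have d1 := dec (r + t) ltac:(by rewrite lerDl).
    apply: (@le_trans _ _ (r `^ (- a) * (r - t) `^ (- a))); first by rewrite ler_wpM2r.
    by rewrite lerDr mulr_ge0// powR_ge0.
  have d1 := dec (r - t) ltac:(by rewrite lerDl oppr_ge0 ltW).
  apply: (@le_trans _ _ ((r + t) `^ (- a) * r `^ (- a))); first by rewrite ler_wpM2l.
  by rewrite mulrC lerDl mulr_ge0// powR_ge0.
- move=> t /rt[t1 t2]; apply: der_eq (derM (derC _ _) (derB (dpow _ _ t1) (dpow' _ _ t2))) _.
  by rewrite aE /g; field; rewrite gt_eqF.
- move=> t /rt[t1 t2]; apply: contM; first exact: contC.
  by apply: contD; [exact: der_cont (dpow _ _ t1)|exact: der_cont (dpow' _ _ t2)].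
- by move=> t _; apply: mulr_ge0 => //; apply: addr_ge0; exact: powR_ge0.
- move=> t tr; have [t1 t2] := rt _ tr.
  have kk : 0 <= k / (1 - a) by rewrite divr_ge0// ltW.
  rewrite /G normrM (ger0_norm kk) ler_wpM2l//.
  have bnd s : 0 < s -> s <= 2 * r -> s `^ (1 - a) <= 2 * r `^ (1 - a).
    move=> s0 s2; apply: (@le_trans _ _ ((2 * r) `^ (1 - a))).
      by apply: ge0_ler_powR; rewrite ?nnegrE ?(ltW a1') ?(ltW s0)// mulr_ge0// ltW.
    rewrite powRM ?(ltW r0)// ler_wpM2r ?powR_ge0//.
    rewrite -[leRHS]powRr1//; apply: ler_powR; lra.
  move: tr; rewrite ltr_norml => tr.
  have b1 := bnd _ t1 ltac:(lra); have b2 := bnd _ t2 ltac:(lra).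
  have p1 := pos _ t1 (1 - a); have p2 := pos _ t2 (1 - a).
  by rewrite ler_norml; lra.
Qed.

End Singular.

(** * Powers of 1 - |x|^2 over the ball *)

Section BallIntegral.
Variables (R : realType) (a : R).
Hypothesis a12 : 2^-1 < a < 1.
Implicit Types (y : nat -> R) (c rho : R).

Definition ballpow (c : R) (k : nat) (rho : R) : \bar R := iter_int k (fun y =>
  let s := \sum_(i < k) y i ^+ 2 in
  if (s < rho)%R then (c * (rho - s) `^ (- a))%:E else 0%E).

Lemma ballpow_ge0 c k rho : 0 <= c -> (0 <= ballpow c k rho)%E.
Proof.
by move=> c0; apply: iter_int_ge0 => y /=; case: ifP => // _; rewrite lee_fin mulr_ge0 ?powR_ge0.
Qed.

Lemma ballpowS c k rho :
  ballpow c k.+1 rho = (\int[@lebesgue_measure R]_(t in [set: R]) ballpow c k (rho - t ^+ 2))%E.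
Proof.
rewrite /ballpow /=; apply: eq_integral => t _; congr iter_int; apply/funext => y /=.
rewrite big_ord_recr /= eqxx.
have -> : \sum_(i < k) (if nat_of_ord i == k then t else y i) ^+ 2 = \sum_(i < k) y i ^+ 2.
  by apply: eq_bigr => i _; rewrite ltn_eqF.
by rewrite ltrBrDr opprD addrA (addrAC rho).
Qed.

Lemma ballpow1 : exists2 C : R, 0 <= C & forall c rho, 0 <= c ->
  (ballpow c 1 rho <= if (0 < rho)%R then (C * c * rho `^ (2^-1 - a))%:E else 0)%E.
Proof.
have /andP[a1 a2] := a12; have a3 : 0 < 1 - a by lra.
exists (4 / (1 - a)); first by rewrite divr_ge0// ltW.
move=> c rho c0; rewrite ballpowS.
have E t : ballpow c 0 (rho - t ^+ 2)
    = if (t ^+ 2 < rho)%R then (c * (rho - t ^+ 2) `^ (- a))%:E else 0%E.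
  by rewrite /ballpow /= big_ord0 subr0 subr_gt0.
under eq_integral do rewrite E.
case: ltP => rho0; last first.
  rewrite integral0_eq// => t _; rewrite ltNge (le_trans rho0) ?sqr_ge0//.
apply: (int_beta _ c0 rho0).
by apply/andP; split; lra.
Qed.

(** After one integration the exponent is [1/2 - a], between -1/2 and 0; a second one makes it
    [1 - a > 0], so two coordinates remove the singularity. *)
Lemma ballpow2 : exists2 C : R, 0 <= C & forall c rho, 0 <= c -> rho <= 1 ->
  (ballpow c 2 rho <= if (0 < rho)%R then (C * c)%:E else 0)%E.
Proof.
have /andP[a1 a2] := a12; have [C C0 hC] := ballpow1.
pose b := a - 2^-1; have b0 : 0 < 1 - b by rewrite /b; lra.
exists (4 / (1 - b) * C); first by rewrite mulr_ge0// divr_ge0// ltW.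
move=> c rho c0 rho1; rewrite ballpowS; have Cc0 : 0 <= C * c by exact: mulr_ge0.
apply: (@le_trans _ _ (\int[@lebesgue_measure R]_(t in [set: R])
  (if (t ^+ 2 < rho)%R then (C * c * (rho - t ^+ 2) `^ (- b))%:E else 0))%E).
  apply: le_integral_pos => t; first exact: ballpow_ge0.
  by have := hC c (rho - t ^+ 2) c0; rewrite subr_gt0 /b opprB.
case: ltP => rho0; last first.
  rewrite integral0_eq// => t _; rewrite ltNge (le_trans rho0) ?sqr_ge0//.
apply: le_trans (int_beta _ Cc0 rho0) _; first by apply/andP; split; rewrite /b; lra.
rewrite lee_fin -(mulrA _ C) ler_piMr//; first by rewrite mulr_ge0// divr_ge0// ltW.
have b1 : 0 <= 2^-1 - b by rewrite /b; lra.
have := ge0_ler_powR b1 _ _ rho1; rewrite powR1; apply; rewrite nnegrE//.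
exact: ltW.
Qed.

(** Every further coordinate only costs a factor 2, the length of [-1, 1]. *)
Lemma ballpow_bound k : exists2 C : R, 0 <= C & forall c rho, 0 <= c -> rho <= 1 ->
  (ballpow c k.+2 rho <= if (0 < rho)%R then (C * c)%:E else 0)%E.
Proof.
elim: k => [|k [C C0 hC]]; first exact: ballpow2.
exists (C * 2); first by rewrite mulr_ge0.
move=> c rho c0 rho1; rewrite ballpowS; have Cc0 : 0 <= C * c by exact: mulr_ge0.
apply: (@le_trans _ _ (\int[@lebesgue_measure R]_(t in [set: R])
  (if (t ^+ 2 < rho)%R then (C * c)%:E else 0))%E).
  apply: le_integral_pos => t; first exact: ballpow_ge0.
  have := hC c (rho - t ^+ 2) c0; rewrite subr_gt0; apply.
  by rewrite (le_trans _ rho1)// lerBlDr lerDl sqr_ge0.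
case: ltP => rho0; last first.
  rewrite integral0_eq// => t _; rewrite ltNge (le_trans rho0) ?sqr_ge0//.
have -> : (C * 2 * c)%:E
    = (\int[@lebesgue_measure R]_(t in [set` `[(-1)%R, 1%R] ]) cst (C * c)%:E t)%E.
  rewrite (mulrAC C).
  rewrite integral_cst//.
  by rewrite EFinM; congr (_ * _)%E; exact: esym (measure_segment R).
rewrite [X in (_ <= X)%E]integral_mkcond; apply: le_integral_pos => t.
  by case: ifP.
case: ifP => [tr|_]; last by rewrite patchE; case: ifP.
rewrite patchE mem_set//= in_itv /= -ler_norml -(@ler_pXn2r _ 2) ?nnegrE//.
by rewrite real_normK ?num_real// expr1n (le_trans (ltW tr)).
Qed.

Lemma ball_integral_bound (N : nat) : (2 <= N)%N -> exists2 C : R, 0 <= C &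
  forall c, 0 <= c -> (int_nn (fun x : 'rV[R]_N =>
    if asbool (inball x) then (c * (1 - sqn x) `^ (- a))%:E else 0) <= (C * c)%:E)%E.
Proof.
case: N => [//|[//|k]] _; have [C C0 hC] := ballpow_bound k; exists C => // c c0.
have := hC c 1 c0 (lexx _); rewrite ltr01; apply: le_trans.
suff -> : int_nn (fun x : 'rV[R]_k.+2 =>
   if asbool (inball x) then (c * (1 - sqn x) `^ (- a))%:E else 0%E) = ballpow c k.+2 1 by [].
rewrite /int_nn /ballpow; congr iter_int; apply/funext => y.
have E : sqn (\row_(i < k.+2) y (nat_of_ord i)) = \sum_(i < k.+2) y i ^+ 2.
  by apply: eq_bigr => i _; rewrite mxE.
by rewrite /inball E; case: asboolP => [->//|/negP/negbTE ->].
Qed.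

End BallIntegral.

(** * From profiles to functions on the ball *)

Lemma der_idM (R : realType) (k : R -> R) : {for 0, continuous k} ->
  has_deriv (fun t => t * k t) 0 (k 0).
Proof.
move=> /cont_epsP ck; apply/der_epsP => e /ck[r r0 hr]; exists r => // h h0 hlt.
by rewrite add0r mul0r subr0 [h * _]mulrC mulfK//; apply: hr; rewrite subr0.
Qed.

Section Profile.
Variables (R : realType) (N : nat).
Hypothesis N7 : (7 <= N)%N.
Local Notation n := (N%:R : R).
Local Notation V := 'rV[R]_N.
Variables (g v d : R -> R) (a : R).
Hypotheses (hsol : sol N g a v d) (cg : continuous g).
Implicit Types (x : V) (s : R) (y : nat -> R).

(* The variable [s] is [|x|^2], and [xi s] is [cosh r - 1]; [gprof s] is twice the
   derivative of [uprof], so that [gfun] is the Euclidean gradient of [ufun]. *)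
Definition xi s : R := 2 * s / (1 - s).
Definition uprof s : R := if s < 1 then v (xi s) else 0.
Definition gprof s : R := if s < 1 then (2 / (1 - s)) ^+ 2 * d (xi s) else 0.
Definition ufun x : R := uprof (sqn x).
Definition gfun x : V := gprof (sqn x) *: x.

(* The vector field [flux (|x|^2) x] is [(2 / (1 - |x|^2))^(N - 2)] times the gradient,
   [flux_src] is [2 s] times the derivative of [flux]. *)
Definition flux s : R := (2 / (1 - s)) ^+ N * d (xi s).
Definition flux_src s : R := - (2 / (1 - s)) ^+ N * g (v (xi s)) - n * flux s.

Lemma xi_der s : s < 1 -> has_deriv xi s (2 / (1 - s) ^+ 2).
Proof.
move=> s1; have s0 : 1 - s != 0 by rewrite gt_eqF; lra.
apply: der_eq (derM (derM (derC _ 2) (derI _)) (@derV R (fun z : R => 1 - z) s _ s0 (derB (derC _ 1) (derI _)))) _.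
by field.
Qed.

Lemma conf_der s : s < 1 -> has_deriv (fun z : R => 2 / (1 - z)) s (2 / (1 - s) ^+ 2).
Proof.
move=> s1; have s0 : 1 - s != 0 by rewrite gt_eqF; lra.
apply: der_eq (derM (derC _ 2) (@derV R (fun z : R => 1 - z) s _ s0 (derB (derC _ 1) (derI _)))) _.
by field.
Qed.

Lemma xi_cont s : s < 1 -> {for s, continuous xi}.
Proof. by move=> /xi_der; exact: der_cont. Qed.

Lemma conf_cont s : s < 1 -> {for s, continuous (fun z : R => 2 / (1 - z))}.
Proof. by move=> /conf_der; exact: der_cont. Qed.

Lemma xi_gt0 s : 0 < s -> s < 1 -> 0 < xi s.
Proof. by move=> s0 s1; rewrite divr_gt0; lra. Qed.

Lemma flux_cont s : s < 1 -> {for s, continuous flux}.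
Proof.
move=> s1; apply: contM; first by apply: contX; exact: conf_cont.
by apply: (@cont_comp R _ d); [exact: xi_cont|exact: (sol_dcont hsol)].
Qed.

Lemma flux_src_cont s : s < 1 -> {for s, continuous flux_src}.
Proof.
move=> s1; apply: contB; last by apply: contM; [exact: contC|exact: flux_cont].
apply: contM; first by apply: contN; apply: contX; exact: conf_cont.
apply: (@cont_comp R _ g); last exact: cg.
by apply: (@cont_comp R _ v); [exact: xi_cont|exact: (sol_cont hsol)].
Qed.

(** The regularity condition [d 0 = - g (v 0) / n] at the centre. It is what lets x_i^2 / |x|^2
    times the source extend continuously by 0 to the origin, where the first factor has no limit. *)
Lemma flux_src0 : flux_src 0 = 0.
Proof.
have n0 : n != 0 by rewrite gt_eqF// (lt_le_trans _ (n7 R N7)).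
have [_ _ [_ d0 _]] := hsol.
by rewrite /flux_src /flux /xi mulr0 mul0r d0; field.
Qed.

Lemma flux_der s : 0 < s -> s < 1 -> has_deriv flux s (flux_src s / (2 * s)).
Proof.
move=> s0 s1; have x0 := xi_gt0 s0 s1.
have s1n : 1 - s != 0 by rewrite gt_eqF; lra.
apply: der_eq (derM (derX N (conf_der s1)) (der_comp (sol_der2 N7 hsol x0) (xi_der s1))) _.
rewrite /flux_src /flux; set D := d (xi s); set gv := g (v (xi s)).
case: N N7 => // m _ /=; rewrite (exprS _ m) -(natr1 m).
rewrite /sinh2; set c := (2 / (1 - s)) ^+ m; rewrite /xi.
have s0' : s != 0 by rewrite gt_eqF.
have nz : 2 * s / (1 - s) + 2 != 0.
  by have -> : 2 * s / (1 - s) + 2 = 2 / (1 - s) by [field]; rewrite mulf_neq0 ?invr_neq0.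
by field; rewrite s1n s0' /=; apply/eqP; lra.
Qed.

Lemma Cc_inf_ball_supp (psi : V -> R) : Cc_inf psi -> ball_supp psi.
Proof. by move=> [_ [r [r1 h]]]; exists r. Qed.

Lemma ball_suppM (psi F : V -> R) : ball_supp psi -> ball_supp (fun x => psi x * F x).
Proof. by move=> [r r1 h]; exists r => // x /h ->; rewrite mul0r. Qed.

Lemma derive_supp (psi : V -> R) (w : V) (r : R) : (forall x, r <= sqn x -> psi x = 0) ->
  forall x, r < sqn x -> 'D_w psi x = 0.
Proof.
move=> h x rx; have <- : 'D_w (fun=> 0 : R) x = 0 by exact: derive_cst.
apply: near_eq_derive; have := near_gt (@cont_sqn R N x) rx.
by apply: filterS => z /ltW; exact: h.
Qed.

Definition fluxcoord (psi : V -> R) (i : 'I_N) x : R := psi x * (x ord0 i * flux (sqn x)).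
(** The i-th partial derivative of [fluxcoord psi i] inside the ball. At the origin the quotient is
    0 by the convention on inverses, which agrees with the continuous extension. *)
Definition fluxpartial (psi : V -> R) (i : 'I_N) x : R :=
  'D_(delta_mx ord0 i) psi x * (x ord0 i * flux (sqn x))
  + psi x * (flux (sqn x) + x ord0 i ^+ 2 / sqn x * flux_src (sqn x)).

Lemma partial_supp psi : ball_supp psi -> exists2 r : R, r < 1 &
  forall x, r <= sqn x -> forall i, fluxpartial psi i x = 0.
Proof.
move=> [r r1 h]; exists ((r + 1) / 2); first lra.
move=> x xr i; have rx : r < sqn x by lra.
by rewrite /fluxpartial (derive_supp _ h)// h 1?ltW// !mul0r addr0.
Qed.

Lemma ball_supp_partial psi i : ball_supp psi -> ball_supp (fluxpartial psi i).
Proof. by move=> /partial_supp[r r1 h]; exists r => // x /h. Qed.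

Lemma cont_compV (f : R -> R) x : {for (sqn x), continuous f} ->
  {for x, continuous (fun z : V => f (sqn z))}.
Proof. by move=> cf; apply: (@cont_comp R V f); [exact: cont_sqn|]. Qed.

Lemma sqn0_coord x i : sqn x = 0 -> x ord0 i = 0.
Proof.
move=> x0; have := coord_le_sqn x i; rewrite x0 => h.
by apply/eqP; rewrite -sqrf_eq0 eq_le h sqr_ge0.
Qed.

Lemma cont_dom (T : topologicalType) (F Q : T -> R) (x : T) : {for x, continuous Q} ->
  Q x = 0 -> (forall z, `|F z| <= `|Q z|) -> {for x, continuous F}.
Proof.
move=> cQ Qx FQ; have Fx : F x = 0.
  by apply/eqP; rewrite -normr_le0 (le_trans (FQ x))// Qx normr0.
suff : F z @[z --> x] --> F x by [].
rewrite Fx; apply/cvgr0Pnorm_lt => e e0.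
have : Q z @[z --> x] --> (0 : R) by rewrite -Qx; exact: cQ.
by move=> /cvgr0Pnorm_lt/(_ _ e0); apply: filterS => z; apply: le_lt_trans.
Qed.

Lemma radial_part_cont (i : 'I_N) x : sqn x < 1 ->
  {for x, continuous (fun z : V => z ord0 i ^+ 2 / sqn z * flux_src (sqn z))}.
Proof.
move=> x1; have cQ := cont_compV (flux_src_cont x1).
have [x0|x0] := eqVneq (sqn x) 0; last first.
  apply: contM cQ; apply: contM; last by apply: (contV x0); exact: cont_sqn.
  by apply: (@contX R V (fun z => z ord0 i)); exact: cont_coord.
have Qx : flux_src (sqn x) = 0 by rewrite x0 flux_src0.
apply: cont_dom cQ Qx _ => z.
rewrite normrM -[leRHS]mul1r ler_wpM2r//.
have z0 : 0 <= z ord0 i ^+ 2 / sqn z by rewrite divr_ge0 ?sqr_ge0 ?sqn_ge0.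
rewrite ger0_norm//; have [->|zn] := eqVneq (sqn z) 0; first by rewrite invr0 mulr0.
by rewrite ler_pdivrMr ?mul1r ?coord_le_sqn// lt_def zn sqn_ge0.
Qed.

Lemma Cc_inf_cont (psi : V -> R) : Cc_inf psi -> continuous psi.
Proof. by move=> [h _] x; exact: differentiable_continuous (h [::] x). Qed.

Lemma Cc_inf_contD (psi : V -> R) (w : V) : Cc_inf psi -> continuous ('D_w psi).
Proof. by move=> [h _] x; exact: differentiable_continuous (h [:: w] x). Qed.

Lemma cont_fluxcoord psi i : Cc_inf psi -> continuous (fluxcoord psi i).
Proof.
move=> Cp; apply: cont_glue; first exact/ball_suppM/Cc_inf_ball_supp.
move=> x x1; apply: contM; first exact: Cc_inf_cont.
by apply: contM; [exact: cont_coord|exact/cont_compV/flux_cont].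
Qed.

Lemma cont_fluxpartial psi i : Cc_inf psi -> continuous (fluxpartial psi i).
Proof.
move=> Cp; apply: cont_glue; first exact/ball_supp_partial/Cc_inf_ball_supp.
move=> x x1; have cf := cont_compV (flux_cont x1); apply: contD.
  by apply: contM; [exact: Cc_inf_contD|apply: contM => //; exact: cont_coord].
apply: contM; first exact: Cc_inf_cont.
by apply: contD => //; exact: radial_part_cont.
Qed.

Lemma fluxcoord_der psi (i : 'I_N) y : Cc_inf psi ->
  has_deriv (fun t => fluxcoord psi i (row_of N (upd i t y))) (y i)
    (fluxpartial psi i (row_of N y)).
Proof.
move=> Cp; have sp := Cc_inf_ball_supp Cp.
have [x1|x1] := ltP (sqn (row_of N y)) 1; last first.
  rewrite (ball_supp_out (ball_supp_partial i sp) x1).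
  have [r r1 hr] := sp; apply: der_ext (derC _ 0).
  have cs : {for (y i), continuous (fun t => sqn (row_of N (upd i t y)))}.
    exact: der_cont (sqn_der i y).
  have rx : r < sqn (row_of N (upd i (y i) y)) by rewrite upd_id (lt_le_trans r1).
  have := near_gt cs rx; apply: filterS => t /ltW /hr h.
  by rewrite /fluxcoord h mul0r.
have dpsi : has_deriv (fun t => psi (row_of N (upd i t y))) (y i)
    ('D_(delta_mx ord0 i) psi (row_of N y)).
  apply/has_deriv_derive; have [hd _] := Cp.
  by split => //; exact: diff_derivable (hd [::] _).
suff dK : has_deriv (fun t => row_of N (upd i t y) ord0 i * flux (sqn (row_of N (upd i t y)))) (y i)
   (flux (sqn (row_of N y)) + row_of N y ord0 i ^+ 2 / sqn (row_of N y) * flux_src (sqn (row_of N y))).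
  by apply: der_eq (derM dpsi dK) _; rewrite /fluxpartial upd_id; ring.
have -> : (fun t => row_of N (upd i t y) ord0 i * flux (sqn (row_of N (upd i t y))))
   = (fun t => t * flux (sqn (row_of N (upd i t y)))).
  by apply/funext => t; rewrite row_ofE upd_eq.
have [x0|x0] := eqVneq (sqn (row_of N y)) 0.
  have y0 : y i = 0 by have := sqn0_coord i x0; rewrite row_ofE.
  have cf : {for 0, continuous (fun t => flux (sqn (row_of N (upd i t y))))}.
    rewrite -y0; apply: (@cont_comp R _ flux); first exact: der_cont (sqn_der i y).
    by rewrite upd_id; exact: flux_cont.
  have := der_idM cf; rewrite row_ofE y0 expr0n /= mul0r mul0r addr0.
  by rewrite -[X in upd i X]y0 upd_id.
have sp0 : 0 < sqn (row_of N y) by rewrite lt_def x0 sqn_ge0.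
have [dF dS] := (flux_der sp0 x1, sqn_der i y).
have dF' : has_deriv flux (sqn (row_of N (upd i (y i) y)))
    (flux_src (sqn (row_of N y)) / (2 * sqn (row_of N y))) by rewrite upd_id.
apply: der_eq (derM (derI _) (der_comp dF' dS)) _; rewrite upd_id row_ofE.
by field.
Qed.

Definition weak_integrand (psi : V -> R) x : R :=
  confac x ^- 2 * edot (gfun x) (egrad psi x) - g (ufun x) * psi x.

(** The divergence is computed: the divergence N of the field x is cancelled by the term
    [- n * flux] of [flux_src], and the weights x_i^2 / |x|^2 sum to 1 off the origin, while at the
    origin the source is 0. *)
Lemma weak_integrandE psi x : Cc_inf psi -> sqn x < 1 ->
  weak_integrand psi x * confac x ^+ N = \sum_(i < N) fluxpartial psi i x.
Proof.
move=> Cp x1; rewrite /weak_integrand /gfun /ufun /gprof /uprof x1 /confac.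
set c := 2 / (1 - sqn x); have c0 : c != 0 by rewrite mulf_neq0 ?invr_neq0// gt_eqF//; lra.
have -> : edot ((c ^+ 2 * d (xi (sqn x))) *: x) (egrad psi x)
   = c ^+ 2 * d (xi (sqn x)) * \sum_(i < N) 'D_(delta_mx ord0 i) psi x * x ord0 i.
  rewrite /edot big_distrr /=; apply: eq_bigr => i _; rewrite !mxE; ring.
rewrite /fluxpartial big_split /= -[in X in _ = _ + X]big_distrr /= big_split /=.
have -> : \sum_(i < N) 'D_(delta_mx ord0 i) psi x * (x ord0 i * flux (sqn x))
   = (\sum_(i < N) 'D_(delta_mx ord0 i) psi x * x ord0 i) * flux (sqn x).
  by rewrite big_distrl /=; apply: eq_bigr => i _; rewrite mulrA.
rewrite sumr_const card_ord.
have -> : \sum_(i < N) x ord0 i ^+ 2 / sqn x * flux_src (sqn x) = flux_src (sqn x).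
  rewrite -!big_distrl /=; have [x0|x0] := eqVneq (sqn x) 0.
    by rewrite x0 flux_src0 mulr0.
  by rewrite -/(sqn x) divff// mul1r.
rewrite /flux_src /flux -/c -[_ *+ N]mulr_natl; set S := \sum_(i < N) _.
set cN := c ^+ N; set D := d _; set gv := g _.
by field.
Qed.

(** Times the volume density the integrand is a continuous function [E] supported inside the ball.
    Its absolute value and its positive and negative parts are 1-Lipschitz images of [E], so their
    iterated integrals are finite values of [iint]; the difference of the last two is the integral
    of [E], a sum of integrals of partial derivatives. *)
Lemma weak_integrand_hint psi : Cc_inf psi ->
  hintegrable (weak_integrand psi) /\ hint (weak_integrand psi) = 0.
Proof.
move=> Cp; have sp := Cc_inf_ball_supp Cp.
pose E x : R := \sum_(i < N) fluxpartial psi i x.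
have cE : continuous E by move=> x; apply: cont_sum => i; exact: cont_fluxpartial.
have sE : ball_supp E.
  by have [r r1 h] := partial_supp sp; exists r => // x /h hx; exact: big1.
have UE := unif_supp_row cE sE.
have EF x (T : Type) (op : R -> T) (y : T) : op 0 = y ->
    (if asbool (inball x) then op (weak_integrand psi x * confac x ^+ N) else y) = op (E x).
  move=> op0; case: asboolP => [x1|/negP]; first by rewrite weak_integrandE.
  by rewrite -leNgt => x1; rewrite (ball_supp_out sE x1) op0.
have conf0 x : inball x -> 0 < confac x ^+ N.
  by rewrite /inball => x1; rewrite exprn_gt0// divr_gt0//; lra.
have lip_max (F : R -> R) : F 0 = 0 -> (forall s t, `|F s - F t| <= `|s - t|) ->
    (forall s, 0 <= F s) -> int_nn (fun x => (F (E x))%:E)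
      = (iint N (fun y => F (E (row_of N y))))%:E.
  by move=> F0 lF Fge; rewrite /int_nn iter_int_iint//; exact: unif_supp_lip.
split.
  rewrite /hintegrable /hint_abs.
  have -> : (fun x : V => if asbool (inball x) then (`|weak_integrand psi x| * confac x ^+ N)%:E else 0%E)
     = (fun x => (`|E x|)%:E).
    apply/funext => x; rewrite -(EF x _ (fun z => (`|z|)%:E) 0%E) ?normr0//.
    by case: asboolP => // /conf0 c0; rewrite normrM (gtr0_norm c0).
  by rewrite (lip_max Num.norm) ?normr0 ?ltry//; exact: ler_dist_dist.
rewrite /hint.
have EP (sg : R -> R) : sg 0 = 0 -> (forall s t, sg (s * t) = sg s * t) ->
    (fun x : V => if asbool (inball x)
      then (Num.max (sg (weak_integrand psi x)) 0 * confac x ^+ N)%:E else 0%E)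
     = (fun x => (Num.max (sg (E x)) 0)%:E).
  move=> sg0 sgM; apply/funext => x.
  rewrite -(EF x _ (fun z => (Num.max (sg z) 0)%:E) 0%E) ?sg0 ?maxxx//.
  by case: asboolP => // /conf0/ltW c0; rewrite sgM maxr_pMl// mul0r.
rewrite (EP id)// (EP -%R) ?oppr0//; last by move=> s t; rewrite mulNr.
have lip1 (s t : R) : `|Num.max s 0 - Num.max t 0| <= `|s - t|.
  by rewrite ![Num.max _ 0]maxC; exact: max_lip.
have lip2 (s t : R) : `|Num.max (- s) 0 - Num.max (- t) 0| <= `|s - t|.
  by apply: le_trans (lip1 _ _) _; rewrite -opprD normrN.
rewrite (lip_max (fun z => Num.max z 0)) ?maxxx//; last by move=> s; rewrite le_max lexx orbT.
rewrite (lip_max (fun z => Num.max (- z) 0)) ?oppr0 ?maxxx//; last first.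
  by move=> s; rewrite le_max lexx orbT.
rewrite /= -iintB; first last.
- by apply: (@unif_supp_lip _ _ (fun y => E (row_of N y)) (fun z => Num.max (- z) 0)); rewrite ?oppr0 ?maxxx.
- by apply: (@unif_supp_lip _ _ (fun y => E (row_of N y)) (fun z => Num.max z 0)); rewrite ?maxxx.
have -> : (fun y => Num.max (E (row_of N y)) 0 - Num.max (- E (row_of N y)) 0)
    = (fun y => E (row_of N y)).
  apply/funext => y; set e := E _; have [e0|e0] := leP 0 e.
    by rewrite (@max_r _ _ (- e)) ?oppr_le0// subr0.
  by rewrite (@max_l _ _ (- e)) ?oppr_ge0 ?ltW// sub0r opprK.
have [] := @iint_sum0 R N 'I_N xpredT (fun i y => fluxpartial psi i (row_of N y)) _ _ => //.
- by move=> i; apply: unif_supp_row; [exact: cont_fluxpartial|exact: ball_supp_partial].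
- move=> i; apply: (@iint_deriv _ N i _ (fun y => fluxcoord psi i (row_of N y))) => //.
  + by apply: unif_supp_row; [exact: cont_fluxpartial|exact: ball_supp_partial].
  + by apply: unif_supp_row; [exact: cont_fluxcoord|exact: ball_suppM].
  + apply: (@unif_derivP _ N) => //; last by move=> y; exact: fluxcoord_der.
    by apply: unif_supp_row; [exact: cont_fluxpartial|exact: ball_supp_partial].
Qed.

(** * Membership in the energy space *)

Section Decay.
Variables (C D : R).
Hypotheses (C0 : 0 <= C) (D0 : 0 < D) (D1 : D < 2^-1).
Let b := (n - 1) / 2 + D.
Hypothesis decay : forall x : R, 0 <= x ->
  `|v x| <= C * (x + 1) `^ (- b) /\ `|d x| <= C * (x + 1) `^ (- b - 1).

Lemma b_ge3 : 3 <= b.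
Proof. by have h := n7 R N7; have hD := D0; rewrite /b; lra. Qed.

Lemma xi_powR s r : 0 <= s -> s < 1 -> 0 <= r -> (xi s + 1) `^ (- r) <= (1 - s) `^ r.
Proof.
move=> s0 s1 r0; have t0 : 0 < 1 - s by lra.
have x1 : (1 - s)^-1 <= xi s + 1.
  have -> : xi s + 1 = (1 + s) / (1 - s) by rewrite /xi; field; rewrite gt_eqF.
  by rewrite -[leLHS]mul1r ler_pM2r ?invr_gt0//; lra.
have iV : 0 < (1 - s)^-1 by rewrite invr_gt0.
have -> : (1 - s) `^ r = ((1 - s)^-1) `^ (- r).
  by rewrite -powR_inv1 ?ltW// -powRrM mulrNN mul1r.
have X0 := lt_le_trans iV x1.
rewrite !powRN lef_pV2 ?posrE ?powR_gt0//.
by apply: ge0_ler_powR => //; rewrite nnegrE ltW.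
Qed.

Lemma uprof_le s : 0 <= s -> s < 1 -> `|uprof s| <= C * (1 - s) `^ b.
Proof.
move=> s0 s1; rewrite /uprof s1; have := b_ge3 => b3.
have x0 : 0 <= xi s by rewrite divr_ge0; lra.
have [h _] := decay x0; apply: le_trans h _.
by rewrite ler_wpM2l// xi_powR//; lra.
Qed.

Lemma gprof_le s : 0 <= s -> s < 1 -> `|gprof s| <= 4 * C * (1 - s) `^ (b - 1).
Proof.
move=> s0 s1; rewrite /gprof s1; have := b_ge3 => b3; have t0 : 0 < 1 - s by lra.
have x0 : 0 <= xi s by rewrite divr_ge0; lra.
have [_ h] := decay x0; rewrite normrM.
rewrite (@ger0_norm _ (_ ^+ 2)) ?sqr_ge0//.
have -> : 4 * C * (1 - s) `^ (b - 1) = (2 / (1 - s)) ^+ 2 * (C * (1 - s) `^ (b + 1)).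
  have -> : (1 - s) `^ (b + 1) = (1 - s) `^ (b - 1) * (1 - s) ^+ 2.
    by rewrite -powR_mulrn ?ltW// -powRD ?(gt_eqF t0) ?implybT//; congr (_ `^ _); ring.
  by field; rewrite gt_eqF.
rewrite ler_wpM2l ?sqr_ge0//; apply: le_trans h _; rewrite ler_wpM2l//.
have -> : - b - 1 = - (b + 1) by ring.
by rewrite xi_powR//; lra.
Qed.

Lemma profile_cont (f : R -> R) (K : R) : 0 <= K ->
  (forall s, s < 1 -> {for s, continuous f}) ->
  (forall s, 1 <= s -> f s = 0) -> (forall s, 0 <= s -> s < 1 -> `|f s| <= K * (1 - s)) ->
  continuous f.
Proof.
move=> K0 cf f1 fK s; have [/cf//|s1|s1] := ltgtP s 1.
- apply: cont_ext (@contC R R 0 s); near=> z; rewrite f1//; apply: ltW; near: z.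
  exact: lt_nbhsr.
- apply/cont_epsP => e e0; have K1 : 0 < K + 1 by lra.
  exists (Num.min 1 (e / (K + 1))); first by rewrite lt_min ltr01 divr_gt0.
  move=> y; rewrite lt_min s1 (f1 1)// subr0 => /andP[y1 y2].
  have [yl|/f1 ->] := ltP y 1; last by rewrite normr0.
  have y0 : 0 <= y by move: y1; rewrite ltr_norml; lra.
  apply: le_lt_trans (fK _ y0 yl) _; move: y2; rewrite ltr_pdivlMr// ltr0_norm ?subr_lt0//.
  by have y3 : 0 < 1 - y by [lra]; move=> h; lra.
Unshelve. all: by end_near.
Qed.

Lemma powR_le_id s r : 0 < s -> s <= 1 -> 1 <= r -> s `^ r <= s.
Proof. by move=> s0 s1 r1; apply: ge1r_powR => //; rewrite s0. Qed.

Lemma uprof_cont : continuous uprof.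
Proof.
apply: (@profile_cont _ C) => //.
- move=> s s1; apply: (@cont_ext R R (fun z => v (xi z))).
    by near=> z; rewrite /uprof ifT//; near: z; exact: lt_nbhsl.
  by apply: (@cont_comp R _ v); [exact: xi_cont|exact: (sol_cont hsol)].
- by move=> s; rewrite /uprof ltNge => ->.
- move=> s s0 s1; apply: le_trans (uprof_le s0 s1) _; rewrite ler_wpM2l// powR_le_id//; first lra.
    by rewrite gerBl.
  by have := b_ge3; lra.
Unshelve. all: by end_near.
Qed.

Lemma gprof_cont : continuous gprof.
Proof.
apply: (@profile_cont _ (4 * C)); first by rewrite mulr_ge0.
- move=> s s1; apply: (@cont_ext R R (fun z => (2 / (1 - z)) ^+ 2 * d (xi z))).
    by near=> z; rewrite /gprof ifT//; near: z; exact: lt_nbhsl.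
  apply: contM; first by apply: contX; exact: conf_cont.
  by apply: (@cont_comp R _ d); [exact: xi_cont|exact: (sol_dcont hsol)].
- by move=> s; rewrite /gprof ltNge => ->.
- move=> s s0 s1; apply: le_trans (gprof_le s0 s1) _.
  rewrite ler_wpM2l ?mulr_ge0// powR_le_id//; first lra.
    by rewrite gerBl.
  by have := b_ge3; lra.
Unshelve. all: by end_near.
Qed.

Lemma uprof_der s : s < 1 -> has_deriv uprof s (gprof s / 2).
Proof.
move=> s1; have [_ dv _] := hsol.
have s0 : 1 - s != 0 by rewrite gt_eqF// subr_gt0.
apply: der_eq (der_ext _ (der_comp (dv (xi s)) (xi_der s1))) _.
  by near=> z; rewrite /uprof ifT//; near: z; exact: lt_nbhsl.
by rewrite /gprof s1; field.
Unshelve. all: by end_near.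
Qed.

Lemma ufun_cont : continuous ufun.
Proof. by move=> x; apply: cont_compV; exact: uprof_cont. Qed.

Lemma gfun_cont i : continuous (fun x => gfun x ord0 i).
Proof.
move=> x; apply: (@cont_ext R V (fun z => gprof (sqn z) * z ord0 i)).
  by near=> z; rewrite mxE.
by apply: contM; [apply: cont_compV; exact: gprof_cont|exact: cont_coord].
Unshelve. all: by end_near.
Qed.

Definition pospart (s : R) : R := (s + `|s|) / 2.

Lemma pospart0 s : s <= 0 -> pospart s = 0.
Proof. by move=> s0; rewrite /pospart ler0_norm//; lra. Qed.

Lemma pospart_id s : 0 <= s -> pospart s = s.
Proof. by move=> s0; rewrite /pospart ger0_norm//; lra. Qed.

(** Soft thresholding cuts off the part of size at most [M] without creating a jump, so a continuous
    profile stays continuous. *)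
Lemma soft_threshold s M : 0 <= M ->
  `|s - (pospart (s - M) - pospart (- s - M))| <= M /\
  (`|s| <= M -> pospart (s - M) - pospart (- s - M) = 0).
Proof.
move=> M0; split.
  have [h|h] := leP s M.
    have [h'|h'] := leP (- M) s.
      by rewrite !pospart0 ?subrr ?subr0 ?ler_norml; [apply/andP; split|lra|lra].
    by rewrite pospart0 ?pospart_id; [rewrite sub0r ler_norml; apply/andP; split; lra|lra|lra].
  by rewrite (pospart_id (s := s - M)) ?(pospart0 (s := - s - M)); [rewrite ler_norml; apply/andP; split; lra|lra|lra].
by rewrite ler_norml => /andP[h1 h2]; rewrite !pospart0 ?subrr//; lra.
Qed.

Lemma cont_pospart (f : R -> R) s : {for s, continuous f} ->
  {for s, continuous (fun z => pospart (f z))}.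
Proof.
by move=> cf; apply: contM; [apply: contD => //; exact: cont_norm|exact: contC].
Qed.

(** A compromise: [m < b - 1], so [gprof] is eventually below any multiple of (1 - s)^m; yet
    [2 (m + 1) - n = D - 1 > -1], so errors of this size are square integrable for the hyperbolic
    volume. *)
Let m := b - 1 - D / 2.

Lemma m_ge1 : 1 <= m.
Proof. by have h := b_ge3; have h1 := D0; have h2 := D1; rewrite /m; lra. Qed.

(** For e > 0 this is (1 - s)^e continued by 0 beyond s = 1, which makes it continuous on the whole
    line. *)
Definition tailpow (e s : R) : R := `|pospart (1 - s)| `^ e.

Lemma tailpowE e s : s < 1 -> tailpow e s = (1 - s) `^ e.
Proof. by move=> s1; rewrite /tailpow pospart_id ?ger0_norm//; lra. Qed.

Lemma tailpow_ge0 e s : 0 <= tailpow e s.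
Proof. exact: powR_ge0. Qed.

Lemma tailpow_cont e : 0 < e -> continuous (tailpow e).
Proof.
move=> e0 s.
suff : {for s, continuous (fun z : R => `|pospart (1 - z)| `^ e)} by [].
apply: (@cont_comp R R (fun t => `|t| `^ e) (fun z : R => pospart (1 - z))).
  by apply: cont_pospart; apply: contB; [exact: contC|exact: contI].
exact: absq_cont.
Qed.

Lemma small_tail K e t : 0 <= K -> 0 < e -> 0 < t ->
  exists2 del : R, 0 < del < 1 & forall s, 0 < s -> s <= del -> K * s `^ e <= t.
Proof.
move=> K0 e0 t0; have K1 : 0 < K + 1 by lra.
have := absq_cont e0 (v := 0); move=> /cont_epsP/(_ _ (divr_gt0 t0 K1))[r r0 hr].
exists (Num.min (r / 2) 2^-1).
  by rewrite lt_min gt_min; apply/andP; split; [apply/andP; split|apply/orP; right]; lra.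
move=> s s0; rewrite le_min => /andP[sr _].
have := hr s; rewrite subr0 normr0 powR0 ?gt_eqF// subr0 (gtr0_norm s0).
rewrite (ger0_norm (powR_ge0 _ _)) ltr_pdivlMr// => /(_ ltac:(lra)).
by have := powR_ge0 s e; nra.
Qed.

(* [q] approximates the soft thresholding of [gprof] at height [t (1 - s)^m], which
   vanishes near [s = 1] since [gprof] decays faster than [(1 - s)^m]. *)
Lemma profile_approx (t : R) : 0 < t -> exists q eta : R -> R, [/\ smooth eta,
  forall s, has_deriv eta s (q s / 2),
  exists2 T : R, T < 1 & forall s, T <= s -> eta s = 0,
  forall s, 0 <= s -> s < 1 -> `|gprof s - q s| <= 2 * t * (1 - s) `^ m &
  forall s, 0 <= s -> s < 1 -> `|uprof s - eta s| <= t * (1 - s) `^ (m + 1)].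
Proof.
move=> t0; have m1 := m_ge1; have m0 : 0 < m by lra.
pose M s := t * tailpow m s.
have M0 s : 0 <= M s by rewrite mulr_ge0 ?tailpow_ge0// ltW.
pose k s := pospart (gprof s - M s) - pospart (- gprof s - M s).
have cM : continuous M by move=> s; exact: contM (@contC R R t s) (@tailpow_cont m m0 s).
have ck : continuous k.
  move=> s; have cgp := @gprof_cont s; have cMs := @cM s.
  exact: contB (cont_pospart (contB cgp cMs)) (cont_pospart (contB (contN cgp) cMs)).
have kM s : `|gprof s - k s| <= M s by have [] := soft_threshold (gprof s) (M0 s).
have k0 s : `|gprof s| <= M s -> k s = 0 by have [_] := soft_threshold (gprof s) (M0 s).
have D20 : 0 < D / 2 by have := D0; lra.
have C40 : 0 <= 4 * C by rewrite mulr_ge0.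
have [del /andP[del0 del1] hdel] := small_tail C40 D20 t0.
have kT s : 1 - del <= s -> k s = 0.
  move=> sT; apply: k0; have [s1|s1] := ltP s 1; last by rewrite /gprof ltNge s1 normr0.
  have s0 : 0 <= s by lra.
  have t1 : 0 < 1 - s by lra.
  apply: le_trans (gprof_le s0 s1) _; rewrite /M tailpowE//.
  have -> : (1 - s) `^ (b - 1) = (1 - s) `^ (D / 2) * (1 - s) `^ m.
    by rewrite -powRD ?(gt_eqF t1) ?implybT//; congr (_ `^ _); rewrite /m; ring.
  rewrite mulrA ler_wpM2r ?powR_ge0//; apply: hdel => //; lra.
have T0 : 0 < 1 - del by lra.
(* A uniform error of this size is below the weighted tolerance [t * (1 - s) ^ m] on s <= 1 - del;
   beyond that point both functions vanish. *)
have e0 : 0 < t * del `^ m by rewrite mulr_gt0// powR_gt0.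
have [q sq [q1 q2]] := smooth_approx ck T0 kT e0.
have gq s : 0 <= s -> s < 1 -> `|gprof s - q s| <= 2 * t * (1 - s) `^ m.
  move=> s0 s1; have p0 := powR_ge0 (1 - s) m.
  have h1 : `|gprof s - k s| <= t * (1 - s) `^ m by have := kM s; rewrite /M tailpowE.
  have [sT|sT] := leP (1 - del) s.
    by rewrite q1// -(kT _ sT); nra.
  have h2 := q2 _ s0.
  have h3 : t * del `^ m <= t * (1 - s) `^ m.
    by rewrite ler_pM2l//; apply: ge0_ler_powR; rewrite ?nnegrE ?(ltW m0) ?(ltW del0)//; lra.
  have -> : gprof s - q s = (gprof s - k s) + (k s - q s) by ring.
  by apply: le_trans (ler_normD _ _) _; lra.
have [F F0 dF] := primitive (sq 0%N : continuous q).
pose eta s := (F s - F 1) * 2^-1.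
have deta s : has_deriv eta s (q s / 2).
  by apply: der_eq (derM (derB (dF s) (derC _ _)) (derC _ _)) _; ring.
exists q, eta; split => //.
- have sq2 : smooth (fun s => q s / 2) by move=> j; apply: CnM; [exact: sq|exact: CnC].
  exact: smooth_prim deta sq2.
- exists (1 - del); first lra.
  have F1 s : 1 - del <= s -> F s = F (1 - del).
    move=> sT; apply/esym; apply: (der0_eq sT) => z /andP[z1 _].
    by have := dF z; rewrite q1.
  by move=> s sT; rewrite /eta (F1 s)// (F1 1) ?subrr ?mul0r//; lra.
- move=> s s0 s1; have ms0 : 0 < m + 1 by lra.
  (* A primitive of t (1 - s)^m vanishing at s = 1, like [uprof - eta]; integrating the gradient
     error back from the boundary gains one power of 1 - s. *)
  pose G s := - (t / (m + 1) * tailpow (m + 1) s).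
  have cG : continuous G.
    by move=> z; exact: contN (contM (@contC R R (t / (m + 1)) z) (@tailpow_cont _ ms0 z)).
  have cu : continuous (fun z => uprof z - eta z).
    by move=> z; exact: contB (@uprof_cont z) (der_cont (deta z)).
  have dG z : s < z < 1 -> has_deriv G z (t * (1 - z) `^ m).
    move=> /andP[_ z1]; have z1' : 0 < 1 - z by lra.
    have dp : has_deriv (fun y : R => (1 - y) `^ (m + 1)) z (- ((m + 1) * (1 - z) `^ m)).
      apply: der_eq (der_comp (g := fun y : R => 1 - y) (is_derive1_powR (m + 1) z1')
        (derB (derC _ 1) (derI _))) _.
      have -> : m + 1 - 1 = m by ring.
      by ring.
    have dc := derN (derM (derC z (t / (m + 1))) dp).
    apply: (@der_eq _ G z _ _ (der_ext _ dc)).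
      by near=> y; rewrite /G tailpowE//; near: y; exact: lt_nbhsl.
    by field; rewrite gt_eqF.
  have du z : s < z < 1 -> has_deriv (fun z => uprof z - eta z) z (gprof z / 2 - q z / 2).
    by move=> /andP[_ z1]; apply: derB; [exact: uprof_der|exact: deta].
  have := der_norm_le (ltW s1) (fun z _ => cu z) (fun z _ => cG z) du dG _.
  have -> : uprof 1 - eta 1 = 0 by rewrite /uprof ltxx /eta subrr mul0r subrr.
  have -> : G 1 = 0 by rewrite /G /tailpow subrr pospart0// normr0 powR0 ?gt_eqF// mulr0 oppr0.
  rewrite !sub0r normrN /G opprK tailpowE// => h; apply: le_trans (h _) _.
    move=> z /andP[z0 z1]; rewrite -mulrBl normrM (@ger0_norm _ 2^-1) ?invr_ge0//.
    by rewrite ler_pdivrMr//; have := gq z ltac:(lra) z1; lra.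
  rewrite ler_wpM2r ?powR_ge0// ler_pdivrMr//; nra.
Unshelve. all: by end_near.
Qed.

Lemma borel_cont (f : V -> R) : continuous f -> borel_fun f.
Proof.
move=> cf B mB; have E := congr1 (@^~ B) (measurable_realfun.RGenOInfty.measurableE R).
move: (eq_ind _ (fun P : Prop => P) mB _ E); move: B {mB E}; apply: (@smallest_sub _ _ _ [set B : set R | <<s [set A : set 'rV[R]_N | open A]>> (f @^-1` B)]).
- have [s0 sC sU] := smallest_sigma_algebra setT [set A : set 'rV[R]_N | open A].
  split => /=.
  + by rewrite preimage_set0.
  + by move=> A /sC; rewrite !setTD.
  + by move=> F hF; rewrite preimage_bigcup; exact: sU.
- move=> A [x ->] /=; apply: sub_sigma_algebra => /=.
  have -> : f @^-1` `]x, +oo[%classic = [set z | x < f z].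
    by apply/seteqP; split => z /=; rewrite in_itv /= andbT.
  by rewrite openE => z; rewrite /interior; exact: near_gt (cf z).
Qed.

Lemma sqnZ (c : R) x : sqn (c *: x) = c ^+ 2 * sqn x.
Proof.
by rewrite /sqn big_distrr; apply: eq_bigr => i _; rewrite /= mxE exprMn.
Qed.

(** The factor (1 - s)^2 / 4 from the metric turns the gradient bound (2 t (1 - s)^m)^2 into (t (1 -
    s)^(m + 1))^2, the same as for the function itself; whence the power N + 1 of 2. The volume
    density then lowers the exponent [2 (m + 1)] by n. *)
Lemma H1_pointwise (t : R) (q eta : R -> R) x : 0 < t -> sqn x < 1 ->
  has_deriv eta (sqn x) (q (sqn x) / 2) ->
  `|gprof (sqn x) - q (sqn x)| <= 2 * t * (1 - sqn x) `^ m ->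
  `|uprof (sqn x) - eta (sqn x)| <= t * (1 - sqn x) `^ (m + 1) ->
  `|(ufun x - eta (sqn x)) ^+ 2
    + confac x ^- 2 * sqn (gfun x - egrad (fun z => eta (sqn z)) x)| * confac x ^+ N
  <= t ^+ 2 * 2 ^+ N.+1 * (1 - sqn x) `^ (- (1 - D)).
Proof.
move=> t0 x1 deta hg hu; have s0 := sqn_ge0 x.
rewrite (egrad_radial deta) /gfun -scalerBl sqnZ /ufun /confac.
have -> : 2 * (q (sqn x) / 2) = q (sqn x) by field.
move: hg hu; set s := sqn x in x1 s0 *; set dg := gprof s - q s; set du := uprof s - eta s.
set y := 1 - s; have y0 : 0 < y by rewrite subr_gt0.
have yn : y != 0 by rewrite gt_eqF.
have yP e f : y `^ (e + f) = y `^ e * y `^ f by rewrite powRD ?yn ?implybT.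
rewrite (yP m 1) powRr1 ?(ltW y0)//; set P := y `^ m => hg hu.
have P0 : 0 <= P by exact: powR_ge0.
have -> : y `^ (- (1 - D)) = P ^+ 2 * y ^+ 2 / y ^+ N.
  have -> : - (1 - D) = m + m + 2 + - n by rewrite /m /b; field.
  by rewrite (yP _ (- n)) (yP _ 2) (yP m m) powRN !powR_mulrn ?(ltW y0).
have c2 : (2 / y) ^- 2 = y ^+ 2 / 4 by field.
have cN : (2 / y) ^+ N = 2 ^+ N / y ^+ N by rewrite expr_div_n.
rewrite c2 cN (exprS _ N) ger0_norm; last first.
  apply: addr_ge0; first exact: sqr_ge0.
  by apply: mulr_ge0; [rewrite divr_ge0 ?sqr_ge0|apply: mulr_ge0; rewrite ?sqr_ge0].
have -> : t ^+ 2 * (2 * 2 ^+ N) * (P ^+ 2 * y ^+ 2 / y ^+ N)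
   = 2 * (t * (P * y)) ^+ 2 * (2 ^+ N / y ^+ N) by rewrite !exprMn; ring.
apply: ler_wpM2r; first by rewrite divr_ge0// exprn_ge0// ltW.
have sq (z w : R) : `|z| <= w -> z ^+ 2 <= w ^+ 2.
  by move=> h; rewrite -[z ^+ 2]real_normK ?num_real// lerXn2r ?nnegrE// (le_trans _ h).
have h1 := sq _ _ hu; have h2 := sq _ _ hg.
have h3 : dg ^+ 2 * s <= (2 * t * P) ^+ 2.
  apply: le_trans h2; rewrite ler_piMr ?sqr_ge0// ltW//.
have h4 : y ^+ 2 / 4 * (dg ^+ 2 * s) <= y ^+ 2 / 4 * (2 * t * P) ^+ 2.
  by apply: ler_wpM2l h3; rewrite mulr_ge0 ?sqr_ge0.
have -> : 2 * (t * (P * y)) ^+ 2 = (t * (P * y)) ^+ 2 + y ^+ 2 / 4 * (2 * t * P) ^+ 2.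
  by rewrite !exprMn; field.
exact: lerD.
Qed.

Lemma ufun_inH1 : inH1 ufun gfun.
Proof.
split; first by apply: borel_cont; exact: ufun_cont.
split; first by move=> i; apply: borel_cont; exact: gfun_cont.
have t0 (k : nat) : 0 < (harmonic k : R) by exact: harmonic_gt0.
have hex (k : nat) := profile_approx (t0 k).
have [q hq] := choice hex; have [eta hqe] := choice hq.
(* The range of exponents for which [ball_integral_bound] gives a finite integral over the ball. *)
have D12 : 2^-1 < 1 - D < 1 by have := D0; have := D1; lra.
have N2 : (2 <= N)%N by exact: leq_trans N7.
have [K K0 hK] := ball_integral_bound D12 N2.
exists (fun k x => eta k (sqn x)); split.
  by move=> k; have [se de [T T1 eT] _ _] := hqe k; exact: Cc_inf_radial se T1 eT.
apply: (@squeeze_cvge _ _ _ _ (cst 0%E) _ (fun k => ((K * 2 ^+ N.+1)%:E * (harmonic k)%:E)%E)).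
- near=> k; apply/andP; split.
    apply: iter_int_ge0 => y; case: asboolP => // x1; rewrite lee_fin.
    by apply: mulr_ge0 => //; apply: exprn_ge0; rewrite divr_ge0// subr_ge0 ltW.
  have [se de _ hg hu] := hqe k.
  have c0 : 0 <= harmonic k ^+ 2 * 2 ^+ N.+1 :> R by rewrite mulr_ge0 ?sqr_ge0 ?exprn_ge0.
  apply: le_trans (le_trans _ (hK _ c0)) _; last first.
    have hk0 : 0 <= harmonic k :> R by exact: harmonic_ge0.
    have hk1 : harmonic k <= 1 :> R by rewrite invf_le1 ?ler1n.
    rewrite -EFinM lee_fin.
    have -> : K * (harmonic k ^+ 2 * 2 ^+ N.+1) = K * 2 ^+ N.+1 * harmonic k ^+ 2 by ring.
    by rewrite ler_wpM2l ?mulr_ge0 ?exprn_ge0// ler_piMr.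
  apply: le_iter_int => y.
    case: asboolP => // x1; rewrite lee_fin.
    by apply: mulr_ge0 => //; apply: exprn_ge0; rewrite divr_ge0// subr_ge0 ltW.
  case: asboolP => // x1; rewrite lee_fin.
  exact: (H1_pointwise (t0 k) x1 (de _) (hg _ (sqn_ge0 _) x1) (hu _ (sqn_ge0 _) x1)).
- exact: cvg_cst.
- rewrite -[X in _ --> X](mule0 (K * 2 ^+ N.+1)%:E).
  by apply: cvgeZl => //; exact: cvge_harmonic.
Unshelve. all: by end_near.
Qed.

End Decay.
End Profile.

(** * Sign changes and the infinite family *)

Lemma near_norm (R : realType) (W : normedModType R) (x : W) (P : W -> Prop) :
  (\forall y \near x, P y) -> exists2 r : R, 0 < r & forall y, `|y - x| < r -> P y.
Proof.
move=> /nbhs_ballP[r /= r0 hr]; exists r => // y yx.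
by apply: hr; rewrite -ball_normE /= distrC.
Qed.

Section PositiveMeasure.
Variable R : realType.
Implicit Types (y c : nat -> R) (r : R).

Definition inbox (k : nat) c r y : bool :=
  \big[andb/true]_(i < k) (`|y i - c i| <= r).

Lemma iter_int0 k : iter_int k (fun _ : nat -> R => 0%E) = 0%E.
Proof. by elim: k => [//|k ih] /=; rewrite integral0_eq. Qed.

Lemma iter_int_box k c r : 0 < r ->
  iter_int k (fun y => if inbox k c r y then 1%E else 0%E) = ((2 * r) ^+ k)%:E.
Proof.
move=> r0; elim: k => [|k ih]; first by rewrite /= /inbox big_ord0.
have E t : iter_int k (fun y => if inbox k.+1 c r (fun i => if i == k then t else y i)
      then 1%E else 0%E)
    = (fun t => ((2 * r) ^+ k)%:E) \_ [set` `[(c k - r), (c k + r)] ] t.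
  rewrite patchE; have Ein y : inbox k.+1 c r (fun i => if i == k then t else y i)
      = inbox k c r y && (`|t - c k| <= r).
    rewrite /inbox big_ord_recr /= eqxx; congr andb; apply: eq_bigr => i _.
    by rewrite ltn_eqF.
  case: ifPn => [|].
    rewrite inE /= in_itv /= -ler_distl => tr; rewrite -ih; congr iter_int.
    by apply/funext => y; rewrite Ein tr andbT.
  rewrite notin_setE /= in_itv /= -ler_distl => /negP/negbTE tr.
  transitivity (iter_int k (fun _ : nat -> R => 0%E : \bar R)); last by rewrite iter_int0.
  by congr iter_int; apply/funext => y; rewrite Ein tr andbF.
rewrite /=; under eq_integral do rewrite E.
rewrite -integral_mkcond integral_cst//.
have m : @lebesgue_measure R `[(c k - r), (c k + r)]%classic = (2 * r)%:E.
  rewrite lebesgue_measure_itv /= lte_fin ifT; last lra.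
  by rewrite -EFinD; congr (_%:E); ring.
by rewrite exprSr EFinM; congr (_ * _)%E; exact: m.
Qed.

(** By continuity a cube around [x0] lies both in the ball and in [A]; its iterated integral is an
    explicit positive number. *)
Lemma ball_meas_gt0 (N : nat) (A : set 'rV[R]_N) (F : 'rV[R]_N -> R) (x0 : 'rV[R]_N) :
  continuous F -> sqn x0 < 1 -> 0 < F x0 -> (forall x, 0 < F x -> A x) ->
  (0 < ball_meas A)%E.
Proof.
move=> cF x01 F0 FA.
have n1 := near_gt (cF x0) F0.
have c2 : {for x0, continuous (fun x : 'rV[R]_N => - sqn x)}.
  by apply: (@contN R 'rV[R]_N); exact: cont_sqn.
have n2 : \forall x \near x0, -1 < - sqn x by apply: near_gt c2 _; rewrite ltrN2.
have [r r0 hr] := @near_norm R 'rV[R]_N x0 _ (filterI n1 n2).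
pose c (i : nat) : R := if insub i is Some j then x0 ord0 j else 0.
have r2 : 0 < r / 2 by rewrite divr_gt0.
have p0 : (0 < ((2 * (r / 2)) ^+ N)%:E)%E by rewrite lte_fin exprn_gt0// mulr_gt0.
apply: lt_le_trans p0 _; rewrite -(iter_int_box N c r2); apply: le_iter_int => y.
  by case: ifP.
case: ifP => [|_]; last by case: ifP.
rewrite /inbox big_andE => /forallP yb.
have : `|row_of N y - x0| < r.
  apply: row_norm_lt => // i.
  rewrite !mxE; have := yb i; rewrite /c valK /= => h; apply: le_lt_trans h _.
  by rewrite gtr_pMr// invf_lt1// ltr1n.
move=> /hr[/FA Ay]; rewrite ltrN2 => y1.
by rewrite ifT//; apply/asboolP.
Qed.

End PositiveMeasure.

Lemma weak_integrand_weak_sol (R : realType) (N : nat) (lam : R) (v d : R -> R) (a : R) :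
  (7 <= N)%N -> sol N (nonlin lam (4 / (N%:R - 2))) a v d ->
  weak_sol lam (@ufun R N v) (@gfun R N d).
Proof.
move=> N7 s p psi Cp /=; rewrite /p {p}.
have n := n7 R N7; have q0 : 0 < 4 / (N%:R - 2) :> R by rewrite divr_gt0//; lra.
have [] := weak_integrand_hint N7 s (@nonlin_cont R lam _ q0) Cp.
suff -> : weak_integrand (nonlin lam (4 / (N%:R - 2))) v d psi = (fun x =>
   confac x ^- 2 * edot (gfun d x) (egrad psi x) - lam * ufun v x * psi x
   - `|ufun v x| `^ (2 * N%:R / (N%:R - 2) - 2) * ufun v x * psi x) by [].
apply/funext => x; rewrite /weak_integrand /nonlin /phi.
have -> : 2 * N%:R / (N%:R - 2) - 2 = 4 / (N%:R - 2) :> R.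
  by field; rewrite gt_eqF//; lra.
by ring.
Qed.

Lemma radial_point (R : realType) (N : nat) (s : R) : (7 <= N)%N -> 0 <= s ->
  exists x : 'rV[R]_N, sqn x = s.
Proof.
case: N => // m _ s0; exists (\row_i (if i == ord0 then Num.sqrt s else 0)).
rewrite /sqn (bigD1 ord0)//= mxE eqxx sqr_sqrtr// big1 ?addr0// => i i0.
by rewrite mxE (negbTE i0) expr0n.
Qed.

Lemma profile_sign_changing (R : realType) (N : nat) (v : R -> R) (x : R) : (7 <= N)%N ->
  continuous (@ufun R N v) -> 0 < v 0 -> 0 < x -> v x < 0 -> sign_changing (@ufun R N v).
Proof.
move=> N7 cu v0 x0 vx; split.
  have [z zE] := radial_point N7 (lexx (0 : R)).
  apply: (ball_meas_gt0 (F := ufun v) (x0 := z)) => //; first by rewrite zE.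
  by rewrite /ufun /uprof /xi zE ltr01 mulr0 mul0r.
(* The inverse of [xi]: the squared Euclidean radius at which cosh r - 1 equals x. *)
pose s := x / (x + 2); have x2 : 0 < x + 2 by lra.
have s1 : s < 1 by rewrite ltr_pdivrMr//; lra.
have s0 : 0 <= s by rewrite divr_ge0; lra.
have [z zE] := radial_point N7 s0.
apply: (ball_meas_gt0 (F := fun x => - ufun v x) (x0 := z)); rewrite ?zE//.
- by move=> y; apply: (@contN R 'rV[R]_N); exact: cu.
- rewrite /ufun /uprof zE s1 oppr_gt0; have -> // : xi s = x.
  by rewrite /xi /s; field; rewrite gt_eqF//=; apply/eqP; lra.
- by move=> y; rewrite oppr_gt0.
Qed.

Lemma profile_distinct (R : realType) (N : nat) (v w : R -> R) : (7 <= N)%N ->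
  continuous (@ufun R N v) -> continuous (@ufun R N w) -> v 0 <> w 0 ->
  distinct_fun (@ufun R N v) (@ufun R N w).
Proof.
move=> N7 cv cw vw; have [z zE] := radial_point N7 (lexx (0 : R)).
apply: (ball_meas_gt0 (F := fun x => `|ufun v x - ufun w x|) (x0 := z)); rewrite ?zE//.
- by move=> y; apply: (@cont_norm R 'rV[R]_N); apply: contB; [exact: cv|exact: cw].
- rewrite normr_gt0 subr_eq0; apply/eqP.
  by rewrite /ufun /uprof /xi zE ltr01 mulr0 mul0r.
- by move=> y; rewrite normr_gt0 subr_eq0 => /eqP.
Qed.

Theorem theorem1p3 (R : realType) (N : nat) (lambda : R) :
  (7 <= N)%N ->
  (N%:R * (N%:R - 2)) / 4 < lambda ->
  lambda < ((N%:R - 1) / 2) ^+ 2 ->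
  exists (u : nat -> ('rV[R]_N -> R)) (G : nat -> ('rV[R]_N -> 'rV[R]_N)),
    (forall n, inH1 (u n) (G n) /\ weak_sol lambda (u n) (G n) /\
               radial (u n) /\ sign_changing (u n)) /\
    (forall n m, n <> m -> distinct_fun (u n) (u m)).
Proof.
move=> N7 lo hi.
have [al hal] := choice (radial_profiles N7 lo hi).
have [v hv] := choice hal; have [d hd] := choice hv.
(* Each profile is sought beyond the initial value of the preceding one: [A k.+1] is the value at
   the origin of solution number k. These values increase strictly, which makes the solutions
   distinct. *)
pose A := fix A k := if k is k'.+1 then al (A k') else 0.
have Amono k : A k < A k.+1 by have [] := hd (A k).
have Alt k l : (k < l)%N -> A k < A l.
  by move=> /subnK <-; elim: (l - k.+1)%N => [|j ih] //; exact: lt_trans ih (Amono _).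
have n := n7 R N7; have q0 : 0 < 4 / (N%:R - 2) :> R by rewrite divr_gt0//; lra.
pose D := ((N%:R - 1) / 2) ^+ 2 - lambda.
have D0 : 0 < D by rewrite subr_gt0.
have D1 : D < 2^-1 by rewrite /D; lra.
have dec k : exists2 C, 0 <= C & forall x : R, 0 <= x ->
   `|v (A k) x| <= C * (x + 1) `^ (- ((N%:R - 1) / 2 + D)) /\
   `|d (A k) x| <= C * (x + 1) `^ (- ((N%:R - 1) / 2 + D) - 1).
  have [_ _ _ _ [C hC]] := hd (A k); exists C => //.
  by have [h _] := hC 0 (lexx 0); move: h; rewrite add0r powR1 mulr1; apply: le_trans.
have sl k : sol N (nonlin lambda (4 / (N%:R - 2))) (A k.+1) (v (A k)) (d (A k)).
  by have [] := hd (A k).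
have cu k : continuous (@ufun R N (v (A k))).
  have [C C0 hC] := dec k.
  exact: (@ufun_cont R N N7 _ _ _ _ (sl k) C D C0 D0 hC).
have v0 k : v (A k) 0 = A k.+1 by have [] := sl k.
exists (fun k => ufun (v (A k))), (fun k => gfun (d (A k))); split=> [k|k l kl].
  have [C C0 hC] := dec k; have [_ a0 _ [x x0 vx] _] := hd (A k).
  split; first exact: (@ufun_inH1 R N N7 _ _ _ _ (sl k) C D C0 D0 D1 hC).
  split; first exact: (weak_integrand_weak_sol N7 (sl k)).
  split; first by move=> y z; rewrite /ufun => ->.
  by apply: (profile_sign_changing N7 (cu k) _ x0 vx); rewrite v0.
apply: (profile_distinct N7 (cu k) (cu l)); rewrite !v0.
have [kl'|kl'|//] := ltngtP k l.
  by have := Alt k.+1 l.+1 kl' => /lt_eqF/eqP.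
by have := Alt l.+1 k.+1 kl' => /gt_eqF/eqP.
Qed.
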